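(* Let $n\ge 1$, let $B_1\subset\mathbb{R}^n$ be the open unit ball, let $s\in(0,1)$, $k\in\mathbb{N}$, and let $f:B_1\times(-1,1)\to\mathbb{R}$ with $f\in C^k(\overline{B_1}\times[-1,1])$. Fix $\varepsilon>0$. Then there exists a function $u\in C^\infty(B_1\times(-1,1))\cap C(\mathbb{R}^{n+1})$ (depending on $\varepsilon$), compactly supported in $\mathbb{R}^{n+1}$, such that $$\partial_t u+(-\Delta)^s u=0\quad\text{in } B_1\times(-1,1)$$ and $$\|u-f\|_{C^k(B_1\times(-1,1))}\le\varepsilon.$$
   Context: Points of $\mathbb{R}^{n+1}$ are written $(x,t)$ with $x\in\mathbb{R}^n$, $t\in\mathbb{R}$. The fractional Laplacian $(-\Delta)^s$ acts on the variable $x$ only: $$(-\Delta)^s u(x,t):=C(n,s)\lim_{\varrho\searrow0}\int_{\mathbb{R}^n\setminus B_\varrho}\frac{u(x,t)-u(x+y,t)}{|y|^{n+2s}}\,dy,\qquad C(n,s):=\frac{4^s\,s\,\Gamma\left(\frac n2+s\right)}{\pi^{n/2}\,\Gamma(1-s)},$$ where $B_\varrho\subset\mathbb{R}^n$ is the ball of radius $\varrho$ centered at $0$ and $\Gamma$ is Euler's Gamma function. $C^k$ on a closed set (closure of an open set) means that all derivatives of order at most $k$ in the interior exist and extend continuously to the closed set; $\|\cdot\|_{C^k}$ is the usual norm given by the suprema of all partial derivatives of order at most $k$. *)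

(* Defs.v *)
From HB Require Import structures.
From mathcomp Require Import all_boot all_order all_algebra.
From mathcomp Require Import all_classical all_reals all_analysis.

Set Implicit Arguments.
Unset Strict Implicit.
Unset Printing Implicit Defensive.
Import Order.TTheory GRing.Theory Num.Theory.
Import numFieldNormedType.Exports.

Local Open Scope classical_set_scope.
Local Open Scope ring_scope.

(* The library has no n-dimensional Lebesgue measure.  It is built here on
   n.-tuple R, which carries the product of the Borel sigma-algebras, as the
   n-fold product of the one-dimensional Lebesgue measure; see
   [lebesgue_tuple_box].  Integrals over R^n of functions of row vectors
   ('rV[R]_n carries the topology) are pulled back along [row_of_tuple]. *)
Section lebesgue_cons.
Local Open Scope ereal_scope.
Context {R : realType} {n : nat}.
Variable mu : {sigma_finite_measure set (n.-tuple (measurableTypeR R)) -> \bar R}.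

Let cons_pair (p : measurableTypeR R * n.-tuple (measurableTypeR R)) :
  n.+1.-tuple (measurableTypeR R) := [tuple of p.1 :: p.2].

Let measurable_cons_pair : measurable_fun setT cons_pair.
Proof. by apply: measurable_cons. Qed.

Definition lebesgue_cons : set (n.+1.-tuple (measurableTypeR R)) -> \bar R :=
  pushforward (lebesgue_measure \x mu) cons_pair.

Let m : {measure set _ -> \bar R} :=
  measure_function_pushforward__canonical__measure_function_Measure
    (lebesgue_measure \x mu)%E measurable_cons_pair.

HB.instance Definition _ := isMeasure.Build _ _ _ lebesgue_cons
  (measure0 m) (measure_ge0 m) (@measure_semi_sigma_additive _ _ _ m).

Lemma lebesgue_consX (A : set R) (B : set (n.-tuple (measurableTypeR R))) :
  measurable (A : set (measurableTypeR R)) -> measurable B ->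
  lebesgue_cons [set v | A (thead v) /\ B [tuple of behead v]] =
  lebesgue_measure A * mu B.
Proof.
move=> mA mB; rewrite /lebesgue_cons /pushforward -product_measure1E//.
congr (product_measure1 _ _ _); apply/seteqP; split=> -[x v] /=.
  rewrite /cons_pair theadE /=; suff -> : [tuple of behead [tuple of x :: v]] = v by [].
  exact: val_inj.
rewrite /cons_pair theadE /=; suff -> : [tuple of behead [tuple of x :: v]] = v by [].
exact: val_inj.
Qed.

Let lebesgue_cons_sigma_finite : sigma_finite setT lebesgue_cons.
Proof.
have /sigma_finiteP[F [TF ndF Foo]] := sigma_finiteT (@lebesgue_measure R).
have /sigma_finiteP[G [TG ndG Goo]] := sigma_finiteT mu.
exists (fun i => [set v | F i (thead v) /\ G i [tuple of behead v]]).
  apply/seteqP; split=> // v _.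
  have [i _ Fi] : (\bigcup_i F i) (thead v) by rewrite -TF.
  have [j _ Gj] : (\bigcup_i G i) [tuple of behead v] by rewrite -TG.
  exists (maxn i j) => //; split.
  - by move: (thead v) Fi; exact/subsetPset/ndF/leq_maxl.
  - by move: [tuple of behead v] Gj; exact/subsetPset/ndG/leq_maxr.
move=> i; have [mF Fi] := Foo i; have [mG Gi] := Goo i; split.
  have mhd : measurable [set v : n.+1.-tuple (measurableTypeR R) | F i (thead v)].
    rewrite -[X in measurable X]setTI.
    exact: (@measurable_tnth _ (measurableTypeR R) n.+1 ord0).
  have mtl : measurable
      [set v : n.+1.-tuple (measurableTypeR R) | G i [tuple of behead v]].
    rewrite -[X in measurable X]setTI.
    exact: (@measurable_behead _ (measurableTypeR R) n).
  exact: measurableI mhd mtl.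
by rewrite lebesgue_consX// lte_mul_pinfty// ge0_fin_numE.
Qed.

HB.instance Definition _ := Measure_isSigmaFinite.Build _ _ _ lebesgue_cons
  lebesgue_cons_sigma_finite.

End lebesgue_cons.

Section lebesgue_tuple.
Local Open Scope ereal_scope.
Context {R : realType}.

Definition lebesgue_tuple0 : set (0.-tuple (measurableTypeR R)) -> \bar R :=
  dirac [tuple].

HB.instance Definition _ := Measure.on lebesgue_tuple0.

Let lebesgue_tuple0_sigma_finite : sigma_finite setT lebesgue_tuple0.
Proof.
apply: fin_num_fun_sigma_finite; first by rewrite measure0.
by move=> A _; rewrite /lebesgue_tuple0 diracE.
Qed.

HB.instance Definition _ := Measure_isSigmaFinite.Build _ _ _ lebesgue_tuple0
  lebesgue_tuple0_sigma_finite.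

Fixpoint lebesgue_tuple n :
    {sigma_finite_measure set (n.-tuple (measurableTypeR R)) -> \bar R} :=
  if n is n'.+1 then lebesgue_cons (lebesgue_tuple n') else lebesgue_tuple0.

Lemma measurable_box n (A : 'I_n -> set R) :
  (forall i, measurable (A i : set (measurableTypeR R))) ->
  measurable [set v : n.-tuple (measurableTypeR R) | forall i, A i (tnth v i)].
Proof.
move=> mA; rewrite (_ : [set _ | _] =
    \bigcap_(i in [set: 'I_n]) ((@tnth n (measurableTypeR R))^~ i @^-1` A i)).
  apply: fin_bigcap_measurable => [|i _]; first exact: finite_finset.
  rewrite -[X in measurable X]setTI.
  exact: measurable_tnth.
by apply/seteqP; split=> [v Av i _|v Av i]; [exact: Av|exact: (Av i)].
Qed.

Lemma lebesgue_tuple_box n (A : 'I_n -> set R) :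
  (forall i, measurable (A i : set (measurableTypeR R))) ->
  lebesgue_tuple n [set v | forall i, A i (tnth v i)] =
  \prod_(i < n) lebesgue_measure (A i).
Proof.
elim: n A => [|n IHn] A mA.
  rewrite big_ord0 /= /lebesgue_tuple0 (_ : [set _ | _] = setT) ?diracT//.
  by apply/seteqP; split=> // v _ [].
rewrite big_ord_recl -(IHn (fun i => A (lift ord0 i)))//.
rewrite -lebesgue_consX//; last exact: (@measurable_box _ (fun i => A (lift ord0 i))).
rewrite [lebesgue_tuple _]/=; congr (lebesgue_cons _ _).
apply/seteqP; split=> v /=.
  move=> Av; split; first exact: Av.
  by move=> i; have := Av (lift ord0 i); rewrite {1}(tuple_eta v) tnthS.
move=> [A0 Av] i; case: (unliftP ord0 i) => [j|] -> //.
by rewrite (tuple_eta v) tnthS.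
Qed.

End lebesgue_tuple.

Section space_time.
Context {R : realType} {n : nat}.
Implicit Types (s t : R) (x y : 'rV[R]_n) (p : 'rV[R]_n * R).
Implicit Types (u f g : 'rV[R]_n * R -> R) (Omega : set ('rV[R]_n * R)).

Definition row_of_tuple (v : n.-tuple (measurableTypeR R)) : 'rV[R]_n :=
  \row_i tnth v i.

(* [`|y|] is the sup norm on 'rV[R]_n. *)
Definition enorm y : R := Num.sqrt (\sum_i y 0 i ^+ 2).

Definition unit_ball : set 'rV[R]_n := [set x | enorm x < 1].

Definition cylinder : set ('rV[R]_n * R) := unit_ball `*` `]-1, 1[.

(* [Some i] is the i-th space variable, [None] is time. *)
Definition dir (i : option 'I_n) : 'rV[R]_n * R :=
  if i is Some j then (delta_mx 0 j, 0) else (0, 1).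

Definition partial (i : option 'I_n) u : 'rV[R]_n * R -> R := 'D_(dir i) u.

Definition partials (a : seq (option 'I_n)) u : 'rV[R]_n * R -> R :=
  foldr partial u a.

Definition has_partials k Omega u : Prop :=
  forall i a, (size a < k)%N ->
  forall p, Omega p -> derivable (partials a u) p (dir i).

(* These are meant for open sets [Omega]: then the derivatives on [Omega], and
   hence the predicates and the norm below, only depend on the values of the
   total function on [Omega]. *)
Definition Ck_on k Omega u : Prop :=
  has_partials k Omega u /\
  forall a, (size a <= k)%N ->
  forall p, Omega p -> {for p, continuous (partials a u)}.

Definition Coo_on Omega u : Prop := forall k, Ck_on k Omega u.

Definition Ck_closure k Omega u : Prop :=
  has_partials k Omega u /\
  forall a, (size a <= k)%N ->
  exists2 g, {within closure Omega, continuous g} &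
             forall p, Omega p -> partials a u p = g p.

Definition Ck_norm k Omega u : \bar R :=
  ereal_sup [set ereal_sup [set `|partials a u p|%:E | p in Omega]
            | a in [set a | (size a <= k)%N]].

Definition supp u : set ('rV[R]_n * R) := closure [set p | u p != 0].

Definition Gamma (z : R) : R :=
  \int[lebesgue_measure]_(r in `]0, +oo[) (r `^ (z - 1) * expR (- r)).

Definition frac_const s : R :=
  4 `^ s * s * Gamma (n%:R / 2 + s) / (pi `^ (n%:R / 2) * Gamma (1 - s)).

Definition frac_integrand s u x t y : R :=
  (u (x, t) - u (x + y, t)) / enorm y `^ (n%:R + 2 * s).

Definition ball_compl (rho : R) : set (n.-tuple (measurableTypeR R)) :=
  [set v | rho <= enorm (row_of_tuple v)].

Definition frac_truncated s u x t (rho : R) : R :=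
  \int[lebesgue_tuple n]_(v in ball_compl rho)
     frac_integrand s u x t (row_of_tuple v).

(* [Rintegral] and [lim] are total functions; this says that the integrals and
   the limit in [frac_laplacian] exist. *)
Definition frac_laplacian_exists s u x t : Prop :=
  (forall rho : R, 0 < rho ->
     (lebesgue_tuple n).-integrable (ball_compl rho)
       (fun v => (frac_integrand s u x t (row_of_tuple v))%:E)) /\
  cvg (frac_truncated s u x t rho @[rho --> 0^'+]).

Definition frac_laplacian s u x t : R :=
  frac_const s * lim (frac_truncated s u x t rho @[rho --> 0^'+]).

End space_time.

Arguments unit_ball R n : clear implicits.
Arguments cylinder R n : clear implicits.
Arguments frac_const {R} n s.

(* Main.v *)
Require Import Defs.
From HB Require Import structures.
From mathcomp Require Import all_boot all_order all_algebra.
From mathcomp Require Import all_classical all_reals all_analysis measurable_realfun.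
From mathcomp Require Import ring lra.
Import Order.TTheory GRing.Theory Num.Theory.
Import numFieldNormedType.Exports.

Set Implicit Arguments.
Unset Strict Implicit.
Unset Printing Implicit Defensive.

Local Open Scope classical_set_scope.
Local Open Scope ring_scope.

(** The fractional Laplacian L is nonlocal: a source placed far away produces,
    near the unit ball, a smooth potential, and these potentials are dense among
    continuous functions. This flexibility allows to correct an approximation
    of f so that it solves the equation exactly, at a small cost in size.

    Density ([far_potential_density]). Point sources at y give the functions
    |y - x|^(-n-2s) of x. Laplacians in y give |y - x|^(-n-2s-2j) for all j;
    polynomials in |y - x|^(-2) then give the Gaussian of center y by the
    Weierstrass theorem, that is e^(x.y) up to factors which depend on x alone
    or on y alone. The exponentials e^(x.y), y in a half space, are dense.

    Elliptic step ([elliptic_approximation]). Given h and F, there is u close to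
    F near the ball with u + L u = h exactly there. A function close to F has
    some residual; a far potential removes most of it; the small rest is removed
    by the resolvent of L ([resolvent_solution], for a variant of L whose long
    jumps are damped by a cutoff), which by the maximum principle only adds a
    small function.

    Time ([caloric_approximation]). By the Stone-Weierstrass theorem a continuous
    F is close to e^t sum_j t^j / j! g_j(x). Solving psi_j + L psi_j = - psi_(j+1)
    with psi_j close to g_j, downwards in j, makes e^t sum_j t^j / j! psi_j an
    exact solution that is uniformly close to F.

    Smoothness. The convolution of a solution with a smooth kernel is a smooth
    solution in a slightly smaller cylinder ([mollified_equation]), and its
    derivatives are convolutions with derivatives of the kernel. So f is first
    dilated, to be defined around the closed cylinder, then extended to a
    continuous function F whose convolution is C^k close to f
    ([partials_M_inner], [M_close]). For this fixed kernel, a solution that is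
    uniformly close enough to F has a convolution that is C^k close to that of F.

    The solutions have bounded second differences, so that the principal value
    that defines L is an absolutely convergent symmetrized integral
    ([frac_laplacian_frac]). *)

(** * Measurability and invariance on tuples *)

Section row_vector_norm.
Context {R : realType} {n : nat}.
Implicit Types x : 'rV[R]_n.

Lemma coord_le_norm x i : `|x 0 i| <= `|x|.
Proof.
rewrite {2}/Num.norm /= mx_normrE.
exact: (le_bigmax _ (fun ij : 'I_1 * 'I_n => `|x ij.1 ij.2|) (0, i)).
Qed.

Lemma norm_le_coord x e : 0 <= e -> (forall i, `|x 0 i| <= e) -> `|x| <= e.
Proof.
move=> e0 xe; rewrite {1}/Num.norm /= mx_normrE.
by apply/bigmax_leP; split => // -[i j] _ /=; rewrite ord1.
Qed.

Lemma norm_lt_coord x e : 0 < e -> (forall i, `|x 0 i| < e) -> `|x| < e.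
Proof.
move=> e0 xe; rewrite {1}/Num.norm /= mx_normrE.
by apply/bigmax_ltP; split => // -[i j] _ /=; rewrite ord1.
Qed.

End row_vector_norm.

(** Tuples carry the product sigma-algebra and row vectors a topology. Rounding
    the argument of g down to a grid of mesh 1 / (m + 1) gives functions with
    countably many values, measurable by the coordinatewise hypotheses, which
    converge to x |-> g (phi x, tau x). *)
Lemma measurable_continuous_comp {R : realType} d (X : measurableType d) n
    (g : 'rV[R]_n * R -> R) (phi : X -> 'rV[R]_n) (tau : X -> R) :
  continuous g -> (forall i, measurable_fun setT (fun x => phi x 0 i)) ->
  measurable_fun setT tau -> measurable_fun setT (fun x => g (phi x, tau x)).
Proof.
move=> cg mphi mtau.
pose fl (m : nat) (a : R) := Num.floor (a * m.+1%:R).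
pose code (m : nat) x := ([ffun i => fl m (phi x 0 i)], fl m (tau x)).
pose dec (m : nat) (k : {ffun 'I_n -> int} * int) : 'rV[R]_n * R :=
  (\row_i ((k.1 i)%:~R / m.+1%:R), k.2%:~R / m.+1%:R).
have mfl m (f : X -> R) k : measurable_fun setT f ->
    measurable [set x | fl m (f x) = k].
  move=> mf; rewrite (_ : [set _ | _] =
    f @^-1` `[k%:~R / m.+1%:R, (k + 1)%:~R / m.+1%:R[).
    by rewrite -[X in measurable X]setTI; apply: mf.
  apply/seteqP; split=> x /=.
    move=> <-; rewrite in_itv /= ler_pdivrMr // ltr_pdivlMr //.
    by rewrite /fl floor_le // floorD1_gt.
  rewrite in_itv /= ler_pdivrMr // ltr_pdivlMr // => H.
  exact: floor_def.
have mcode m (k : {ffun 'I_n -> int} * int) : measurable [set x | code m x = k].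
  rewrite (_ : [set _ | _] = (\bigcap_(i in [set: 'I_n])
      [set x | fl m (phi x 0 i) = k.1 i]) `&` [set x | fl m (tau x) = k.2]).
    apply: measurableI; last exact: mfl.
    by apply: fin_bigcap_measurable => [|i _]; [exact: finite_finset|exact: mfl].
  apply/seteqP; split=> x /=.
    by case: k => k1 k2 /= [<- <-]; split=> // i _; rewrite ffunE.
  move=> [H1 H2]; rewrite /code H2; case: k H1 H2 => k1 k2 /= H1 H2.
  by congr pair; apply/ffunP => i; rewrite ffunE H1.
apply: (@measurable_fun_cvg _ _ _ _ (fun m x => g (dec m (code m x)))).
  move=> m _ B mB; rewrite setTI.
  rewrite (_ : _ @^-1` _ =
      \bigcup_(k in [set k | B (g (dec m k))]) [set x | code m x = k]).
    rewrite bigcup_mkcond; apply: countable_bigcupT_measurable => [|k]; first exact: countableP.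
    by case: ifP.
  apply/seteqP; split=> x /=; first by move=> ?; exists (code m x).
  by move=> [k /= + E]; rewrite -E.
have flE m (a : R) : `|a - (fl m a)%:~R / m.+1%:R| <= m.+1%:R^-1.
  rewrite -(ler_pM2r (_ : 0 < m.+1%:R)) // mulVf // -[X in _ * X]gtr0_norm //.
  rewrite -normrM mulrBl divfK // ler_norml.
  have := floor_le (a * m.+1%:R).
  by have := ltW (floorD1_gt (a * m.+1%:R)); rewrite rmorphD /= -/(fl m a); lra.
move=> x _.
have small : m.+1%:R^-1 @[m --> \oo] --> (0 : R) by exact: cvg_harmonic.
suff cdec : dec m (code m x) @[m --> \oo] --> (phi x, tau x).
  exact: (cvg_comp _ _ cdec (cg _)).
apply/cvgrPdist_le => /= e e0; near=> m.
have me : m.+1%:R^-1 <= e.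
  near: m; move/cvgrPdist_le : small => /(_ _ e0); apply: filterS => m.
  by rewrite sub0r normrN ger0_norm.
rewrite prod_normE /= ge_max; apply/andP; split; apply: (le_trans _ me).
  by apply: norm_le_coord => // i; rewrite !mxE ffunE; exact: flE.
exact: flE.
Unshelve. all: by end_near. Qed.

Section measure_preserving_coordinates.
Context {R : realType}.
Local Open Scope ereal_scope.

Lemma lebesgue_measure_translation (c : R) (A : set R) :
  measurable (A : set (measurableTypeR R)) ->
  lebesgue_measure ((fun x => x + c)%R @^-1` A) = lebesgue_measure A.
Proof.
move=> mA.
have mD : measurable_fun [set: measurableTypeR R]
    ((fun x => x + c)%R : _ -> measurableTypeR R) by exact: measurable_funD.
pose f := HB.pack_for {mfun measurableTypeR R >-> measurableTypeR R}
   ((fun x => x + c)%R : measurableTypeR R -> measurableTypeR R)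
   (isMeasurableFun.Build _ _ _ _ _ mD).
rewrite -[LHS]/(pushforward lebesgue_measure f A).
apply/esym/lebesgue_measure_unique => //= _ [[a b]] _ <-.
rewrite /pushforward (_ : _ @^-1` _ = `](a - c)%R, (b - c)%R]%classic).
  by rewrite !lebesgue_measure_itv/= !lte_fin ltrD2r; case: ifP => // _; congr (_%:E); ring.
by apply/seteqP; split=> x /=; rewrite !in_itv/= ltrBlDr lerBrDr.
Qed.

(** Sections reduce the claim to one coordinate at a time. Translations and
    the reflection through the origin are of this form. *)
Lemma lebesgue_tuple_map n (f : 'I_n -> R -> R) :
  (forall i, measurable_fun [set: measurableTypeR R]
     (f i : measurableTypeR R -> measurableTypeR R)) ->
  (forall i (A : set R), measurable (A : set (measurableTypeR R)) ->
     lebesgue_measure (f i @^-1` A) = lebesgue_measure A) ->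
  forall A : set (n.-tuple (measurableTypeR R)), measurable A ->
  lebesgue_tuple n ((fun v => [tuple f i (tnth v i) | i < n]) @^-1` A) =
  lebesgue_tuple n A.
Proof.
elim: n f => [|n IHn] f mf pf A mA.
  congr (lebesgue_tuple 0 _); rewrite -[RHS]preimage_id; congr (_ @^-1` A).
  by apply/funext => v; apply: eq_from_tnth => -[].
pose cp (p : measurableTypeR R * n.-tuple (measurableTypeR R)) :
  n.+1.-tuple (measurableTypeR R) := [tuple of p.1 :: p.2].
have mcp : measurable_fun setT cp by exact: measurable_cons.
pose C := cp @^-1` A.
have mC : measurable C by rewrite -[C]setTI; exact: mcp.
pose f' i := f (lift ord0 i).
pose g' (v : n.-tuple (measurableTypeR R)) : n.-tuple (measurableTypeR R) :=
  [tuple f' i (tnth v i) | i < n].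
rewrite /= -[LHS]/(\int[lebesgue_measure]_x (lebesgue_tuple n (xsection
   (cp @^-1` ((fun v => [tuple f i (tnth v i) | i < n.+1]) @^-1` A)) x))).
rewrite -[RHS]/(\int[lebesgue_measure]_x (lebesgue_tuple n (xsection C x))).
transitivity (\int[lebesgue_measure]_x (lebesgue_tuple n (xsection C (f ord0 x)))).
  apply: eq_integral => x _.
  rewrite -[RHS](IHn f'); first last.
  - exact: measurable_xsection.
  - by move=> i; exact: pf.
  - by move=> i; exact: mf.
  congr (lebesgue_tuple n _); apply/seteqP; split=> v;
    rewrite /xsection /= !inE /C /=; congr A; apply: eq_from_tnth => i;
    rewrite !tnth_mktuple; case: (unliftP ord0 i) => [j|] ->;
    rewrite /= ?tnthS ?tnth_mktuple ?tnth0 //.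
have mphi : measurable_fun [set: measurableTypeR R]
   (fun x => lebesgue_tuple n (xsection C x)) by exact: measurable_fun_xsection.
pose f0 := HB.pack_for {mfun measurableTypeR R >-> measurableTypeR R}
   (f ord0 : measurableTypeR R -> measurableTypeR R)
   (isMeasurableFun.Build _ _ _ _ _ (mf ord0)).
transitivity (\int[pushforward lebesgue_measure f0]_x (lebesgue_tuple n (xsection C x))).
  by rewrite ge0_integral_pushforward.
apply: eq_measure_integral => B mB _; exact: pf.
Qed.

End measure_preserving_coordinates.

(** * Real integrals *)

Section real_integral.
Context d {T : measurableType d} {R : realType}.
Variable mu : {measure set T -> \bar R}.
Implicit Types f g : T -> R.

Definition Itg f := mu.-integrable setT (EFin \o f).
Definition J f : R := \int[mu]_x f x.

Lemma Itg_meas f : Itg f -> measurable_fun setT f.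
Proof. by move=> /measurable_int/measurable_EFinP. Qed.

Lemma Itg_le f g : measurable_fun setT f -> (forall x, `|f x| <= g x) ->
  Itg g -> Itg f.
Proof.
move=> mf fg; apply: le_integrable => //; first exact/measurable_EFinP.
by move=> x _ /=; rewrite lee_fin (le_trans (fg x)) // ler_norm.
Qed.

Lemma ItgD f g : Itg f -> Itg g -> Itg (fun x => f x + g x).
Proof. by move=> If Ig; exact: (integrableD _ If Ig). Qed.

Lemma ItgZ c f : Itg f -> Itg (fun x => c * f x).
Proof. by move=> If; exact: (integrableZl _ c If). Qed.

Lemma ItgN f : Itg f -> Itg (fun x => - f x).
Proof.
move=> /(ItgZ (-1)); congr Itg; apply/funext => x; by rewrite mulN1r.
Qed.

Lemma ItgB f g : Itg f -> Itg g -> Itg (fun x => f x - g x).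
Proof. by move=> If /ItgN; exact: ItgD. Qed.

Lemma Itg_abs f : Itg f -> Itg (fun x => `|f x|).
Proof.
move=> If; apply: (le_integrable _ _ _ If) => //.
  exact/measurable_EFinP/measurableT_comp/Itg_meas.
by move=> x _ /=; rewrite normr_id.
Qed.

Lemma JD f g : Itg f -> Itg g -> J (fun x => f x + g x) = J f + J g.
Proof. exact: RintegralD. Qed.

Lemma JB f g : Itg f -> Itg g -> J (fun x => f x - g x) = J f - J g.
Proof. exact: RintegralB. Qed.

Lemma JZ c f : Itg f -> J (fun x => c * f x) = c * J f.
Proof. exact: RintegralZl. Qed.

Lemma JN f : Itg f -> J (fun x => - f x) = - J f.
Proof.
move=> If; rewrite -mulN1r -JZ //; congr J.
by apply/funext => x; rewrite mulN1r.
Qed.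

Lemma J0 : J (fun=> 0) = 0.
Proof. by rewrite /J /Rintegral integral0. Qed.

Lemma J_le f g : Itg f -> Itg g -> (forall x, f x <= g x) -> J f <= J g.
Proof. by move=> If Ig fg; exact: le_Rintegral. Qed.

Lemma J_ge0 f : (forall x, 0 <= f x) -> 0 <= J f.
Proof. by move=> f0; exact: Rintegral_ge0. Qed.

Lemma J_norm_le f g : measurable_fun setT f -> (forall x, `|f x| <= g x) ->
  Itg g -> `|J f| <= J g.
Proof.
move=> mf fg Ig; have If := Itg_le mf fg Ig.
apply: (le_trans (le_normr_Rintegral _ If)) => //.
by apply: J_le => //; exact: Itg_abs.
Qed.

End real_integral.

Section preserving_integral.
Context {R : realType} {n : nat}.
Local Notation T := (n.-tuple (measurableTypeR R)).
Local Notation mu := (@lebesgue_tuple R n).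
Variable f : 'I_n -> R -> R.
Hypothesis mf : forall i, measurable_fun [set: measurableTypeR R]
     (f i : measurableTypeR R -> measurableTypeR R).
Hypothesis pf : forall i (A : set R), measurable (A : set (measurableTypeR R)) ->
     lebesgue_measure (f i @^-1` A) = lebesgue_measure A.

Let g (v : T) : T := [tuple f i (tnth v i) | i < n].

Let mg : measurable_fun setT g.
Proof.
apply/measurable_fun_tnthP => i.
rewrite (_ : _ \o _ = f i \o (fun v : T => tnth v i)).
  exact: (measurableT_comp (mf i) (@measurable_tnth _ (measurableTypeR R) n i)).
by apply/funext => v /=; rewrite tnth_mktuple.
Qed.

Let ge0_tuple_map (h : T -> \bar R) : measurable_fun setT h ->
  (forall x, (0 <= h x)%E) -> (\int[mu]_v h (g v) = \int[mu]_v h v)%E.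
Proof.
move=> mh h0.
pose g0 := HB.pack_for {mfun T >-> T} g (isMeasurableFun.Build _ _ _ _ _ mg).
transitivity (\int[pushforward mu g0]_v h v)%E.
  by rewrite ge0_integral_pushforward.
by apply: eq_measure_integral => A mA _; exact: lebesgue_tuple_map.
Qed.

Lemma J_tuple_map (h : T -> R) : measurable_fun setT h ->
  J mu (fun v => h (g v)) = J mu h.
Proof.
move=> mh; have mh' : measurable_fun setT (EFin \o h) by exact/measurable_EFinP.
have hp := ge0_tuple_map (measurable_funepos mh') (funepos_ge0 _).
have hn := ge0_tuple_map (measurable_funeneg mh') (funeneg_ge0 _).
rewrite /J /Rintegral [in LHS]integralE [in RHS]integralE -hp -hn.
by congr (fine (_ - _)%E); apply: eq_integral => v _; rewrite ?funeposE ?funenegE.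
Qed.

Lemma Itg_tuple_map (h : T -> R) : Itg mu h -> Itg mu (fun v => h (g v)).
Proof.
move=> Ih; have mh := Itg_meas Ih; move/integrableP: Ih => [_ hoo].
apply/integrableP; split.
  by apply/measurable_EFinP; exact: measurableT_comp mh mg.
rewrite (ge0_tuple_map (h := fun v => `|(h v)%:E|%E)) //.
by apply: measurableT_comp => //; exact/measurable_EFinP.
Qed.

End preserving_integral.

Section row_measurability.
Context {R : realType} {n : nat}.
Local Notation T := (n.-tuple (measurableTypeR R)).
Local Notation rt := (@row_of_tuple R n).

Lemma measurable_row_coord i : measurable_fun setT (fun v : T => rt v 0 i).
Proof.
under eq_fun do rewrite mxE; exact: measurable_tnth.
Qed.

Lemma measurable_continuous_row d (X : measurableType d) (phi : X -> 'rV[R]_n)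
    (h : 'rV[R]_n -> R) : continuous h ->
  (forall i, measurable_fun setT (fun x => phi x 0 i)) ->
  measurable_fun setT (fun x => h (phi x)).
Proof.
move=> ch mphi.
apply: (@measurable_continuous_comp _ _ _ _ (fun p => h p.1) phi (fun=> 0)) => //.
by move=> p; apply: continuous_comp; [exact: cvg_fst|exact: ch].
Qed.

Lemma meas_row (h : 'rV[R]_n -> R) : continuous h ->
  measurable_fun setT (fun v : T => h (rt v)).
Proof. by move=> ch; exact: measurable_continuous_row measurable_row_coord. Qed.

Lemma row_tuple_translate (c : 'rV[R]_n) (v : T) :
  rt v + c = rt [tuple tnth v i + c 0 i | i < n].
Proof. by apply/rowP => i; rewrite !mxE tnth_mktuple. Qed.

Lemma row_tuple_opp (v : T) : - rt v = rt [tuple - tnth v i | i < n].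
Proof. by apply/rowP => i; rewrite !mxE tnth_mktuple. Qed.

Lemma J_translate (c : 'rV[R]_n) (h : 'rV[R]_n -> R) :
  measurable_fun setT (fun v : T => h (rt v)) ->
  J (lebesgue_tuple n) (fun v => h (rt v + c)) =
  J (lebesgue_tuple n) (fun v => h (rt v)).
Proof.
move=> mh; under eq_fun do rewrite row_tuple_translate.
apply: (@J_tuple_map R n (fun i x => x + c 0 i) _ _ (fun v => h (rt v))) => //.
  by move=> i; exact: measurable_funD.
by move=> i A; exact: lebesgue_measure_translation.
Qed.

Lemma Itg_translate (c : 'rV[R]_n) (h : 'rV[R]_n -> R) :
  Itg (lebesgue_tuple n) (fun v => h (rt v)) ->
  Itg (lebesgue_tuple n) (fun v => h (rt v + c)).
Proof.
move=> Ih; under eq_fun do rewrite row_tuple_translate.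
apply: (@Itg_tuple_map R n (fun i x => x + c 0 i) _ _ (fun v => h (rt v))) => //.
  by move=> i; exact: measurable_funD.
by move=> i A; exact: lebesgue_measure_translation.
Qed.

Lemma J_opp (h : 'rV[R]_n -> R) :
  measurable_fun setT (fun v : T => h (rt v)) ->
  J (lebesgue_tuple n) (fun v => h (- rt v)) =
  J (lebesgue_tuple n) (fun v => h (rt v)).
Proof.
move=> mh; under eq_fun do rewrite row_tuple_opp.
apply: (@J_tuple_map R n (fun i x => - x) _ _ (fun v => h (rt v))) => //.
  by move=> i; exact: oppr_measurable.
by move=> i A mA; rewrite -[RHS](lebesgue_measureN mA).
Qed.

Lemma Itg_opp (h : 'rV[R]_n -> R) :
  Itg (lebesgue_tuple n) (fun v => h (rt v)) ->
  Itg (lebesgue_tuple n) (fun v => h (- rt v)).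
Proof.
move=> Ih; under eq_fun do rewrite row_tuple_opp.
apply: (@Itg_tuple_map R n (fun i x => - x) _ _ (fun v => h (rt v))) => //.
  by move=> i; exact: oppr_measurable.
by move=> i A mA; rewrite -[RHS](lebesgue_measureN mA).
Qed.

End row_measurability.

(** * The kernel |y|^(-n-2s) *)

Lemma dyadic_interval {R : realType} (t : R) : 1 <= t ->
  exists j, 2 ^+ j <= t /\ t < 2 ^+ j.+1 :> R.
Proof.
move=> t1; have ex : exists j, t < 2 ^+ j.+1.
  exists (Num.trunc t); apply: (lt_le_trans (truncnS_gt t)).
  by rewrite -natrX ler_nat ltnW // ltn_expl.
exists (ex_minn ex); case: ex_minnP => -[|j] tj jmin; split => //.
by rewrite leNgt; apply/negP => /jmin; rewrite ltnn.
Qed.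

(** f is dominated by the sum of the c j on A j, whose integral is at most a
    geometric series. With dyadic shells for A j, powers of the distance to the
    origin are integrated without polar coordinates. *)
Lemma Itg_geometric {R : realType} d (T : measurableType d)
    (mu : {measure set T -> \bar R}) (f : T -> R) (A : nat -> set T)
    (c : nat -> R) (C q : R) :
  measurable_fun setT f -> (forall v, 0 <= f v) ->
  (forall j, measurable (A j)) -> (forall j, 0 <= c j) -> 0 <= q -> q < 1 ->
  (forall j, ((c j)%:E * mu (A j) <= (C * q ^+ j)%:E)%E) ->
  (forall v, f v = 0 \/ exists2 j, A j v & f v <= c j) ->
  Itg mu f.
Proof.
move=> mf f0 mA c0 q0 q1 cA fA; apply/integrableP; split.
  exact/measurable_EFinP.
pose g j v := ((c j)%:E * (\1_(A j) v)%:E)%E.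
have mg j : measurable_fun setT (g j).
  by apply/measurable_funeM/measurable_EFinP/measurable_indic.
have g0 j v : (0 <= g j v)%E by rewrite /g mule_ge0 ?lee_fin.
apply: (@le_lt_trans _ _ (\int[mu]_v (\sum_(0 <= j <oo) g j v))%E).
  apply: ge0_le_integral => //.
  - by apply: measurableT_comp => //; exact/measurable_EFinP.
  - by apply: (@ge0_emeasurable_sum _ _ _ _ g xpredT) => // k _; exact: mg.
  move=> v _; rewrite /= ger0_norm //; case: (fA v) => [->|[j Aj fj]].
    exact: nneseries_ge0.
  apply: (@le_trans _ _ (g j v)); first by rewrite /g indicE mem_set // mule1 lee_fin.
  apply: le_trans (nneseries_lim_ge (m := 0) (P := xpredT) j.+1 _) => //.
  rewrite big_nat_recr //= leeDr // sume_ge0 //.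
rewrite integral_nneseries //.
apply: (@le_lt_trans _ _ (C / (1 - q))%:E); last exact: ltry.
apply: lime_le.
  by apply: is_cvg_nneseries => j _ _; exact: integral_ge0.
apply: nearW => k; apply: (@le_trans _ _ (\sum_(0 <= j < k) (C * q ^+ j)%:E)%E).
  apply: lee_sum => j _; rewrite /g ge0_integralZl_EFin //; last first.
    exact/measurable_EFinP/measurable_indic.
  by rewrite integral_indic // setIT.
have C0 : 0 <= C.
  by move: (cA 0%N); rewrite expr0 mulr1 -lee_fin; apply: le_trans; rewrite mule_ge0 ?lee_fin.
rewrite sumEFin lee_fin.
have -> : \sum_(0 <= j < k) C * q ^+ j = series (geometric C q) k by [].
rewrite geometric_seriesE ?lt_eqF //=.
apply: ler_wpM2r; first by rewrite invr_ge0 subr_ge0 ltW.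
by rewrite ler_piMr // lerBlDr lerDl exprn_ge0.
Qed.

Section kernel.
Context {R : realType} {n : nat}.
Local Notation T := (n.-tuple (measurableTypeR R)).
Local Notation rt := (@row_of_tuple R n).
Local Notation mu := (@lebesgue_tuple R n).
Implicit Types x y : 'rV[R]_n.

Lemma enorm_ge0 y : 0 <= enorm y.
Proof. exact: sqrtr_ge0. Qed.

Lemma enormN y : enorm (- y) = enorm y.
Proof. by congr Num.sqrt; apply: eq_bigr => i _; rewrite mxE sqrrN. Qed.

Lemma sqr_enorm y : enorm y ^+ 2 = \sum_i y 0 i ^+ 2.
Proof. by rewrite sqr_sqrtr // sumr_ge0 // => i _; exact: sqr_ge0. Qed.

Lemma norm_le_enorm y : `|y| <= enorm y.
Proof.
apply: norm_le_coord => [|i]; first exact: enorm_ge0.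
rewrite -(ler_pXn2r (_ : 0 < 2)%N) ?nnegrE ?enorm_ge0 //.
rewrite sqr_enorm (bigD1 i) //= real_normK ?num_real // lerDl sumr_ge0 //.
by move=> j _; exact: sqr_ge0.
Qed.

Lemma enorm_continuous : continuous (@enorm R n).
Proof.
move=> x; apply: (@continuous_comp _ _ _ (fun y : 'rV[R]_n => \sum_i y 0 i ^+ 2)).
  apply: (continuous_big (op := +%R)) => [|i _ z]; first exact: add_continuous.
  apply: (@continuous_comp _ _ _ (fun y : 'rV[R]_n => y 0 i) (fun t => t ^+ 2)).
    exact: coord_continuous.
  exact: exprn_continuous.
exact: sqrt_continuous.
Qed.

Definition ball_box (r : R) : set T := [set v | forall i, `[- r, r]%classic (tnth v i)].

Lemma measurable_ball_box r : measurable (ball_box r).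
Proof. by apply: (@measurable_box R n (fun=> `[- r, r]%classic)). Qed.

Lemma measure_ball_box r : 0 <= r -> mu (ball_box r) = ((2 * r) ^+ n)%:E.
Proof.
move=> r0; rewrite (@lebesgue_tuple_box R n (fun=> `[- r, r]%classic)) // (eq_bigr (fun=> (2 * r)%:E)).
  by rewrite prodEFin prodr_const card_ord.
move=> i _; rewrite lebesgue_measure_itv /= lte_fin; case: ifPn => [_|].
  by rewrite opprK -mulr2n mulr_natl.
rewrite -leNgt => r1; have -> : r = 0 by lra.
by rewrite mulr0.
Qed.

Lemma ball_boxP r v : 0 <= r -> `|rt v| <= r -> ball_box r v.
Proof.
move=> r0 vr i /=; rewrite in_itv /= -ler_norml.
by have := coord_le_norm (rt v) i; rewrite mxE => /le_trans; apply.
Qed.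

Variable s : R.
Hypotheses (s0 : 0 < s) (s1 : s < 1).

Definition kexp : R := n%:R + 2 * s.

(** Its value at 0 is 0. *)
Definition riesz y : R := (enorm y `^ kexp)^-1.

Lemma kexp_gt0 : 0 < kexp.
Proof. by rewrite /kexp ltr_wpDl // mulr_gt0. Qed.

Lemma riesz_ge0 y : 0 <= riesz y.
Proof. by rewrite invr_ge0 powR_ge0. Qed.

Lemma rieszN y : riesz (- y) = riesz y.
Proof. by rewrite /riesz enormN. Qed.

Lemma measurable_riesz : measurable_fun setT (fun v : T => riesz (rt v)).
Proof.
under eq_fun do rewrite /riesz -powRN.
apply: (measurableT_comp (measurable_powR _)).
by apply: meas_row; exact: enorm_continuous.
Qed.

(** The size, up to a constant, of the second differences in the direction y
    of a bounded C^{1,1} function. *)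
Definition m2 y : R := Num.min 1 (`|y| ^+ 2).

Lemma m2_ge0 y : 0 <= m2 y.
Proof. by rewrite le_min ler01 exprn_ge0. Qed.

Lemma m2_le1 y : m2 y <= 1.
Proof. by rewrite ge_min lexx. Qed.

Lemma m2_le_sqr y : m2 y <= `|y| ^+ 2.
Proof. by rewrite ge_min lexx orbT. Qed.

Lemma m2_const (i0 : 'I_n) : m2 (const_mx 1) = 1.
Proof.
rewrite /m2 (_ : `|const_mx 1 : 'rV[R]_n| = 1) ?expr1n ?minxx //.
apply/eqP; rewrite eq_le; apply/andP; split.
  by apply: norm_le_coord => // i; rewrite mxE normr1.
by have := coord_le_norm (const_mx 1 : 'rV[R]_n) i0; rewrite mxE normr1.
Qed.

Lemma m2_continuous : continuous m2.
Proof.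
move=> x; apply: (@continuous_min _ _ (fun=> 1) (fun y : 'rV[R]_n => `|y| ^+ 2)).
  exact: cst_continuous.
apply: (@continuous_comp _ _ _ (fun y : 'rV[R]_n => `|y|) (fun t => t ^+ 2)).
  exact: norm_continuous.
exact: exprn_continuous.
Qed.

Lemma measurable_m2riesz :
  measurable_fun setT (fun v : T => m2 (rt v) * riesz (rt v)).
Proof.
apply: measurable_funM; last exact: measurable_riesz.
by apply: meas_row; exact: m2_continuous.
Qed.

Let pow2_gt1 (p : R) : 0 < p -> 1 < 2 `^ p :> R.
Proof.
move=> p0; have := gt0_ltr_powR p0 (x := 1) (y := 2).
by rewrite !nnegrE powR1; apply; rewrite ?ler01 ?ler0n ?ltr1n.
Qed.

Let q1 : 2 `^ (- (2 * s)) < 1 :> R.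
Proof. by rewrite powRN invf_lt1 ?powR_gt0 // pow2_gt1 // mulr_gt0. Qed.

Let q2 : 2 `^ (2 * s - 2) < 1 :> R.
Proof. by rewrite -opprB powRN invf_lt1 ?powR_gt0 // pow2_gt1 //; rewrite subr_gt0 gtr_pMr. Qed.

Let two_gt0 : 0 < 2 :> R. Proof. by []. Qed.

Lemma riesz_le_powR r y : 0 < r -> r <= `|y| -> riesz y <= r `^ (- kexp).
Proof.
move=> r0 ry; rewrite powRN /riesz lef_pV2 ?posrE ?powR_gt0 //; last first.
  by rewrite (lt_le_trans r0) // (le_trans ry) // norm_le_enorm.
apply: ge0_ler_powR; rewrite ?nnegrE ?enorm_ge0 ?(ltW r0) ?(ltW kexp_gt0) //.
by rewrite (le_trans ry) // norm_le_enorm.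
Qed.

Lemma Itg_riesz_far :
  Itg mu (fun v : T => if 1 <= `|rt v| then riesz (rt v) else 0).
Proof.
have mf : measurable_fun setT (fun v : T => if 1 <= `|rt v| then riesz (rt v) else 0).
  apply: measurable_fun_ifT => //; last exact: measurable_riesz.
  apply: measurable_fun_ler => //.
  by apply: (meas_row (h := fun x => `|x|)) => x; exact: norm_continuous.
apply: (@Itg_geometric _ _ _ _ _ (fun j => ball_box (2 ^+ j.+1))
  (fun j => (2 ^+ j) `^ (- kexp)) (4 ^+ n) (2 `^ (- (2 * s)))) => //.
- by move=> v; case: ifP => // _; exact: riesz_ge0.
- by move=> j; exact: measurable_ball_box.
- move=> j; rewrite [X in (_ * X <= _)%E](measure_ball_box (exprn_ge0 _ (ltW two_gt0))) -EFinM lee_fin.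
  rewrite exprS mulrA exprMn -natrM mulrCA ler_wpM2l ?exprn_ge0 //.
  rewrite -!powR_mulrn ?powR_ge0 ?exprn_ge0 // -!powRrM -powRD ?pnatr_eq0 ?implybT //.
  by rewrite /kexp le_eqVlt; apply/orP; left; apply/eqP; congr (_ `^ _); ring.
move=> v; case: ifPn => [v1|_]; last by left.
right; have [j [j1 j2]] := dyadic_interval v1; exists j.
  by apply: ball_boxP (ltW j2); rewrite exprn_ge0.
by apply: riesz_le_powR; rewrite ?exprn_gt0.
Qed.

Lemma Itg_riesz_near :
  Itg mu (fun v : T => if `|rt v| < 1 then `|rt v| ^+ 2 * riesz (rt v) else 0).
Proof.
have cn : measurable_fun setT (fun v : T => `|rt v|).
  by apply: (meas_row (h := fun x => `|x|)) => x; exact: norm_continuous.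
apply: (@Itg_geometric _ _ _ _ _ (fun j => ball_box (2 ^- j))
  (fun j => (2 ^- j) ^+ 2 * (2 ^- j.+1) `^ (- kexp)) (2 `^ (kexp + n%:R))
  (2 `^ (2 * s - 2))) => //.
- apply: measurable_fun_ifT => //; first exact: measurable_fun_ltr.
  apply: measurable_funM; last exact: measurable_riesz.
  exact: measurable_funX.
- by move=> v; case: ifP => // _; rewrite mulr_ge0 ?exprn_ge0 ?riesz_ge0.
- by move=> j; exact: measurable_ball_box.
- move=> j; rewrite [X in (_ * X <= _)%E]measure_ball_box ?invr_ge0 ?exprn_ge0 // -EFinM lee_fin.
  have e k : 2 ^- k = 2 `^ (- k%:R) :> R by rewrite powRN powR_mulrn.
  have ex (u : R) k : (2 `^ u) ^+ k = 2 `^ (u * k%:R) :> R.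
    by rewrite powRrM powR_mulrn ?powR_ge0.
  rewrite exprMn !e !ex -powRrM -(powR_mulrn n (ltW two_gt0)).
  rewrite -!powRD ?pnatr_eq0 ?implybT // le_eqVlt; apply/orP; left; apply/eqP.
  by congr (_ `^ _); rewrite /kexp -(natr1 j); ring.
move=> v; case: ifPn => [v1|_]; last by left.
have [->|v0] := eqVneq (rt v) 0; first by left; rewrite normr0 expr0n mul0r.
right; have nv0 : 0 < `|rt v| by rewrite normr_gt0.
have [|j [j1 j2]] := @dyadic_interval R (`|rt v|^-1); first by rewrite invf_ge1 // ltW.
have v1' : `|rt v| <= 2 ^- j by rewrite -[leLHS]invrK lef_pV2 ?posrE ?exprn_gt0 ?invr_gt0.
have v2' : 2 ^- j.+1 <= `|rt v|.
  by rewrite -[leRHS]invrK lef_pV2 ?posrE ?exprn_gt0 ?invr_gt0 // ltW.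
exists j; first by apply: ball_boxP v1'; rewrite invr_ge0 exprn_ge0.
apply: ler_pM; rewrite ?exprn_ge0 ?riesz_ge0 //.
  by rewrite ler_pXn2r ?nnegrE ?invr_ge0 ?exprn_ge0.
by apply: riesz_le_powR => //; rewrite invr_gt0 exprn_gt0.
Qed.

Lemma Itg_m2riesz : Itg mu (fun v : T => m2 (rt v) * riesz (rt v)).
Proof.
apply: Itg_le (ItgD Itg_riesz_far Itg_riesz_near); first exact: measurable_m2riesz.
move=> v; rewrite ger0_norm ?mulr_ge0 ?m2_ge0 ?riesz_ge0 //.
have [v1|v1] := leP 1 `|rt v|.
  by rewrite addr0 ler_piMl ?riesz_ge0 ?m2_le1.
by rewrite add0r ler_wpM2r ?riesz_ge0 ?m2_le_sqr.
Qed.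

End kernel.

(** * Bounded C^{1,1} functions *)

Section second_difference_class.
Context {R : realType} {V : normedModType R}.
Implicit Types (f g : V -> R) (x h : V).

Definition bnd (C : R) f := forall x, `|f x| <= C.
Definition lip (C : R) f := forall x h, `|f (x + h) - f x| <= C * `|h|.
Definition sdf (C : R) f :=
  forall x h, `|f (x + h) + f (x - h) - 2 * f x| <= C * `|h| ^+ 2.

(** The bound on second differences makes the symmetrized integrand of the
    fractional Laplacian integrable; the three bounds together are stable under
    products, under averaging over translations, and under uniform limits. *)
Definition bls f := exists C, [/\ bnd C f, lip C f & sdf C f].

Lemma bnd_ge0 C f : bnd C f -> 0 <= C.
Proof. by move=> /(_ 0); apply: le_trans. Qed.

Lemma bnd_le C D f : C <= D -> bnd C f -> bnd D f.
Proof. by move=> CD Cf x; exact: le_trans (Cf x) CD. Qed.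

Lemma lip_le C D f : C <= D -> lip C f -> lip D f.
Proof. by move=> CD Cf x h; apply: le_trans (Cf x h) _; exact: ler_wpM2r. Qed.

Lemma sdf_le C D f : C <= D -> sdf C f -> sdf D f.
Proof.
move=> CD Cf x h; apply: le_trans (Cf x h) _.
by apply: ler_wpM2r => //; rewrite exprn_ge0.
Qed.

Lemma lip_continuous C f : lip C f -> continuous f.
Proof.
move=> lf x; have C0 : 0 <= `|C| + 1 by rewrite addr_ge0.
apply/cvgrPdist_lt => e e0; near=> y.
have -> : y = x + (y - x) by rewrite addrC subrK.
rewrite distrC (le_lt_trans (lf x (y - x))) //.
apply: (@le_lt_trans _ _ ((`|C| + 1) * `|y - x|)).
  by rewrite ler_wpM2r // (le_trans (ler_norm _)) // lerDl.
rewrite mulrC -ltr_pdivlMr ?ltr_wpDl // distrC; near: y.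
by apply: cvgr_dist_lt; rewrite ?divr_gt0 // ltr_wpDl.
Unshelve. all: by end_near. Qed.

Lemma bls_continuous f : bls f -> continuous f.
Proof. by move=> [C [_ /lip_continuous]]. Qed.

Lemma blsP B L K f : bnd B f -> lip L f -> sdf K f -> bls f.
Proof.
move=> bf lf sf; exists (Num.max B (Num.max L K)); split.
- by apply: bnd_le bf; rewrite le_max lexx.
- by apply: lip_le lf; rewrite !le_max lexx orbT.
- by apply: sdf_le sf; rewrite !le_max lexx !orbT.
Qed.

Lemma bls_pos f : bls f -> exists2 C, 0 <= C & [/\ bnd C f, lip C f & sdf C f].
Proof. by move=> [C [bf lf sf]]; exists C => //; exact: bnd_ge0 bf. Qed.

Lemma bls_cst c : bls (fun=> c).
Proof.
apply: (@blsP `|c| 0 0) => x // h; first by rewrite subrr normr0 mul0r.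
have -> : c + c - 2 * c = 0 by ring.
by rewrite normr0 mul0r.
Qed.

Lemma lipD B C f g : lip B f -> lip C g -> lip (B + C) (fun x => f x + g x).
Proof.
move=> lf lg x h; have := lf x h; have := lg x h.
have -> : f (x + h) + g (x + h) - (f x + g x) =
  (f (x + h) - f x) + (g (x + h) - g x) by ring.
move=> H1 H2; rewrite (mulrDl B C); apply: (le_trans (ler_normD _ _)). exact: (lerD H2 H1).
Qed.

Lemma sdfD B C f g : sdf B f -> sdf C g -> sdf (B + C) (fun x => f x + g x).
Proof.
move=> sf sg x h; have := sf x h; have := sg x h.
have -> : f (x + h) + g (x + h) + (f (x - h) + g (x - h)) - 2 * (f x + g x) =
  (f (x + h) + f (x - h) - 2 * f x) + (g (x + h) + g (x - h) - 2 * g x) by ring.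
move=> H1 H2; rewrite (mulrDl B C); apply: (le_trans (ler_normD _ _)); exact: (lerD H2 H1).
Qed.

Lemma blsD f g : bls f -> bls g -> bls (fun x => f x + g x).
Proof.
move=> [B [bf lf sf]] [C [bg lg sg]]; exists (B + C); split.
- by move=> x; rewrite (le_trans (ler_normD _ _)) //; exact: lerD.
- exact: lipD.
- exact: sdfD.
Qed.

Lemma blsZ c f : bls f -> bls (fun x => c * f x).
Proof.
move=> [B [bf lf sf]]; exists (`|c| * B); split=> [x|x h|x h].
- by rewrite normrM ler_wpM2l.
- by rewrite -mulrBr normrM -mulrA ler_wpM2l.
- have -> : c * f (x + h) + c * f (x - h) - 2 * (c * f x) =
    c * (f (x + h) + f (x - h) - 2 * f x) by ring.
  by rewrite normrM -mulrA ler_wpM2l.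
Qed.

Lemma blsN f : bls f -> bls (fun x => - f x).
Proof. by move=> /(blsZ (-1)); congr bls; apply/funext => x; rewrite mulN1r. Qed.

Lemma blsB f g : bls f -> bls g -> bls (fun x => f x - g x).
Proof. by move=> bf /blsN; exact: blsD. Qed.

Lemma lipM A B C D f g : bnd A f -> lip B f -> bnd C g -> lip D g ->
  lip (A * D + C * B) (fun x => f x * g x).
Proof.
move=> bf lf bg lg x h.
have -> : f (x + h) * g (x + h) - f x * g x =
  f (x + h) * (g (x + h) - g x) + g x * (f (x + h) - f x) by ring.
rewrite (le_trans (ler_normD _ _)) // [leRHS]mulrDl -!mulrA !normrM.
by apply: lerD; apply: ler_pM.
Qed.

Lemma sdfM A B K C D L f g : bnd A f -> lip B f -> sdf K f ->
  bnd C g -> lip D g -> sdf L g -> 0 <= B -> 0 <= D ->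
  sdf (A * L + C * K + 2 * (B * D)) (fun x => f x * g x).
Proof.
move=> bf lf sf bg lg sg B0 D0 x h.
have -> : f (x + h) * g (x + h) + f (x - h) * g (x - h) - 2 * (f x * g x) =
  f x * (g (x + h) + g (x - h) - 2 * g x) +
  g x * (f (x + h) + f (x - h) - 2 * f x) +
  ((f (x + h) - f x) * (g (x + h) - g x) +
   (f (x - h) - f x) * (g (x - h) - g x)) by ring.
have H k : `|k| = `|h| -> `|(f (x + k) - f x) * (g (x + k) - g x)| <=
    B * D * `|h| ^+ 2.
  move=> kh; rewrite normrM expr2 mulrACA -kh.
  by apply: ler_pM.
rewrite (le_trans (ler_normD _ _)) // (mulrDl _ (2 * _)); apply: lerD.
  rewrite (le_trans (ler_normD _ _)) // [leRHS]mulrDl -!mulrA !normrM.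
  by apply: lerD; apply: ler_pM.
rewrite (le_trans (ler_normD _ _)) // -mulrA mulr_natl mulr2n.
by apply: lerD; apply: H; rewrite ?normrN.
Qed.

Lemma blsM f g : bls f -> bls g -> bls (fun x => f x * g x).
Proof.
move=> /bls_pos[B B0 [bf lf sf]] /bls_pos[C C0 [bg lg sg]].
apply: blsP (lipM bf lf bg lg) (sdfM bf lf sf bg lg sg B0 C0).
by move=> x; rewrite normrM; apply: ler_pM (bf x) (bg x).
Qed.

Lemma bls_translate c f : bls f -> bls (fun x => f (x + c)).
Proof.
move=> [C [bf lf sf]]; exists C; split=> [x|x h|x h]; first exact: bf.
  by rewrite (addrAC x h c); exact: lf.
by rewrite (addrAC x h c) (addrAC x (- h) c); exact: sf.
Qed.

Lemma bls_sum I (r : seq I) (F : I -> V -> R) : (forall i, bls (F i)) ->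
  bls (fun x => \sum_(i <- r) F i x).
Proof.
move=> bF; elim: r => [|i r IHr].
  by under eq_fun do rewrite big_nil; exact: bls_cst.
by under eq_fun do rewrite big_cons; exact: blsD.
Qed.

Lemma bls_prod I (r : seq I) (F : I -> V -> R) : (forall i, bls (F i)) ->
  bls (fun x => \prod_(i <- r) F i x).
Proof.
move=> bF; elim: r => [|i r IHr].
  by under eq_fun do rewrite big_nil; exact: bls_cst.
by under eq_fun do rewrite big_cons; exact: blsM.
Qed.

End second_difference_class.

Lemma bls_comp_linear {R : realType} {V W : normedModType R} (T : W -> V)
    (D : R) (f : V -> R) :
  (forall x y, T (x + y) = T x + T y) -> (forall x, T (- x) = - T x) ->
  (forall x, `|T x| <= D * `|x|) -> bls f -> bls (fun x => f (T x)).
Proof.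
move=> TD TN Tb /bls_pos[C C0 [bf lf sf]].
apply: (@blsP _ _ C (C * D) (C * D ^+ 2)) => [x|x h|x h]; first exact: bf.
  rewrite TD (le_trans (lf _ _)) // -mulrA; exact: ler_wpM2l.
rewrite !TD TN (le_trans (sf _ _)) // -mulrA -exprMn; apply: ler_wpM2l => //.
by apply: lerXn2r; rewrite ?nnegrE // (le_trans _ (Tb h)).
Qed.

Lemma bls_coord {R : realType} {n : nat} (f : R -> R) (i : 'I_n) :
  bls f -> bls (fun x : 'rV[R]_n => f (x 0 i)).
Proof.
apply: (bls_comp_linear (T := fun x : 'rV[R]_n => x 0 i) (D := 1)) => [x y|x|x];
  rewrite ?mxE // mul1r; exact: coord_le_norm.
Qed.

Section step_function.
Context {R : realType}.

Let p (t : R) := Num.max 0 t ^+ 2.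

(** The distribution function of a hat density, hence a C^{1,1} step from 0 to 1. *)
Definition step (t : R) := (p t - 2 * p (t - 1) + p (t - 2)) / 2.

Let pE t : p t = if 0 <= t then t ^+ 2 else 0.
Proof.
by rewrite /p; case: ifPn => [/max_r ->|] //; rewrite -ltNge => /ltW/max_l ->;
  rewrite expr0n.
Qed.

Lemma step_le0 t : t <= 0 -> step t = 0.
Proof. by move=> t0; rewrite /step !pE; do 3![case: ifPn => ?]; nra. Qed.

Lemma step_ge2 t : 2 <= t -> step t = 1.
Proof. by move=> t0; rewrite /step !pE; do 3![case: ifPn => ?]; nra. Qed.

Lemma step_01 t : 0 <= step t <= 1.
Proof.
rewrite /step !pE; do 3![case: ifPn; rewrite -?ltNge => ?];
  apply/andP; split; nra.
Qed.

Let sdf_p : sdf 2 p.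
Proof.
move=> t h; rewrite real_normK ?num_real // !pE.
do 3![case: ifPn; rewrite -?ltNge => ?]; rewrite ler_norml; apply/andP; split; nra.
Qed.

Let step_le s t : s <= t -> step t - step s <= t - s.
Proof.
move=> st; rewrite /step !pE.
do 6![case: ifPn; rewrite -?ltNge => ?]; nra.
Qed.

Let step_mono s t : s <= t -> step s <= step t.
Proof.
move=> st; rewrite /step !pE.
do 6![case: ifPn; rewrite -?ltNge => ?]; nra.
Qed.

Lemma bls_step : bls step.
Proof.
apply: (@blsP _ _ 1 1 4) => [t|t h|t h].
- by have /andP[? ?] := step_01 t; rewrite ger0_norm.
- rewrite mul1r; have [h0|h0] := leP 0 h.
    have th : t <= t + h by rewrite lerDl.
    rewrite ger0_norm ?subr_ge0 ?step_mono // (ger0_norm h0).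
    by have := step_le th; lra.
  have th : t + h <= t by rewrite gerDl ltW.
  rewrite distrC ger0_norm ?subr_ge0 ?step_mono // (ltr0_norm h0).
  by have := step_le th; lra.
have := sdf_p t h; have := sdf_p (t - 1) h; have := sdf_p (t - 2) h.
rewrite !ler_norml /step (addrAC t (- 1) h) (addrAC t (- 2) h).
rewrite (addrAC t (- 1) (- h)) (addrAC t (- 2) (- h)).
move=> /andP[a1 a2] /andP[b1 b2] /andP[c1 c2]; apply/andP; split; lra.
Qed.

End step_function.

Section cutoff.
Context {R : realType} {n : nat}.

(** A C^{1,1} cutoff: 1 on |x| <= a, 0 where |x| >= a + 2, sup norm. *)
Definition cutoff (a : R) (x : 'rV[R]_n) : R :=
  \prod_(i < n) (step (a + 2 - x 0 i) * step (a + 2 + x 0 i)).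

Lemma cutoff_01 a x : 0 <= cutoff a x <= 1.
Proof.
have mul01 (u v : R) : 0 <= u <= 1 -> 0 <= v <= 1 -> 0 <= u * v <= 1.
  by move=> /andP[? ?] /andP[? ?]; rewrite mulr_ge0 // mulr_ile1.
apply: (big_ind (fun u : R => 0 <= u <= 1)) => // [|i _]; first by rewrite ler01 lexx.
by apply: mul01; exact: step_01.
Qed.

Lemma cutoff1 a x : `|x| <= a -> cutoff a x = 1.
Proof.
move=> xa; rewrite /cutoff big1 // => i _.
have := le_trans (coord_le_norm x i) xa; rewrite ler_norml => /andP[? ?].
by rewrite !step_ge2 ?mulr1 //; lra.
Qed.

Lemma cutoff0 a x : 0 < a + 2 -> a + 2 <= `|x| -> cutoff a x = 0.
Proof.
move=> a2 ax; apply/eqP; apply: contraTT ax => c0; rewrite -ltNge.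
apply: norm_lt_coord => // i; rewrite ltNge; apply: contra c0.
rewrite ler_normr => /orP[|] xi; rewrite /cutoff (bigD1 i) //=.
  by rewrite (step_le0 (t := a + 2 - x 0 i)) ?mul0r //; lra.
by rewrite (step_le0 (t := a + 2 + x 0 i)) ?mulr0 ?mul0r //; lra.
Qed.

Lemma bls_cutoff a : bls (cutoff a).
Proof.
apply: bls_prod => i; apply: blsM.
  apply: (bls_coord (f := fun t => step (a + 2 - t)) i).
  have := bls_comp_linear (T := fun t : R => - t) (D := 1) _ _ _
    (bls_translate (a + 2) (@bls_step R)).
  have -> : (fun t : R => step (a + 2 - t)) = (fun t => step (- t + (a + 2))).
    by apply/funext => t; rewrite addrC.
  by apply => [t u|t|t]; rewrite ?opprD // mul1r normrN.
apply: (bls_coord (f := fun t => step (a + 2 + t)) i).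
by under eq_fun do rewrite addrC; exact/bls_translate/bls_step.
Qed.

End cutoff.

(** * Truncated operators *)

Section uniform_limits.
Context {R : realType}.

Lemma le_of_small (a b : R) (e : nat -> R) :
  e m @[m --> \oo] --> 0 -> (forall m, a <= b + e m) -> a <= b.
Proof.
move=> e0 ab; rewrite -[leRHS]addr0.
have c : b + e m @[m --> \oo] --> b + 0 by apply: cvgD => //; exact: cvg_cst.
rewrite -(cvg_lim _ c) //; apply: limr_ge; first by apply/cvg_ex; exists (b + 0).
exact: nearW.
Qed.

Lemma uniform_cauchy_limit (V : Type) (z : nat -> V -> R) (e : nat -> R) :
  e m @[m --> \oo] --> 0 ->
  (forall m l x, (l <= m)%N -> `|z m x - z l x| <= e l) ->
  exists w, forall l x, `|w x - z l x| <= e l.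
Proof.
move=> e0 ze; exists (fun x => lim (z m x @[m --> \oo])) => l x.
have zc : cvg (z m x @[m --> \oo]).
  apply/cauchy_cvgP/cauchy_exP => eps eps0.
  have /cvgrPdist_lt/(_ _ eps0)[N _ /(_ N (leqnn N))] := e0.
  rewrite sub0r normrN => eN; exists (z N x); exists N => // m /= Nm.
  rewrite /ball /= distrC (le_lt_trans (ze _ _ _ Nm)) //.
  exact: le_lt_trans (ler_norm _) eN.
have c : `|z m x - z l x| @[m --> \oo] --> `|lim (z m x @[m --> \oo]) - z l x|.
  by apply: cvg_norm; apply: cvgB => //; exact: cvg_cst.
rewrite -(cvg_lim _ c) //; apply: limr_le.
  by apply/cvg_ex; eexists; exact: c.
by exists l => // m /=; exact: ze.
Qed.

Lemma cvg_geo0 (C q : R) : 0 <= q -> q < 1 -> C * q ^+ m @[m --> \oo] --> 0.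
Proof. by move=> q0 q1; apply: cvg_geometric; rewrite ger0_norm. Qed.

Context {V : normedModType R}.
Variables (z : nat -> V -> R) (w : V -> R) (e : nat -> R).
Hypotheses (e0 : e m @[m --> \oo] --> 0) (wz : forall l x, `|w x - z l x| <= e l).

Let cvg_scale (k : R) : k * e m @[m --> \oo] --> 0.
Proof. by rewrite -[X in _ --> X](mulr0 k); apply: cvgM => //; exact: cvg_cst. Qed.

Lemma bnd_limit C : (forall m, bnd C (z m)) -> bnd C w.
Proof.
move=> zC x; apply: (le_of_small e0) => m.
have := wz m x; have := zC m x.
by rewrite !ler_norml => /andP[? ?] /andP[? ?]; apply/andP; split; lra.
Qed.

Lemma lip_limit C : (forall m, lip C (z m)) -> lip C w.
Proof.
move=> zC x h; apply: (le_of_small (cvg_scale 2)) => m.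
have := wz m x; have := wz m (x + h); have := zC m x h.
rewrite !ler_norml => /andP[? ?] /andP[? ?] /andP[? ?]; apply/andP; split; lra.
Qed.

Lemma sdf_limit C : (forall m, sdf C (z m)) -> sdf C w.
Proof.
move=> zC x h; apply: (le_of_small (cvg_scale 4)) => m.
have := wz m x; have := wz m (x + h); have := wz m (x - h); have := zC m x h.
rewrite !ler_norml => /andP[? ?] /andP[? ?] /andP[? ?] /andP[? ?].
apply/andP; split; lra.
Qed.

End uniform_limits.

Section resolvent.
Context {R : realType} {n : nat}.
Local Notation T := (n.-tuple (measurableTypeR R)).
Local Notation rt := (@row_of_tuple R n).
Local Notation mu := (@lebesgue_tuple R n).
Local Notation I W := (J mu (fun v => W (rt v))).
Local Notation itg W := (Itg mu (fun v => W (rt v))).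
Implicit Types x y h : 'rV[R]_n.

Variable k : 'rV[R]_n -> R.
Hypotheses (k0 : forall y, 0 <= k y) (mk : measurable_fun setT (fun v : T => k (rt v))).
Hypothesis Ik : itg (fun y => m2 y * k y).
Variable chi : 'rV[R]_n -> R.
Hypotheses (chi1 : bnd 1 chi) (bchi : bls chi).

Let mnorm : measurable_fun setT (fun v : T => `|rt v|).
Proof. by apply: (meas_row (h := fun x => `|x|)) => x; exact: norm_continuous. Qed.

Definition trunc (d : R) y := if d < `|y| then k y else 0.
Definition kfar y := if 1 <= `|y| then k y else 0.

Lemma trunc_ge0 d y : 0 <= trunc d y.
Proof. by rewrite /trunc; case: ifP. Qed.

Lemma kfar_ge0 y : 0 <= kfar y.
Proof. by rewrite /kfar; case: ifP. Qed.

Lemma measurable_trunc d : measurable_fun setT (fun v : T => trunc d (rt v)).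
Proof. by apply: measurable_fun_ifT => //; exact: measurable_fun_ltr. Qed.

Lemma measurable_kfar : measurable_fun setT (fun v : T => kfar (rt v)).
Proof. by apply: measurable_fun_ifT => //; exact: measurable_fun_ler. Qed.

Lemma itg_trunc d : 0 < d -> itg (trunc d).
Proof.
move=> d0; pose c := Num.min 1 (d ^+ 2).
have c0 : 0 < c by rewrite lt_min ltr01 exprn_gt0.
apply: Itg_le (ItgZ c^-1 Ik); first exact: measurable_trunc.
move=> v; rewrite ger0_norm ?trunc_ge0 // /trunc; case: ifPn => [dv|_].
  rewrite mulrA ler_peMl // mulrC ler_pdivlMr // mul1r.
  rewrite /c /m2 le_min !ge_min lexx /=; apply/orP; right.
  by rewrite ler_pXn2r ?nnegrE ?(ltW d0) // ltW.
by rewrite mulr_ge0 ?mulr_ge0 ?m2_ge0 ?invr_ge0 // ltW.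
Qed.

Lemma itg_kfar : itg kfar.
Proof.
apply: Itg_le Ik; first exact: measurable_kfar.
move=> v; rewrite ger0_norm ?kfar_ge0 // /kfar; case: ifPn => [v1|_].
  by rewrite /m2 min_l ?mul1r // expr_ge1.
by rewrite mulr_ge0 ?m2_ge0.
Qed.

(** The error made by truncating the kernel at d, on a C^{1,1} function. *)
Definition omega (d : R) : R :=
  I (fun y => if `|y| <= d then m2 y * k y else 0).

Lemma measurable_near d :
  measurable_fun setT (fun v : T => if `|rt v| <= d then m2 (rt v) * k (rt v) else 0).
Proof.
apply: measurable_fun_ifT => //; first exact: measurable_fun_ler.
by apply: measurable_funM => //; apply: meas_row; exact: m2_continuous.
Qed.

Lemma itg_near d : itg (fun y => if `|y| <= d then m2 y * k y else 0).
Proof.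
apply: Itg_le Ik; first exact: measurable_near.
move=> v; have H : 0 <= m2 (rt v) * k (rt v) by rewrite mulr_ge0 ?m2_ge0.
by case: ifP => _; rewrite ?normr0 // ger0_norm.
Qed.

Lemma omega_cvg0 : omega m.+2%:R^-1 @[m --> \oo] --> 0.
Proof.
have h2 : forall m : nat, measurable_fun setT (fun v : T =>
    (if `|rt v| <= m.+2%:R^-1 then m2 (rt v) * k (rt v) else 0)%:E).
  by move=> m; apply/measurable_EFinP; exact: measurable_near.
have [] := @dominated_convergence _ _ _ mu setT measurableT
    (fun m v => (if `|rt v| <= m.+2%:R^-1 then m2 (rt v) * k (rt v) else 0)%:E)
    (fun=> 0%E) (fun v => (m2 (rt v) * k (rt v))%:E) h2 (measurable_cst _) _ Ik _.
- apply: aeW => v _; have [v0|v0] := eqVneq (rt v) 0.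
    have -> : (fun m : nat => (if `|rt v| <= m.+2%:R^-1 then m2 (rt v) * k (rt v)
        else 0)%:E) = (fun=> 0%E).
      apply/funext => m; rewrite v0 normr0 invr_ge0 ler0n.
      by rewrite /m2 normr0 expr0n min_r // mul0r.
    exact: cvg_cst.
  apply: cvg_near_cst; exists (Num.trunc `|rt v|^-1) => // m /= Hm.
  case: ifPn => // vm; exfalso.
  have nv : 0 < `|rt v| by rewrite normr_gt0.
  have : m.+2%:R <= `|rt v|^-1 by rewrite -[leLHS]invrK lef_pV2 ?posrE // invr_gt0.
  apply/negP; rewrite -ltNge (lt_le_trans (truncnS_gt _)) // ler_nat.
  by rewrite ltnS (leq_trans Hm) // leqnSn.
- apply: aeW => v m _ /=; rewrite lee_fin.
  have H : 0 <= m2 (rt v) * k (rt v) by rewrite mulr_ge0 ?m2_ge0.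
  by case: ifP => _; rewrite ?normr0 // ger0_norm.
move=> _ _; rewrite integral0 => c.
have := fine_cvg c; rewrite /= => {}c.
exact: c.
Qed.

Lemma omega_le d d' : d <= d' -> omega d <= omega d'.
Proof.
move=> dd; apply: J_le; [exact: itg_near|exact: itg_near|move=> v].
case: ifPn => vd; first by rewrite (le_trans vd dd).
by case: ifP => // _; rewrite mulr_ge0 ?m2_ge0.
Qed.

(** Short jumps see z and long ones chi z. So Lchi z agrees with the operator
    applied to chi z where chi is 1 on the unit ball around the point, and yet
    lam z + Lchi z = f can be solved on the whole space, without boundary. *)
Definition Q z x y : R :=
  if `|y| < 1 then (z (x + y) + z (x - y)) / 2
  else (chi (x + y) * z (x + y) + chi (x - y) * z (x - y)) / 2.

Definition Lchi z x : R := I (fun y => (z x - Q z x y) * k y).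

Definition Ltrunc d z x : R := I (fun y => (z x - Q z x y) * trunc d y).

Definition jump d z x : R := I (fun y => Q z x y * trunc d y).

Definition mass d : R := I (trunc d).

Lemma mass_ge0 d : 0 <= mass d.
Proof. by apply: J_ge0 => v; exact: trunc_ge0. Qed.

Lemma meas_shift (f : 'rV[R]_n -> R) x (sg : bool) : continuous f ->
  measurable_fun setT (fun v : T => f (if sg then x - rt v else x + rt v)).
Proof.
move=> cf; apply: measurable_continuous_row => // i.
case: sg.
  under eq_fun do rewrite !mxE.
  by apply: measurable_funB => //; exact: measurable_tnth.
under eq_fun do rewrite !mxE.
by apply: measurable_funD => //; exact: measurable_tnth.
Qed.

Lemma measurable_Q z x : continuous z ->
  measurable_fun setT (fun v : T => Q z x (rt v)).
Proof.
move=> cz; have cx := bls_continuous bchi.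
have mz b := meas_shift x b cz; have mx b := meas_shift x b cx.
apply: measurable_fun_ifT; first exact: measurable_fun_ltr.
  by apply: measurable_funM => //; apply: measurable_funD; [exact: mz false|exact: mz true].
apply: measurable_funM => //; apply: measurable_funD; apply: measurable_funM.
- exact: mx false.
- exact: mz false.
- exact: mx true.
- exact: mz true.
Qed.

Let half (a b B : R) : `|a| <= B -> `|b| <= B -> `|(a + b) / 2| <= B.
Proof.
by rewrite !ler_norml => /andP[? ?] /andP[? ?]; apply/andP; split; lra.
Qed.

Let chiM z B x : bnd B z -> `|chi x * z x| <= B.
Proof.
move=> bz; rewrite normrM -[leRHS]mul1r; apply: ler_pM => //.
Qed.

Lemma Q_bnd z B x y : bnd B z -> `|Q z x y| <= B.
Proof. by move=> bz; rewrite /Q; case: ifP => _; apply: half => //; exact: chiM. Qed.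

Lemma Q_sub z1 z2 x y : Q (fun x => z1 x - z2 x) x y = Q z1 x y - Q z2 x y.
Proof. by rewrite /Q; case: ifP => _; ring. Qed.

Lemma Q_add z1 z2 x y : Q (fun x => z1 x + z2 x) x y = Q z1 x y + Q z2 x y.
Proof. by rewrite /Q; case: ifP => _; ring. Qed.

Lemma Q_m2 z B K x y : bnd B z -> sdf K z ->
  `|z x - Q z x y| <= (K + 2 * B) * m2 y.
Proof.
move=> bz sz; have B0 := bnd_ge0 bz; have K0 : 0 <= K * `|y| ^+ 2.
  exact: le_trans (sz x y).
have [y1|y1] := ltP `|y| 1.
  rewrite /Q y1 /m2 min_r; last by rewrite expr_le1 // ltW.
  have -> : z x - (z (x + y) + z (x - y)) / 2 =
    - (z (x + y) + z (x - y) - 2 * z x) / 2 by field.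
  rewrite mulNr normrN normrM (ger0_norm (_ : 0 <= 2^-1)) //.
  have : 0 <= B * `|y| ^+ 2 by rewrite mulr_ge0 ?exprn_ge0.
  by have := sz x y; lra.
rewrite /m2 min_l ?mulr1; last by rewrite expr_ge1.
have := Q_bnd x y bz; have := bz x.
have K0' : 0 <= K by rewrite -(pmulr_lge0 _ (_ : 0 < `|y| ^+ 2)) // exprn_gt0 // (lt_le_trans ltr01).
rewrite !ler_norml => /andP[? ?] /andP[? ?]; apply/andP; split; lra.
Qed.

Lemma itg_jump d z B x : 0 < d -> continuous z -> bnd B z ->
  itg (fun y => Q z x y * trunc d y).
Proof.
move=> d0 cz bz; apply: Itg_le (ItgZ B (itg_trunc d0)).
  by apply: measurable_funM; [exact: measurable_Q|exact: measurable_trunc].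
by move=> v; rewrite normrM (ger0_norm (trunc_ge0 _ _)) ler_wpM2r ?trunc_ge0 ?Q_bnd.
Qed.

Lemma jump_bnd d z B x : 0 < d -> continuous z -> bnd B z ->
  `|jump d z x| <= B * mass d.
Proof.
move=> d0 cz bz; rewrite -(JZ _ (itg_trunc d0)); apply: J_norm_le.
- by apply: measurable_funM; [exact: measurable_Q|exact: measurable_trunc].
- by move=> v; rewrite normrM (ger0_norm (trunc_ge0 _ _)) ler_wpM2r ?trunc_ge0 ?Q_bnd.
- exact: (ItgZ B (itg_trunc d0)).
Qed.

Lemma jump_sub d z1 z2 B1 B2 x : 0 < d ->
  continuous z1 -> bnd B1 z1 -> continuous z2 -> bnd B2 z2 ->
  jump d (fun x => z1 x - z2 x) x = jump d z1 x - jump d z2 x.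
Proof.
move=> d0 c1 b1 c2 b2.
rewrite /jump -(JB (itg_jump x d0 c1 b1) (itg_jump x d0 c2 b2)); congr J.
by apply/funext => v; rewrite Q_sub mulrBl.
Qed.

Lemma LtruncE d z B x : 0 < d -> continuous z -> bnd B z ->
  Ltrunc d z x = mass d * z x - jump d z x.
Proof.
move=> d0 cz bz; rewrite mulrC /mass -(JZ (z x) (itg_trunc d0)).
rewrite -(JB (ItgZ (z x) (itg_trunc d0)) (itg_jump x d0 cz bz)); congr J.
by apply/funext => v; rewrite mulrBl.
Qed.

Lemma itg_Lchi z B K x : continuous z -> bnd B z -> sdf K z ->
  itg (fun y => (z x - Q z x y) * k y).
Proof.
move=> cz bz sz; apply: Itg_le (ItgZ (K + 2 * B) Ik).
  apply: measurable_funM => //; apply: measurable_funB => //.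
  exact: measurable_Q.
by move=> v; rewrite normrM (ger0_norm (k0 _)) mulrA ler_wpM2r ?Q_m2.
Qed.

Lemma itg_Ltrunc d z B x : 0 < d -> continuous z -> bnd B z ->
  itg (fun y => (z x - Q z x y) * trunc d y).
Proof.
move=> d0 cz bz.
rewrite (_ : (fun v => _) = fun v => z x * trunc d (rt v) - Q z x (rt v) * trunc d (rt v)).
  by apply: ItgB; [exact: ItgZ (itg_trunc d0)|exact: itg_jump d0 cz bz].
by apply/funext => v; rewrite mulrBl.
Qed.

Lemma Ltrunc_close d z B K x : 0 < d -> continuous z -> bnd B z -> sdf K z ->
  `|Lchi z x - Ltrunc d z x| <= (K + 2 * B) * omega d.
Proof.
move=> d0 cz bz sz.
rewrite -(JB (itg_Lchi x cz bz sz) (itg_Ltrunc x d0 cz bz)) -(JZ _ (itg_near d)).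
apply: J_norm_le; last exact: ItgZ (itg_near d).
  by apply: Itg_meas; apply: ItgB;
    [exact: itg_Lchi cz bz sz|exact: itg_Ltrunc d0 cz bz].
move=> v; rewrite -mulrBr /trunc; case: ifPn => dv.
  by rewrite subrr mulr0 normr0 (lt_geF dv) mulr0.
move: dv; rewrite -leNgt => dv.
by rewrite subr0 dv normrM (ger0_norm (k0 _)) mulrA ler_wpM2r ?Q_m2.
Qed.

End resolvent.

(** * The resolvent of the truncated operators *)

Lemma continuous_sub {R : realType} {V : topologicalType} (z w : V -> R) :
  continuous z -> continuous w -> continuous (fun x => z x - w x).
Proof. by move=> cz cw x; exact: (cvgB (cz x) (cw x)). Qed.

Section resolvent_solution.
Context {R : realType} {n : nat}.
Local Notation T := (n.-tuple (measurableTypeR R)).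
Local Notation rt := (@row_of_tuple R n).
Local Notation mu := (@lebesgue_tuple R n).
Local Notation I W := (J mu (fun v => W (rt v))).
Local Notation itg W := (Itg mu (fun v => W (rt v))).
Implicit Types x y h : 'rV[R]_n.

Variable k : 'rV[R]_n -> R.
Hypotheses (k0 : forall y, 0 <= k y) (mk : measurable_fun setT (fun v : T => k (rt v))).
Hypothesis Ik : itg (fun y => m2 y * k y).
Variable chi : 'rV[R]_n -> R.
Hypotheses (chi1 : bnd 1 chi) (bchi : bls chi).

Local Notation Q := (Q chi).
Local Notation jump := (jump k chi).
Local Notation mass := (mass k).
Local Notation trunc := (trunc k).
Local Notation kfar := (kfar k).
Local Notation Ltrunc := (Ltrunc k chi).
Local Notation Lchi := (Lchi k chi).
Local Notation omega := (omega k).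

(** At a positive distance from 0 the kernel has finite mass, so Ltrunc d is
    mass d minus a jump operator that multiplies the supremum by at most mass d. *)
Lemma maximum_trunc d lam e B G : 0 < d -> 0 < lam -> continuous e -> bnd B e ->
  (forall x, `|lam * e x + Ltrunc d e x| <= G) -> forall x, lam * `|e x| <= G.
Proof.
move=> d0 lam0 ce be eG x.
pose S := [set `|e x| | x in [set: 'rV[R]_n]].
have hs : has_sup S.
  by split; [exists `|e 0|; exists 0|exists B => _ [y _ <-]; exact: be].
pose s := sup S.
have bs : bnd s e by move=> y; apply: (sup_upper_bound hs); exists y.
have m0 := mass_ge0 k0 d; have lm : 0 < lam + mass d by rewrite ltr_wpDr.
have H y : `|e y| <= (G + s * mass d) / (lam + mass d).
  rewrite ler_pdivlMr // mulrC -[X in X * _](gtr0_norm lm) -normrM.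
  have -> : (lam + mass d) * e y = (lam * e y + Ltrunc d e y) + jump d e y.
    by rewrite (LtruncE k0 mk Ik chi1 bchi y d0 ce be); ring.
  rewrite (le_trans (ler_normD _ _)) //; apply: lerD; first exact: eG.
  exact: (jump_bnd k0 mk Ik chi1 bchi y d0 ce bs).
have : s <= (G + s * mass d) / (lam + mass d).
  by apply: ge_sup => [|_ [y _ <-]]; [case: hs|exact: H].
rewrite ler_pdivlMr // mulrDr => sG.
apply: (@le_trans _ _ (lam * s)); first by rewrite ler_wpM2l // ltW.
by rewrite mulrC -(lerD2r (s * mass d)).
Qed.

(** Maximum principle for lam + L^chi: truncate at d and let d go to 0. *)
Lemma maximum_principle lam e G : 0 < lam -> bls e ->
  (forall x, `|lam * e x + Lchi e x| <= G) -> forall x, lam * `|e x| <= G.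
Proof.
move=> lam0 be eG x; have ce := bls_continuous be.
have [C C0 [bC lC sC]] := bls_pos be.
have c : (C + 2 * C) * omega m.+2%:R^-1 @[m --> \oo] --> 0.
  rewrite -[X in _ --> X](mulr0 (C + 2 * C)); apply: cvgM; first exact: cvg_cst.
  exact: omega_cvg0 k0 mk Ik.
apply: (le_of_small c) => m.
apply: (maximum_trunc (d := m.+2%:R^-1) _ lam0 ce bC) => // y.
have -> : lam * e y + Ltrunc m.+2%:R^-1 e y =
  (lam * e y + Lchi e y) - (Lchi e y - Ltrunc m.+2%:R^-1 e y) by ring.
rewrite (le_trans (ler_normB _ _)) //; apply: lerD; first exact: eG.
exact: (Ltrunc_close k0 mk Ik chi1 bchi).
Qed.

Variable Cx : R.
Hypotheses (Cx0 : 0 <= Cx) (lchi : lip Cx chi) (schi : sdf Cx chi).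

Let M1 := I kfar.

Let M1_ge0 : 0 <= M1. Proof. by apply: J_ge0 => v; exact: kfar_ge0. Qed.

Let far y (c : R) : R := if 1 <= `|y| then c else 0.

Let half2 (a b B : R) : `|a| <= B -> `|b| <= B -> `|(a + b) / 2| <= B.
Proof.
by rewrite !ler_norml => /andP[? ?] /andP[? ?]; apply/andP; split; lra.
Qed.

Let chiz_lip z B l : bnd B z -> lip l z -> lip (l + Cx * B) (fun x => chi x * z x).
Proof.
move=> bz lz; have := lipM chi1 lchi bz lz.
by congr lip; ring.
Qed.

Let chiz_sdf z B l K : bnd B z -> lip l z -> sdf K z -> 0 <= l ->
  sdf (K + (2 * (Cx * l) + Cx * B)) (fun x => chi x * z x).
Proof.
move=> bz lz sz l0; have := sdfM chi1 lchi schi bz lz sz Cx0 l0.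
by congr sdf; ring.
Qed.

Let Q_lip z B l x y h : bnd B z -> lip l z ->
  `|Q z (x + h) y - Q z x y| <= l * `|h| + far y (Cx * B * `|h|).
Proof.
move=> bz lz; rewrite /Q /far; have [y1|y1] := ltP `|y| 1.
  rewrite addr0; have := half2 (lz (x + y) h) (lz (x - y) h).
  by rewrite (addrAC x y h) (addrAC x (- y) h); congr (`|_| <= _); field.
rewrite -[leRHS]mulrDl; have lc := chiz_lip bz lz.
have := half2 (lc (x + y) h) (lc (x - y) h).
by rewrite (addrAC x y h) (addrAC x (- y) h); congr (`|_| <= _); field.
Qed.

Let Q_sdf z B l K x y h : bnd B z -> lip l z -> sdf K z -> 0 <= l ->
  `|Q z (x + h) y + Q z (x - h) y - 2 * Q z x y| <=
  K * `|h| ^+ 2 + far y ((2 * (Cx * l) + Cx * B) * `|h| ^+ 2).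
Proof.
move=> bz lz sz l0; rewrite /Q /far; have [y1|y1] := ltP `|y| 1.
  rewrite addr0; have := half2 (sz (x + y) h) (sz (x - y) h).
  rewrite (addrAC x y h) (addrAC x (- y) h) (addrAC x y (- h)) (addrAC x (- y) (- h)).
  by congr (`|_| <= _); field.
rewrite -[leRHS]mulrDl; have sc := chiz_sdf bz lz sz l0.
have := half2 (sc (x + y) h) (sc (x - y) h).
rewrite (addrAC x y h) (addrAC x (- y) h) (addrAC x y (- h)) (addrAC x (- y) (- h)).
by congr (`|_| <= _); field.
Qed.

Let I_far d (a c : R) : 0 < d -> d < 1 -> 
  itg (fun y => (a + far y c) * trunc d y) /\
  I (fun y => (a + far y c) * trunc d y) = a * mass d + c * M1.
Proof.
move=> d0 d1; have it := itg_trunc k0 mk Ik d0; have ik := itg_kfar k0 mk Ik.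
have E : (fun v : T => (a + far (rt v) c) * trunc d (rt v)) =
    (fun v => a * trunc d (rt v) + c * kfar (rt v)).
  apply/funext => v; rewrite mulrDl /far /kfar /trunc; congr (_ + _).
  case: ifPn => v1; last by rewrite mul0r mulr0.
  by rewrite (lt_le_trans d1 v1).
rewrite E; split; first exact: ItgD (ItgZ _ it) (ItgZ _ ik).
by rewrite (JD (ItgZ _ it) (ItgZ _ ik)) (JZ _ it) (JZ _ ik).
Qed.

Let jump_lip d z B l x h : 0 < d -> d < 1 -> bnd B z -> lip l z ->
  `|jump d z (x + h) - jump d z x| <= (l * mass d + Cx * B * M1) * `|h|.
Proof.
move=> d0 d1 bz lz; have cz := lip_continuous lz.
have i1 := itg_jump k0 mk Ik chi1 bchi (x + h) d0 cz bz.
have i2 := itg_jump k0 mk Ik chi1 bchi x d0 cz bz.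
have [i3 E] := I_far (l * `|h|) (Cx * B * `|h|) d0 d1.
have -> : (l * mass d + Cx * B * M1) * `|h| =
  l * `|h| * mass d + Cx * B * `|h| * M1 by ring.
rewrite -E -(JB i1 i2); apply: J_norm_le => //.
  exact: Itg_meas (ItgB i1 i2).
move=> v; rewrite -mulrBl normrM (ger0_norm (trunc_ge0 k0 _ _)).
by rewrite ler_wpM2r ?(trunc_ge0 k0) // Q_lip.
Qed.

Let jump_sdf d z B l K x h : 0 < d -> d < 1 -> bnd B z -> lip l z -> sdf K z ->
  0 <= l ->
  `|jump d z (x + h) + jump d z (x - h) - 2 * jump d z x| <=
  (K * mass d + (2 * (Cx * l) + Cx * B) * M1) * `|h| ^+ 2.
Proof.
move=> d0 d1 bz lz sz l0; have cz := lip_continuous lz.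
have i1 := itg_jump k0 mk Ik chi1 bchi (x + h) d0 cz bz.
have i1' := itg_jump k0 mk Ik chi1 bchi (x - h) d0 cz bz.
have i2 := itg_jump k0 mk Ik chi1 bchi x d0 cz bz.
have [i3 E] := I_far (K * `|h| ^+ 2) ((2 * (Cx * l) + Cx * B) * `|h| ^+ 2) d0 d1.
have -> : (K * mass d + (2 * (Cx * l) + Cx * B) * M1) * `|h| ^+ 2 =
  K * `|h| ^+ 2 * mass d + (2 * (Cx * l) + Cx * B) * `|h| ^+ 2 * M1 by ring.
rewrite -E -(JZ 2 i2) -(JD i1 i1') -(JB (ItgD i1 i1') (ItgZ 2 i2)).
apply: J_norm_le => //.
  exact: Itg_meas (ItgB (ItgD i1 i1') (ItgZ 2 i2)).
move=> v; rewrite mulrA -!mulrDl -mulrBl normrM (ger0_norm (trunc_ge0 k0 _ _)).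
by rewrite ler_wpM2r ?(trunc_ge0 k0) // (Q_sdf (B := B) (l := l)).
Qed.

Variables (lam H Ch : R) (f : 'rV[R]_n -> R).
Hypotheses (lam0 : 0 < lam) (bf : bnd H f) (lf : lip Ch f) (sf : sdf Ch f).
Hypothesis Ch0 : 0 <= Ch.

Let B := H / lam.
Let l := (Ch + Cx * B * M1) / lam.
Let K := (Ch + (2 * (Cx * l) + Cx * B) * M1) / lam.

Let H0 : 0 <= H. Proof. exact: bnd_ge0 bf. Qed.
Let B0 : 0 <= B. Proof. by rewrite divr_ge0 // ltW. Qed.
Let l0 : 0 <= l.
Proof. by rewrite divr_ge0 ?(ltW lam0) // addr_ge0 // mulr_ge0 // mulr_ge0. Qed.
Let K0 : 0 <= K.
Proof.
by rewrite divr_ge0 ?(ltW lam0) // addr_ge0 // mulr_ge0 // addr_ge0 // mulr_ge0 // mulr_ge0.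
Qed.

Section truncated.
Variable d : R.
Hypotheses (d0 : 0 < d) (d1 : d < 1).

Let m0 : 0 <= mass d. Proof. exact: mass_ge0. Qed.
Let lm : 0 < lam + mass d. Proof. by rewrite ltr_wpDr. Qed.

Let Phi (z : 'rV[R]_n -> R) x := (f x + jump d z x) / (lam + mass d).

Let cls (z : 'rV[R]_n -> R) := [/\ bnd B z, lip l z & sdf K z].

Let Phi_cls z : cls z -> cls (Phi z).
Proof.
move=> [bz lz sz]; have cz := lip_continuous lz.
have lamn0 : lam != 0 by rewrite gt_eqF.
have nm a : `|a / (lam + mass d)| = `|a| / (lam + mass d).
  by rewrite normrM (ger0_norm (_ : 0 <= (lam + mass d)^-1)) // invr_ge0 ltW.
split=> [x|x h|x h].
- rewrite /Phi nm ler_pdivrMr //.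
  have -> : B * (lam + mass d) = H + B * mass d by rewrite /B; field.
  rewrite (le_trans (ler_normD _ _)) //; apply: lerD => //.
  exact: (jump_bnd k0 mk Ik chi1 bchi).
- rewrite /Phi -mulrBl nm ler_pdivrMr //.
  have -> : l * `|h| * (lam + mass d) =
    Ch * `|h| + (l * mass d + Cx * B * M1) * `|h| by rewrite /l; field.
  have -> : f (x + h) + jump d z (x + h) - (f x + jump d z x) =
    (f (x + h) - f x) + (jump d z (x + h) - jump d z x) by ring.
  rewrite (le_trans (ler_normD _ _)) //; apply: lerD => //; exact: jump_lip.
rewrite /Phi mulrA -mulrDl -mulrBl nm ler_pdivrMr //.
have -> : K * `|h| ^+ 2 * (lam + mass d) = Ch * `|h| ^+ 2 +
   (K * mass d + (2 * (Cx * l) + Cx * B) * M1) * `|h| ^+ 2 by rewrite /K; field.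
have -> : f (x + h) + jump d z (x + h) + (f (x - h) + jump d z (x - h)) -
   2 * (f x + jump d z x) = (f (x + h) + f (x - h) - 2 * f x) +
   (jump d z (x + h) + jump d z (x - h) - 2 * jump d z x) by ring.
rewrite (le_trans (ler_normD _ _)) //; apply: lerD => //; exact: jump_sdf.
Qed.

Let theta := mass d / (lam + mass d).

Let theta0 : 0 <= theta. Proof. by rewrite divr_ge0 // ltW. Qed.
Let theta1 : theta < 1. Proof. by rewrite ltr_pdivrMr // mul1r ltrDr. Qed.

Let Phi_contract z w C : cls z -> cls w -> bnd C (fun x => z x - w x) ->
  bnd (theta * C) (fun x => Phi z x - Phi w x).
Proof.
move=> [bz lz _] [bw lw _] bC x; have cz := lip_continuous lz; have cw := lip_continuous lw.
rewrite /Phi -mulrBl opprD addrACA subrr add0r.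
rewrite -(jump_sub k0 mk Ik chi1 bchi x d0 cz bz cw bw) normrM.
rewrite (ger0_norm (_ : 0 <= (lam + mass d)^-1)); last by rewrite invr_ge0 ltW.
rewrite /theta mulrAC ler_wpM2r ?invr_ge0 ?(ltW lm) // mulrC.
apply: (jump_bnd k0 mk Ik chi1 bchi) => //.
exact: continuous_sub.
Qed.

(** A fixed point of z |-> (f + jump d z) / (lam + mass d). This map is a
    contraction, and it preserves the bounds B, l and K, which do not depend on
    d: the commutator with chi only occurs for long jumps, of total mass M1. *)
Lemma truncated_solution : exists2 z, cls z & forall x, lam * z x + Ltrunc d z x = f x.
Proof.
pose z m := iter m Phi (fun=> 0).
have cz m : cls (z m).
  elim: m => [|m IHm]; last exact: Phi_cls.
  split=> x *; rewrite /= ?subrr ?mulr0 ?addr0 ?subrr ?normr0 //.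
    by rewrite mulr_ge0.
  by rewrite mulr_ge0 // exprn_ge0.
have z1 m : bnd (theta ^+ m * B) (fun x => z m.+1 x - z m x).
  elim: m => [|m IHm] x.
    by rewrite expr0 mul1r subr0; case: (cz 1%N).
  by rewrite exprS -mulrA; exact: Phi_contract (cz _) (cz _) IHm x.
have t1 : 0 < 1 - theta by rewrite subr_gt0.
have zml m j x : `|z (m + j)%N x - z m x| <= B / (1 - theta) * theta ^+ m * (1 - theta ^+ j).
  elim: j => [|j IHj]; first by rewrite addn0 subrr normr0 expr0 subrr mulr0.
  rewrite addnS -(subrKA (z (m + j)%N x)) (le_trans (ler_normD _ _)) //.
  apply: (le_trans (lerD (z1 _ _) IHj)).
  rewrite exprD exprS le_eqVlt; apply/orP; left; apply/eqP; field.
  by rewrite gt_eqF.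
have c := @cvg_geo0 _ (B / (1 - theta)) _ theta0 theta1.
have [w wz] : exists w, forall m x, `|w x - z m x| <= B / (1 - theta) * theta ^+ m.
  apply: (uniform_cauchy_limit c) => m j x jm; rewrite -(subnKC jm).
  apply: (le_trans (zml _ _ _)); apply: ler_piMr; last by rewrite gerBl exprn_ge0.
  by rewrite mulr_ge0 ?exprn_ge0 // divr_ge0 // ltW.
have cw : cls w.
  by split; [apply: (bnd_limit c wz)|apply: (lip_limit c wz)|apply: (sdf_limit c wz)] => m; case: (cz m).
exists w => // x.
have E : w x = Phi w x.
  apply/eqP; rewrite -subr_eq0 -normr_le0.
  have c2 : 2 * (B / (1 - theta) * theta ^+ m) @[m --> \oo] --> 0.
    by rewrite -[X in _ --> X](mulr0 2); apply: cvgM => //; exact: cvg_cst.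
  apply: (le_of_small c2) => m; rewrite add0r.
  rewrite -(subrKA (z m.+1 x)) (le_trans (ler_normD _ _)) // mulr_natl mulr2n.
  have t1' := ltW theta1.
  have g0 : 0 <= B / (1 - theta) * theta ^+ m by rewrite mulr_ge0 ?exprn_ge0 // divr_ge0 // ltW.
  apply: lerD.
    apply: (le_trans (wz _ _)); rewrite exprSr mulrA ler_piMr //.
  rewrite distrC; apply: (le_trans (Phi_contract cw (cz m) (wz m) x)).
  by rewrite ler_piMl.
case: cw => bw lw _.
rewrite (LtruncE k0 mk Ik chi1 bchi x d0 (lip_continuous lw) bw) {1 2}E /Phi.
by field; exact: lt0r_neq0 lm.
Qed.

End truncated.

(** The truncated solutions form a Cauchy sequence by the maximum principle, as
    d goes to 0, and their common C^{1,1} bounds pass to the limit. *)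
Lemma resolvent_solution : exists2 z, bnd B z /\ bls z &
  forall x, lam * z x + Lchi z x = f x.
Proof.
pose d m : R := m.+2%:R^-1.
have d0 m : 0 < d m by rewrite invr_gt0 ltr0n.
have d1 m : d m < 1 by rewrite invf_lt1 ?ltr1n.
have [z zP] : exists z, forall m, [/\ bnd B (z m), lip l (z m) & sdf K (z m)] /\
    forall x, lam * z m x + Ltrunc (d m) (z m) x = f x.
  have /choice[z zP] : forall m, exists z, [/\ bnd B z, lip l z & sdf K z] /\
    forall x, lam * z x + Ltrunc (d m) z x = f x.
    by move=> m; have [z ? ?] := truncated_solution (d0 m) (d1 m); exists z.
  by exists z.
pose C := K + 2 * B.
have C0 : 0 <= C by rewrite addr_ge0 // mulr_ge0.
have om := omega_cvg0 k0 mk Ik.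
have ce c : c * omega (d m) @[m --> \oo] --> 0.
  by rewrite -[X in _ --> X](mulr0 c); apply: cvgM => //; exact: cvg_cst.
have [w wz] : exists w, forall m x, `|w x - z m x| <= 2 * C / lam * omega (d m).
  apply: (uniform_cauchy_limit (ce _)) => m j x jm.
  have [[bm lm sm] em] := zP m; have [[bj lj sj] ej] := zP j.
  have cm := lip_continuous lm; have cj := lip_continuous lj.
  have cd : continuous (fun x => z m x - z j x).
    exact: continuous_sub.
  have bd : bnd (B + B) (fun x => z m x - z j x).
    by move=> y; rewrite (le_trans (ler_normB _ _)) // lerD.
  rewrite mulrAC ler_pdivlMr // mulrC.
  apply: (maximum_trunc (d0 m) lam0 cd bd) => y.
  rewrite (LtruncE k0 mk Ik chi1 bchi y (d0 m) cd bd).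
  rewrite (jump_sub k0 mk Ik chi1 bchi y (d0 m) cm bm cj bj).
  have Em := em y; have Ej := ej y.
  have Lm := LtruncE k0 mk Ik chi1 bchi y (d0 m) cm bm.
  have Lj := LtruncE k0 mk Ik chi1 bchi y (d0 m) cj bj.
  have -> : lam * (z m y - z j y) + (mass (d m) * (z m y - z j y) -
     (jump (d m) (z m) y - jump (d m) (z j) y)) =
     (Ltrunc (d j) (z j) y - Lchi (z j) y) + (Lchi (z j) y - Ltrunc (d m) (z j) y).
    by rewrite Lj; rewrite Lm in Em; lra.
  rewrite (le_trans (ler_normD _ _)) // -mulrA mulr_natl mulr2n; apply: lerD.
    by rewrite distrC; exact: (Ltrunc_close k0 mk Ik chi1 bchi).
  apply: (le_trans (Ltrunc_close k0 mk Ik chi1 bchi y (d0 m) cj bj sj)).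
  rewrite ler_wpM2l // (omega_le k0 mk Ik) // lef_pV2 ?posrE // ler_nat.
  by rewrite !ltnS.
have bw : bnd B w by apply: (bnd_limit (ce _) wz) => m; case: (zP m) => -[].
have lw : lip l w by apply: (lip_limit (ce _) wz) => m; case: (zP m) => -[].
have sw : sdf K w by apply: (sdf_limit (ce _) wz) => m; case: (zP m) => -[].
exists w; first by split => //; exact: blsP bw lw sw.
move=> x; apply/eqP; rewrite -subr_eq0 -normr_le0.
have cw := lip_continuous lw.
have key j m : `|lam * w x + Lchi w x - f x| <=
    2 * C * omega (d j) +
    ((lam + 2 * mass (d j)) * (2 * C / lam) + C) * omega (d m).
  have [[bm lm sm] em] := zP m; have cm := lip_continuous lm.
  pose em' := 2 * C / lam * omega (d m).
  have bd : bnd em' (fun x => w x - z m x) by exact: wz.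
  have cd : continuous (fun x => w x - z m x).
    exact: continuous_sub.
  have h1 := Ltrunc_close k0 mk Ik chi1 bchi x (d0 j) cw bw sw.
  have h2 := Ltrunc_close k0 mk Ik chi1 bchi x (d0 j) cm bm sm.
  have h3 := Ltrunc_close k0 mk Ik chi1 bchi x (d0 m) cm bm sm.
  have h4 := jump_bnd k0 mk Ik chi1 bchi x (d0 j) cd bd.
  rewrite (jump_sub k0 mk Ik chi1 bchi x (d0 j) cw bw cm bm) in h4.
  have h5 : `|mass (d j) * (w x - z m x)| <= mass (d j) * em'.
    by rewrite normrM (ger0_norm (mass_ge0 k0 _)) ler_wpM2l // mass_ge0.
  have h6 : `|lam * (w x - z m x)| <= lam * em'.
    by rewrite normrM (gtr0_norm lam0) ler_pM2l.
  have Lw := LtruncE k0 mk Ik chi1 bchi x (d0 j) cw bw.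
  have Lm := LtruncE k0 mk Ik chi1 bchi x (d0 j) cm bm.
  have e := em x; rewrite -/C in h1 h2 h3.
  have -> : 2 * C * omega (d j) + ((lam + 2 * mass (d j)) * (2 * C / lam) + C) *
      omega (d m) = 2 * (C * omega (d j)) + lam * em' + 2 * (mass (d j) * em') +
      C * omega (d m) by rewrite /em'; ring.
  rewrite mulrC in h4.
  move: h1 h2 h3 h4 h5 h6; rewrite !ler_norml.
  move=> /andP[? ?] /andP[? ?] /andP[? ?] /andP[? ?] /andP[? ?] /andP[? ?].
  by apply/andP; split; lra.
apply: (le_of_small (ce (2 * C))) => j; rewrite add0r.
exact: (le_of_small (ce _)) (key j).
Qed.

End resolvent_solution.

(** * The Stone-Weierstrass theorem *)

Section compact_minimum.
Context {R : realType} {T : ptopologicalType}.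

Lemma open_below (h F : T -> R) : continuous h -> continuous F ->
  open [set z | h z < F z].
Proof.
move=> ch cF; rewrite (_ : [set z | _] = (fun z => F z - h z) @^-1` [set t | 0 < t]).
  apply: open_comp; last exact: open_gt.
  by move=> z _; exact: (cvgB (cF z) (ch z)).
by apply/seteqP; split=> z /=; rewrite subr_gt0.
Qed.

(** Compactness turns pointwise domination by members of a min-stable family
    into uniform domination by one member. *)
Lemma compact_min (K : set T) (C : set (T -> R)) (F : T -> R) :
  compact K -> (forall h, C h -> continuous h) -> continuous F ->
  (forall g h, C g -> C h -> C (fun z => Num.min (g z) (h z))) ->
  C !=set0 -> (forall y, K y -> exists2 h, C h & h y < F y) ->
  exists2 h, C h & forall y, K y -> h y < F y.
Proof.
move=> cK cC cF minC [h0 Ch0] KC.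
have /choice[H HP] : forall y, exists h, C h /\ (K y -> h y < F y).
  move=> y; have [Ky|nKy] := pselect (K y); last by exists h0.
  by have [h Ch hy] := KC y Ky; exists h.
move: cK; rewrite compact_cover => /(_ T K (fun y => [set z | H y z < F z])).
case=> [y Ky|y Ky|D' D'K KD']; first by apply: open_below => //; apply: cC; case: (HP y).
  by exists y => //=; apply: (HP y).2.
have [h Ch hH] : exists2 h, C h & forall y, y \in finmap.enum_fset D' -> forall z, h z <= H y z.
  move: (finmap.enum_fset D'); elim=> [|y s [h Ch hs]]; first by exists h0.
  exists (fun z => Num.min (H y z) (h z)); first by apply: minC => //; case: (HP y).
  move=> y'; rewrite inE => /orP[/eqP ->|/hs y's] z; first by rewrite ge_min lexx.
  by rewrite ge_min y's orbT.
exists h => // z /KD'[y /= yD' /=]; apply: le_lt_trans; exact: hH.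
Qed.

End compact_minimum.

Section stone_weierstrass.
Context {R : realType} {T : ptopologicalType}.
Variables (K : set T) (A : set (T -> R)).
Hypotheses (cK : compact K) (cA : forall g, A g -> continuous g).
Hypotheses (A1 : forall c, A (fun=> c)).
Hypotheses (AD : forall g h, A g -> A h -> A (fun z => g z + h z)).
Hypotheses (AM : forall g h, A g -> A h -> A (fun z => g z * h z)).
Hypothesis Asep : forall x y, K x -> K y -> x <> y -> exists2 g, A g & g x <> g y.

Let cl h := continuous h /\
  forall e, 0 < e -> exists2 g, A g & forall z, K z -> `|h z - g z| <= e.

Let AZ c g : A g -> A (fun z => c * g z).
Proof. by move=> Ag; exact: AM (A1 c) Ag. Qed.

Let A_cl g : A g -> cl g.
Proof.
by move=> Ag; split=> [|e e0]; [exact: cA|exists g => // z _; rewrite subrr normr0 ltW].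
Qed.

Let clD g h : cl g -> cl h -> cl (fun z => g z + h z).
Proof.
move=> [cg ag] [ch ah]; split=> [z|e e0]; first exact: (cvgD (cg z) (ch z)).
have e2 : 0 < e / 2 by rewrite divr_gt0.
have [g' Ag' gg'] := ag _ e2; have [h' Ah' hh'] := ah _ e2.
exists (fun z => g' z + h' z) => [|z Kz]; first exact: AD.
rewrite opprD addrACA (le_trans (ler_normD _ _)) // [leRHS]splitr.
by apply: lerD; [exact: gg'|exact: hh'].
Qed.

Let clZ c g : cl g -> cl (fun z => c * g z).
Proof.
move=> [cg ag]; split=> [z|e e0]; first by apply: cvgM; [exact: cvg_cst|exact: cg].
have c1 : 0 < `|c| + 1 by rewrite ltr_wpDl.
have [g' Ag' gg'] := ag (e / (`|c| + 1)) (divr_gt0 e0 c1).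
exists (fun z => c * g' z) => [|z Kz]; first exact: AZ.
rewrite -mulrBr normrM (le_trans (ler_wpM2l _ (gg' z Kz))) //.
by rewrite mulrCA ger_pMr // ler_pdivrMr // mul1r lerDl.
Qed.

(* q m is a polynomial approximation of t |-> |t| from below *)
Let q := fix q m (t : R) := if m is m'.+1 then q m' t + (t ^+ 2 - q m' t ^+ 2) / 2 else 0.

Let q_bound m (t : R) : `|t| <= 1 -> 0 <= q m t /\ q m t <= `|t| /\
  `|t| - q m t <= `|t| * (1 - `|t| / 2) ^+ m.
Proof.
move=> t1; have t2 : t ^+ 2 = `|t| ^+ 2 by rewrite real_normK ?num_real.
elim: m => [|m [q0 [qt qm]]]; first by rewrite /= expr0 mulr1 subr0.
rewrite /= t2; have t0 := normr_ge0 t; move: (`|t|) t1 t0 qt qm => u u1 u0 qt qm.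
have E : u - (q m t + (u ^+ 2 - q m t ^+ 2) / 2) = (u - q m t) * (1 - (u + q m t) / 2).
  by field.
have f0 : 0 <= 1 - (u + q m t) / 2 by lra.
have f1 : 1 - (u + q m t) / 2 <= 1 - u / 2 by lra.
split; first by rewrite addr_ge0 // divr_ge0 // subr_sqr mulr_ge0 ?subr_ge0 ?addr_ge0.
split; first by rewrite -subr_ge0 E mulr_ge0 // subr_ge0.
rewrite E exprSr mulrA; apply: ler_pM => //; by rewrite subr_ge0.
Qed.

Let q_close m (t : R) : `|t| <= 1 -> `| `|t| - q m t| <= 2 / m.+1%:R.
Proof.
move=> t1; have [q0 [qt qm]] := q_bound m t1; rewrite ger0_norm ?subr_ge0 //.
apply: (le_trans qm); have t0 := normr_ge0 t; move: (`|t|) t1 t0 => u u1 u0.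
have bern j : (1 - u / 2) ^+ j * (1 + j%:R * (u / 2)) <= 1.
  elim: j => [|j IHj]; first by rewrite expr0 mul0r addr0 mulr1.
  rewrite exprSr -mulrA; apply: le_trans IHj; apply: ler_wpM2l.
    by rewrite exprn_ge0 //; lra.
  have j0 : 0 <= j%:R :> R by []. rewrite -(natr1 j).
  have : 0 <= (u / 2) ^+ 2 * (j%:R + 1) by rewrite mulr_ge0 ?sqr_ge0 // addr_ge0.
  by nra.
rewrite ler_pdivlMr // mulrC -subr_ge0.
have := bern m; have p0 : 0 <= (1 - u / 2) ^+ m by rewrite exprn_ge0 //; lra.
have m0 : 0 <= m%:R :> R by [].
rewrite -(natr1 m); move: ((1 - u / 2) ^+ m) p0 => p p0 H.
have : 0 <= p * (2 - u) by rewrite mulr_ge0 //; lra.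
lra.
Qed.

Let A_q m g : A g -> A (fun z => q m (g z)).
Proof.
move=> Ag; elim: m => [|m IHm] /=; first exact: A1.
have E : (fun z => q m (g z) + (g z ^+ 2 - q m (g z) ^+ 2) / 2) =
   (fun z => q m (g z) + (2^-1 * (g z * g z) + (- 2^-1) * (q m (g z) * q m (g z)))).
  by apply/funext => z; field.
by rewrite E; apply: AD => //; apply: AD; apply: AZ; exact: AM.
Qed.

Let A_bounded g : A g -> exists2 B, 0 < B & forall z, K z -> `|g z| <= B.
Proof.
move=> /cA cg; have := @continuous_compact _ _ g K (continuous_subspaceT cg) cK.
move=> /compact_bounded[B [_ HB]]; exists (`|B| + 1); first by rewrite ltr_wpDl.
move=> z Kz; apply: (HB (`|B| + 1)); last by exists z.
by rewrite (le_lt_trans (ler_norm _)) // ltrDl.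
Qed.

Let cl_abs h : cl h -> cl (fun z => `|h z|).
Proof.
move=> [ch ah]; split=> [z|e e0].
  exact: (cvg_norm (ch z)).
have e2 : 0 < e / 2 by rewrite divr_gt0.
have [g Ag hg] := ah _ e2; have [B B0 gB] := A_bounded Ag.
pose m := Num.trunc (2 * B / (e / 2)).
exists (fun z => B * q m (B^-1 * g z)) => [|z Kz].
  by apply: AZ; apply: (A_q m (g := fun z => B^-1 * g z)); exact: AZ.
have g1 : `|B^-1 * g z| <= 1.
  by rewrite normrM gtr0_norm ?invr_gt0 // mulrC ler_pdivrMr // mul1r gB.
have E : `|g z| = B * `|B^-1 * g z|.
  by rewrite normrM gtr0_norm ?invr_gt0 // mulrA divff ?mul1r // gt_eqF.
rewrite -(subrKA `|g z|) (le_trans (ler_normD _ _)) // [leRHS]splitr; apply: lerD.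
  by rewrite (le_trans (ler_dist_dist _ _)) // hg.
rewrite E -mulrBr normrM (gtr0_norm B0) (le_trans (ler_wpM2l (ltW B0) (q_close m g1))) //.
rewrite mulrA [B * 2]mulrC ler_pdivrMr // [leRHS]mulrC -ler_pdivrMr //.
exact/ltW/truncnS_gt.
Qed.

Let cl_min g h : cl g -> cl h -> cl (fun z => Num.min (g z) (h z)).
Proof.
move=> cg ch.
have := clZ 2^-1 (clD (clD cg ch) (clZ (-1) (cl_abs (clD cg (clZ (-1) ch))))).
congr cl; apply/funext => z; by rewrite minr_absE !mulN1r mulrC.
Qed.

Let interpolate (f : T -> R) x y : K x -> K y ->
  exists2 g, A g & g x = f x /\ g y = f y.
Proof.
move=> Kx Ky; have [<-|/eqP xy] := eqVneq x y; first by exists (fun=> f x).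
have [g Ag /eqP gxy] := Asep Kx Ky xy.
have d0 : g x - g y != 0 by rewrite subr_eq0.
exists (fun z => f y + (f x - f y) / (g x - g y) * (g z + - g y)).
  by apply: AD => //; apply: AZ; apply: AD.
by split; field.
Qed.

(** The uniform closure of A is stable under absolute values, hence under
    minima and, through opposites, maxima; interpolation at two points and
    compactness, used twice, then give the approximation. *)
Theorem stone_weierstrass (f : T -> R) (e : R) : continuous f -> 0 < e ->
  exists2 g, A g & forall z, K z -> `|f z - g z| <= e.
Proof.
move=> cf e0; have [K0|/set0P[x0 Kx0]] := eqVneq K set0.
  by exists (fun=> 0) => // z; rewrite K0.
have e2 : 0 < e / 2 by rewrite divr_gt0.
have cfe c : continuous (fun z => f z + c).
  by move=> z; apply: cvgD; [exact: cf|exact: cvg_cst].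
have one x : K x -> exists2 h, cl h & h x = f x /\ forall y, K y -> h y < f y + e / 2.
  move=> Kx; have [] := @compact_min _ _ K [set h | cl h /\ h x = f x]
    (fun z => f z + e / 2) cK _ (cfe _) _ _ _.
  - by move=> h [[]].
  - move=> g h [cg gx] [ch hx]; split; first exact: cl_min.
    by rewrite gx hx minxx.
  - by exists (fun=> f x); split => //; exact/A_cl/A1.
  - move=> y Ky; have [g Ag [gx gy]] := interpolate f Kx Ky.
    by exists g; [split => //; exact: A_cl|rewrite gy ltrDl].
  by move=> h [ch hx] hf; exists h.
have clN h : cl h -> cl (fun z => - h z).
  by move=> /(clZ (-1)); congr cl; apply/funext => z; rewrite mulN1r.
have [] := @compact_min _ _ K [set h | cl h /\ forall y, K y -> - (f y + e / 2) < h y]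
    (fun z => - f z + e / 2) cK _ _ _ _ _.
- by move=> h [[]].
- move=> z; apply: cvgD; [exact: (cvgN (cf z))|exact: cvg_cst].
- move=> g h [cg gf] [ch hf]; split; first exact: cl_min.
  by move=> y Ky; rewrite lt_min gf // hf.
- have [h ch [_ hf]] := one _ Kx0; exists (fun z => - h z); split; first exact: clN.
  by move=> y Ky; rewrite ltrN2 hf.
- move=> y Ky; have [h ch [hy hf]] := one _ Ky.
  exists (fun z => - h z); last by rewrite hy ltrDl.
  by split; [exact: clN|move=> z Kz; rewrite ltrN2 hf].
move=> h [[ch ah] hlow] hup; have [g Ag hg] := ah _ e2.
exists (fun z => -1 * g z) => [|z Kz]; first exact: AZ.
have := hg z Kz; have := hlow z Kz; have := hup z Kz.
by rewrite !ler_norml => ? ? /andP[? ?]; apply/andP; split; lra.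
Qed.

End stone_weierstrass.

(** * Powers of |z| and their discrete Laplacian *)

Section power_estimates.
Context {R : realType}.
Implicit Types b r t : R.

Lemma mean_value_bound (f df : R -> R) (C r r' : R) :
  (forall t, Num.min r r' <= t -> t <= Num.max r r' -> is_derive t 1 f (df t)) ->
  (forall t, Num.min r r' <= t -> t <= Num.max r r' -> `|df t| <= C) ->
  `|f r' - f r| <= C * `|r' - r|.
Proof.
wlog rr : r r' / r <= r' => [H dfE dfC|].
  have [/H|/ltW/H] := leP r r'; first exact.
  by rewrite minC maxC => H'; rewrite distrC (distrC r'); apply: H'.
rewrite (min_idPl rr) (max_idPr rr) => dfE dfC.
have h1 (t : R) : t \in `]r, r'[ -> is_derive t 1 f (df t).
  by rewrite in_itv /= => /andP[/ltW ? /ltW ?]; exact: dfE.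
have h2 : {within `[r, r'], continuous f}.
  apply: derivable_within_continuous => t; rewrite in_itv /= => /andP[? ?].
  by have [] := dfE t.
have [c] := MVT_segment rr h1 h2.
rewrite in_itv /= => /andP[rc cr'] ->; rewrite normrM.
by apply: ler_wpM2r => //; exact: dfC.
Qed.

(** Used at t = |z|^2, where it is |z|^(-2b). *)
Definition npow b (t : R) : R := t `^ (- b).

Lemma npow_ge0 b t : 0 <= npow b t. Proof. exact: powR_ge0. Qed.

Lemma npow_le1 b t : 0 <= b -> 1 <= t -> npow b t <= 1.
Proof.
move=> b0 t1; rewrite /npow powRN invf_le1 ?powR_gt0 ?(lt_le_trans ltr01) //.
by rewrite -(powRr0 t); apply: ler_powR.
Qed.

Lemma npow_mul b t : 0 < t -> npow (b + 1) t * t = npow b t.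
Proof.
move=> t0; rewrite /npow -[X in _ * X = _](powRr1 (ltW t0)) -powRD; last first.
  by rewrite (gt_eqF t0) implybT.
by congr (_ `^ _); ring.
Qed.

Lemma is_derive_npow b t : 0 < t ->
  is_derive t 1 (npow b) (- b * npow (b + 1) t).
Proof.
move=> t0; have := is_derive1_powR (- b) t0.
by rewrite (_ : - b - 1 = - (b + 1)) //; ring.
Qed.

Lemma npow_lip b r r' : 0 <= b -> 1 <= r -> 1 <= r' ->
  `|npow b r' - npow b r| <= b * `|r' - r|.
Proof.
move=> b0 r1 r'1.
have m1 t : Num.min r r' <= t -> 1 <= t by apply: le_trans; rewrite le_min r1.
apply: (@mean_value_bound _ (fun t => - b * npow (b + 1) t)) => t /m1 t1 _.
  by apply: is_derive_npow; exact: lt_le_trans ltr01 t1.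
rewrite normrM normrN (ger0_norm b0) (ger0_norm (npow_ge0 _ _)).
by rewrite ler_piMr // npow_le1 // addr_ge0.
Qed.

Let between t r r' : Num.min r r' <= t -> t <= Num.max r r' -> `|t - r| <= `|r' - r|.
Proof.
have [rr|rr] := leP r r' => rt tr.
  by rewrite !ger0_norm ?subr_ge0 // lerD2r.
by rewrite distrC (distrC r') !ger0_norm ?subr_ge0 ?(ltW rr) // lerD2l lerN2.
Qed.

Lemma npow_taylor1 b r r' : 0 <= b -> 1 <= r -> 1 <= r' ->
  `|npow b r' - npow b r + b * npow (b + 1) r * (r' - r)| <=
  b * (b + 1) * `|r' - r| ^+ 2.
Proof.
move=> b0 r1 r'1.
have m1 t : Num.min r r' <= t -> 1 <= t by apply: le_trans; rewrite le_min r1.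
pose F t := npow b t + b * npow (b + 1) r * (t - r).
have -> : npow b r' - npow b r + b * npow (b + 1) r * (r' - r) = F r' - F r.
  by rewrite /F subrr; ring.
rewrite expr2 mulrA.
apply: (@mean_value_bound _ (fun t => - b * npow (b + 1) t + b * npow (b + 1) r)).
  move=> t /m1 t1 _; have t0 := lt_le_trans ltr01 t1.
  have d1 := is_derive_npow b t0.
  have d2 : is_derive t 1 (fun t => b * npow (b + 1) r * (t - r)) (b * npow (b + 1) r).
    by apply: is_derive_eq; rewrite subr0 ?scaler1 -[RHS]mulr1 /GRing.scale /=; ring.
  exact: is_deriveD.
move=> t tm tM; have t1 := m1 _ tm.
have -> : - b * npow (b + 1) t + b * npow (b + 1) r =
  - (b * (npow (b + 1) t - npow (b + 1) r)) by ring.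
rewrite normrN normrM (ger0_norm b0) -mulrA ler_wpM2l //.
apply: (le_trans (npow_lip _ r1 t1)); first by rewrite addr_ge0.
by apply: ler_wpM2l; [rewrite addr_ge0|exact: between tM].
Qed.

Lemma npow_taylor2 b r r' : 0 <= b -> 1 <= r -> 1 <= r' ->
  `|npow b r' - npow b r + b * npow (b + 1) r * (r' - r)
    - b * (b + 1) / 2 * npow (b + 2) r * (r' - r) ^+ 2| <=
  b * (b + 1) * (b + 2) * `|r' - r| ^+ 3.
Proof.
move=> b0 r1 r'1.
have m1 t : Num.min r r' <= t -> 1 <= t by apply: le_trans; rewrite le_min r1.
pose F t := npow b t + (b * npow (b + 1) r * (t - r)
   - b * (b + 1) / 2 * npow (b + 2) r * (t - r) ^+ 2).
have -> : npow b r' - npow b r + b * npow (b + 1) r * (r' - r)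
    - b * (b + 1) / 2 * npow (b + 2) r * (r' - r) ^+ 2 = F r' - F r.
  by rewrite /F subrr expr0n /=; ring.
rewrite exprSr mulrA.
apply: (@mean_value_bound _ (fun t => - b * npow (b + 1) t + (b * npow (b + 1) r -
    b * (b + 1) * npow (b + 2) r * (t - r)))).
  move=> t /m1 t1 _; have t0 := lt_le_trans ltr01 t1.
  have d1 := is_derive_npow b t0.
  have d2 : is_derive t 1 (fun t => b * npow (b + 1) r * (t - r)
      - b * (b + 1) / 2 * npow (b + 2) r * (t - r) ^+ 2)
     (b * npow (b + 1) r - b * (b + 1) * npow (b + 2) r * (t - r)).
    by apply: is_derive_eq; rewrite /GRing.scale /= ?expr1; field.
  exact: is_deriveD.
have b2 : b + 1 + 1 = b + 2 by ring.
move=> t tm tM; have t1 := m1 _ tm.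
have -> : - b * npow (b + 1) t + (b * npow (b + 1) r -
    b * (b + 1) * npow (b + 2) r * (t - r)) =
  - (b * (npow (b + 1) t - npow (b + 1) r + (b + 1) * npow (b + 1 + 1) r * (t - r))).
  by rewrite b2; ring.
rewrite normrN normrM (ger0_norm b0) -(mulrA b) -(mulrA b) ler_wpM2l //.
apply: (le_trans (npow_taylor1 _ r1 t1)); first by rewrite addr_ge0.
rewrite b2; apply: ler_wpM2l; first by rewrite mulr_ge0 // addr_ge0.
by rewrite ler_pXn2r ?nnegrE //; exact: between tM.
Qed.

End power_estimates.

Section discrete_laplacian.
Context {R : realType} {n : nat}.
Implicit Types x y z : 'rV[R]_n.

Definition sq z : R := \sum_i z 0 i ^+ 2.

Lemma sq_shift z i t : sq (z + t *: delta_mx 0 i) = sq z + (t ^+ 2 + 2 * t * z 0 i).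
Proof.
rewrite /sq (bigD1 i) //= [in RHS](bigD1 i) //= !mxE !eqxx mulr1.
have -> : \sum_(j | j != i) (z + t *: delta_mx 0 i) 0 j ^+ 2 =
    \sum_(j | j != i) z 0 j ^+ 2.
  by apply: eq_bigr => j ji; rewrite !mxE (negbTE ji) mulr0 addr0.
ring.
Qed.

(** The second order terms of the Taylor expansions add up to the identity
    Delta |z|^(-2b) = 2b (2b + 2 - n) |z|^(-2b-2). *)
Lemma laplacian_npow (i0 : 'I_n) (b : R) z (h C : R) : 0 <= b -> 0 < h -> h <= 1 -> (forall i, `|z 0 i| <= C) ->
  (forall i (t : R), `|t| <= 1 -> 1 <= sq (z + t *: delta_mx 0 i)) ->
  `|\sum_i (npow b (sq (z + h *: delta_mx 0 i)) + npow b (sq (z - h *: delta_mx 0 i))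
       - 2 * npow b (sq z)) - 2 * b * (2 * b + 2 - n%:R) * npow (b + 1) (sq z) * h ^+ 2|
  <= n%:R * (2 * (b * (b + 1) * (b + 2)) * (1 + 2 * C) ^+ 3 + b * (b + 1)) * h ^+ 3.
Proof.
move=> b0 h0 h1 zC z1; set r := sq z.
have r1 : 1 <= r.
  by have := z1 i0 0; rewrite normr0 scale0r addr0; apply; exact: ler01.
have C0 : 0 <= C by exact: (le_trans (normr_ge0 (z 0 i0)) (zC i0)).
have c3 : 0 <= b * (b + 1) * (b + 2) by rewrite !mulr_ge0 ?addr_ge0.
pose t1 (i : 'I_n) := 2 * h ^+ 2 * b * npow (b + 1) r.
pose t2 i := b * (b + 1) / 2 * npow (b + 2) r * (8 * h ^+ 2 * z 0 i ^+ 2).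
have T i : `|npow b (sq (z + h *: delta_mx 0 i)) + npow b (sq (z - h *: delta_mx 0 i))
     - 2 * npow b r - (t2 i - t1 i)| <=
    (2 * (b * (b + 1) * (b + 2)) * (1 + 2 * C) ^+ 3 + b * (b + 1)) * h ^+ 3.
  have sg t : `|t| = h -> 1 <= sq (z + t *: delta_mx 0 i) /\
      `|sq (z + t *: delta_mx 0 i) - r| <= h * (1 + 2 * C).
    move=> th; split; first by apply: z1; rewrite th.
    rewrite sq_shift addrAC subrr add0r (le_trans (ler_normD _ _)) //.
    rewrite mulrDr mulr1; apply: lerD.
      by rewrite normrX th expr2 ler_piMr // ltW.
    rewrite !normrM th (ger0_norm (_ : 0 <= 2)) // -mulrA mulrCA ler_wpM2l ?(ltW h0) //.
    by rewrite ler_wpM2l.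
  have [p1 p2] := sg h (gtr0_norm h0).
  have [m1 m2] : 1 <= sq (z - h *: delta_mx 0 i) /\
      `|sq (z - h *: delta_mx 0 i) - r| <= h * (1 + 2 * C).
    by rewrite -scaleNr; apply: sg; rewrite normrN gtr0_norm.
  have e1 := npow_taylor2 b0 r1 p1; have e2 := npow_taylor2 b0 r1 m1.
  have cub (u : R) : `|u| <= h * (1 + 2 * C) ->
      b * (b + 1) * (b + 2) * `|u| ^+ 3 <=
      b * (b + 1) * (b + 2) * (1 + 2 * C) ^+ 3 * h ^+ 3.
    move=> uh; rewrite -[leRHS]mulrA; apply: ler_wpM2l => //.
    rewrite -exprMn mulrC; apply: lerXn2r; rewrite ?nnegrE ?mulr_ge0 ?(ltW h0) //.
    by rewrite addr_ge0 // mulr_ge0 // C0.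
  have {}e1 := le_trans e1 (cub _ p2); have {}e2 := le_trans e2 (cub _ m2).
  move: e1 e2; rewrite (_ : sq (z + h *: delta_mx 0 i) - r = h ^+ 2 + 2 * h * z 0 i);
    last by rewrite sq_shift addrAC subrr add0r.
  rewrite (_ : sq (z - h *: delta_mx 0 i) - r = h ^+ 2 - 2 * h * z 0 i); last first.
    by rewrite -scaleNr sq_shift addrAC subrr add0r; ring.
  set X := npow b _; set Y := npow b (sq (z - _)); set Z := npow b r.
  have n2 := npow_le1 (addr_ge0 b0 (ler0n R 2)) r1; have n2' := npow_ge0 (b + 2) r.
  move=> e1 e2; have h4 : `|b * (b + 1) / 2 * npow (b + 2) r * (2 * h ^+ 4)| <= b * (b + 1) * h ^+ 3.
    rewrite ger0_norm; last by rewrite !mulr_ge0 ?addr_ge0 ?exprn_ge0 // ltW.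
    have -> : b * (b + 1) / 2 * npow (b + 2) r * (2 * h ^+ 4) =
      b * (b + 1) * h ^+ 3 * (npow (b + 2) r * h) by field.
    rewrite ler_piMr ?mulr_ge0 ?addr_ge0 ?exprn_ge0 ?(ltW h0) //.
    by rewrite mulr_ile1 // ltW.
  have -> : X + Y - 2 * Z - (t2 i - t1 i) =
    (X - Z + b * npow (b + 1) r * (h ^+ 2 + 2 * h * z 0 i) -
      b * (b + 1) / 2 * npow (b + 2) r * (h ^+ 2 + 2 * h * z 0 i) ^+ 2) +
    (Y - Z + b * npow (b + 1) r * (h ^+ 2 - 2 * h * z 0 i) -
      b * (b + 1) / 2 * npow (b + 2) r * (h ^+ 2 - 2 * h * z 0 i) ^+ 2) +
    b * (b + 1) / 2 * npow (b + 2) r * (2 * h ^+ 4).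
    by rewrite /t1 /t2; field.
  rewrite [leRHS]mulrDl (le_trans (ler_normD _ _)) //; apply: lerD => //.
  rewrite (le_trans (ler_normD _ _)) //.
  have -> : 2 * (b * (b + 1) * (b + 2)) * (1 + 2 * C) ^+ 3 * h ^+ 3 =
    b * (b + 1) * (b + 2) * (1 + 2 * C) ^+ 3 * h ^+ 3 + b * (b + 1) * (b + 2) * (1 + 2 * C) ^+ 3 * h ^+ 3 by ring.
  exact: lerD.

have -> : 2 * b * (2 * b + 2 - n%:R) * npow (b + 1) r * h ^+ 2 = \sum_i (t2 i - t1 i).
  have r0 : 0 < r := lt_le_trans ltr01 r1.
  have := npow_mul (b + 1) r0; rewrite (_ : b + 1 + 1 = b + 2); last by ring.
  move=> E; rewrite sumrB.
  have -> : \sum_i t1 i = n%:R * (2 * h ^+ 2 * b * npow (b + 1) r).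
    by rewrite sumr_const card_ord [RHS]mulr_natl.
  have -> : \sum_i t2 i = b * (b + 1) / 2 * npow (b + 2) r * (8 * h ^+ 2 * r).
    by rewrite /t2 -mulr_sumr -mulr_sumr.
  by rewrite -E; field.
rewrite -sumrB (le_trans (ler_norm_sum _ _ _)) //.
apply: (le_trans (ler_sum _ (fun i _ => T i))).
by rewrite sumr_const card_ord -[leLHS]mulr_natl [leLHS]mulrA.
Qed.

End discrete_laplacian.

(** * Potentials of far away sources *)

Section far_potentials.
Context {R : realType} {n : nat}.
Local Notation T := (n.-tuple (measurableTypeR R)).
Local Notation rt := (@row_of_tuple R n).
Local Notation mu := (@lebesgue_tuple R n).
Local Notation I W := (J mu (fun v => W (rt v))).
Local Notation itg W := (Itg mu (fun v => W (rt v))).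
Implicit Types x y z : 'rV[R]_n.

Variables (i0 : 'I_n) (s c : R).
Hypotheses (s0 : 0 < s) (s1 : s < 1) (c0 : 0 < c).

Definition kern y : R := c * riesz s y.

Lemma kern_ge0 y : 0 <= kern y.
Proof. by rewrite mulr_ge0 ?riesz_ge0 // ltW. Qed.

Lemma kernN y : kern (- y) = kern y.
Proof. by rewrite /kern rieszN. Qed.

Lemma measurable_kern : measurable_fun setT (fun v : T => kern (rt v)).
Proof. by apply: measurable_funM => //; exact: measurable_riesz. Qed.

Lemma itg_m2kern : itg (fun y => m2 y * kern y).
Proof.
have := ItgZ c (@Itg_m2riesz R n s s0 s1); congr Itg.
by apply/funext => v; rewrite /kern mulrCA.
Qed.

Local Notation kf := (kfar kern).
Let ik : itg kf. Proof. exact: itg_kfar kern_ge0 measurable_kern itg_m2kern. Qed.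
Let mkf : measurable_fun setT (fun v : T => kf (rt v)).
Proof. exact: measurable_kfar measurable_kern. Qed.

(** Minus the fractional Laplacian of w at x, when w vanishes on the unit ball
    around x. *)
Definition far_pot (w : 'rV[R]_n -> R) x : R :=
  I (fun y => (w (x + y) + w (x - y)) / 2 * kf y).

Lemma itg_far w x : bls w ->
  itg (fun y => w (x + y) * kf y) /\ itg (fun y => w (x - y) * kf y).
Proof.
move=> bw; have cw := bls_continuous bw; have [C C0 [bC _ _]] := bls_pos bw.
have mw b := meas_shift x b cw.
split; apply: Itg_le (ItgZ C ik).
- by apply: measurable_funM => //; exact: (mw false).
- by move=> v; rewrite normrM (ger0_norm (kfar_ge0 kern_ge0 _)) ler_wpM2r // kfar_ge0 // => ?; exact: kern_ge0.
- by apply: measurable_funM => //; exact: (mw true).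
- by move=> v; rewrite normrM (ger0_norm (kfar_ge0 kern_ge0 _)) ler_wpM2r // kfar_ge0 // => ?; exact: kern_ge0.
Qed.

Lemma itg_far_pot w x : bls w ->
  itg (fun y => (w (x + y) + w (x - y)) / 2 * kf y).
Proof.
move=> bw; have [i1 i2] := itg_far x bw.
have := ItgZ 2^-1 (ItgD i1 i2); congr Itg; apply/funext => v; ring.
Qed.

Lemma kfarN y : kf (- y) = kf y.
Proof. by rewrite /kfar normrN kernN. Qed.

Lemma far_potE w x : bls w -> far_pot w x = I (fun y => w (x + y) * kf y).
Proof.
move=> bw; have [i1 i2] := itg_far x bw.
have E : I (fun y => w (x - y) * kf y) = I (fun y => w (x + y) * kf y).
  have := J_opp (h := fun y => w (x + y) * kf y) (Itg_meas i1).
  move=> <-; congr J; apply/funext => v; by rewrite kfarN.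
transitivity (2^-1 * (I (fun y => w (x + y) * kf y) + I (fun y => w (x - y) * kf y))).
  by rewrite -(JD i1 i2) -(JZ _ (ItgD i1 i2)); congr J; apply/funext => v; ring.
by rewrite E; field.
Qed.

Lemma far_potD w1 w2 x : bls w1 -> bls w2 ->
  far_pot (fun z => w1 z + w2 z) x = far_pot w1 x + far_pot w2 x.
Proof.
move=> b1 b2; rewrite -(JD (itg_far_pot x b1) (itg_far_pot x b2)); congr J.
by apply/funext => v; ring.
Qed.

Lemma far_potZ a w x : bls w -> far_pot (fun z => a * w z) x = a * far_pot w x.
Proof.
move=> b1; rewrite -(JZ a (itg_far_pot x b1)); congr J.
by apply/funext => v; ring.
Qed.

Definition far_source (w : 'rV[R]_n -> R) := [/\ bls w,
  forall x, `|x| <= 5 -> w x = 0 & exists r, forall x, r <= `|x| -> w x = 0].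

(** The closure, in the uniform norm on |x| <= 3, of the potentials of sources
    that vanish on |x| <= 5. *)
Definition V (g : 'rV[R]_n -> R) := forall e, 0 < e ->
  exists2 w, far_source w & forall x, `|x| <= 3 -> `|far_pot w x - g x| <= e.

Lemma V_lim g : (forall e, 0 < e ->
  exists2 g', V g' & forall x, `|x| <= 3 -> `|g' x - g x| <= e) -> V g.
Proof.
move=> H e e0; have e2 : 0 < e / 2 by rewrite divr_gt0.
have [g' Vg' gg'] := H _ e2; have [w sw wg] := Vg' _ e2; exists w => // x x3.
rewrite -(subrKA (g' x)) (le_trans (ler_normD _ _)) // [leRHS]splitr.
by apply: lerD; [exact: wg|exact: gg'].
Qed.

Lemma V_eq g g' : (forall x, `|x| <= 3 -> g x = g' x) -> V g -> V g'.
Proof.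
move=> E Vg; apply: V_lim => e e0; exists g => // x x3.
by rewrite E // subrr normr0 ltW.
Qed.

Lemma V_add g h : V g -> V h -> V (fun x => g x + h x).
Proof.
move=> Vg Vh e e0; have e2 : 0 < e / 2 by rewrite divr_gt0.
have [w1 [b1 z1 [r1 r1P]] w1g] := Vg _ e2; have [w2 [b2 z2 [r2 r2P]] w2h] := Vh _ e2.
exists (fun x => w1 x + w2 x).
  split; first exact: blsD.
    by move=> x x5; rewrite z1 // z2 // addr0.
  exists (Num.max r1 r2) => x; rewrite ge_max => /andP[? ?].
  by rewrite r1P // r2P // addr0.
move=> x x3; rewrite far_potD // opprD addrACA (le_trans (ler_normD _ _)) //.
by rewrite [leRHS]splitr; apply: lerD; [exact: w1g|exact: w2h].
Qed.

Lemma V0 : V (fun=> 0).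
Proof.
move=> e e0; exists (fun=> 0).
  by split=> //; [exact: bls_cst|exists 0].
move=> x _; rewrite subr0 /far_pot.
under eq_fun do rewrite addr0 !mul0r.
by rewrite J0 normr0 ltW.
Qed.

Lemma V_scale a g : V g -> V (fun x => a * g x).
Proof.
move=> Vg e e0; have a1 : 0 < `|a| + 1 by rewrite ltr_wpDl.
have [w [b z [r rP]] wg] := Vg (e / (`|a| + 1)) (divr_gt0 e0 a1).
exists (fun x => a * w x).
  split; first exact: blsZ.
    by move=> x x5; rewrite z // mulr0.
  by exists r => x xr; rewrite rP // mulr0.
move=> x x3; rewrite far_potZ // -mulrBr normrM.
rewrite (le_trans (ler_wpM2l _ (wg x x3))) //.
by rewrite mulrCA ger_pMr // ler_pdivrMr // mul1r lerDl.
Qed.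

Lemma V_sum (I : Type) (r : seq I) (g : I -> 'rV[R]_n -> R) :
  (forall i, V (g i)) -> V (fun x => \sum_(i <- r) g i x).
Proof.
move=> Vg; elim: r => [|i r IHr].
  by apply: V_eq V0 => x _; rewrite big_nil.
by apply: V_eq (V_add (Vg i) IHr) => x _; rewrite big_cons.
Qed.

Definition half_kexp : R := @kexp R n s / 2.

Local Notation a2 := half_kexp.

Lemma half_kexp_gt0 : 0 < a2. Proof. by rewrite divr_gt0 // kexp_gt0. Qed.

Lemma sq_ge0 z : 0 <= sq z.
Proof. by apply: sumr_ge0 => i _; exact: sqr_ge0. Qed.

Lemma rieszE z : riesz s z = npow a2 (sq z).
Proof.
rewrite /riesz /npow powRN; congr (_^-1).
by rewrite /enorm -powR12_sqrt ?sq_ge0 // -powRrM mulrC.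
Qed.

Let Y y := 10 < y 0 i0.

Lemma Y_sq (y z : 'rV[R]_n) (r : R) : Y y -> `|z - y| <= r -> r <= 9 -> 1 <= sq z.
Proof.
move=> yY zy r9; rewrite /sq (bigD1 i0) //=.
have : 1 <= z 0 i0.
  have := le_trans (coord_le_norm (z - y) i0) zy.
  by rewrite !mxE ler_norml /Y in yY * => /andP[? ?]; lra.
move=> z1; have : 1 <= z 0 i0 ^+ 2 by rewrite expr_ge1 // (le_trans _ z1).
have : 0 <= \sum_(i | i != i0) z 0 i ^+ 2 by apply: sumr_ge0 => i _; exact: sqr_ge0.
by lra.
Qed.

Let bump (sg : R) x : R := cutoff 1 ((3 / sg) *: x).

Lemma riesz_close y z C : 1 <= sq z -> 1 <= sq (y + z) -> `|z| <= C -> `|y| <= 1 ->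
  `|riesz s (y + z) - riesz s z| <= a2 * (n%:R * (2 * C + 1)) * `|y|.
Proof.
move=> z1 yz1 zC y1; rewrite !rieszE.
apply: (le_trans (npow_lip (ltW half_kexp_gt0) z1 yz1)).
rewrite -[leRHS]mulrA ler_wpM2l ?(ltW half_kexp_gt0) // /sq -sumrB.
apply: (le_trans (ler_norm_sum _ _ _)).
have H i : `|(y + z) 0 i ^+ 2 - z 0 i ^+ 2| <= (2 * C + 1) * `|y|.
  have -> : (y + z) 0 i ^+ 2 - z 0 i ^+ 2 = (2 * z 0 i + y 0 i) * y 0 i.
    by rewrite !mxE; ring.
  rewrite normrM; apply: ler_pM => //; last exact: coord_le_norm.
  rewrite (le_trans (ler_normD _ _)) //; apply: lerD.
    rewrite normrM ger0_norm // ler_wpM2l //.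
    exact: le_trans (coord_le_norm _ _) zC.
  exact: le_trans (coord_le_norm _ _) y1.
apply: (le_trans (ler_sum _ (fun i _ => H i))).
by rewrite sumr_const card_ord -[leLHS]mulr_natl [leLHS]mulrA.
Qed.

(** A narrow cutoff around y0, divided by its mass, acts as a point mass at y0;
    its potential is an average of the kernel near y0 - x. *)
Lemma V_point y0 : Y y0 -> V (fun x => riesz s (y0 - x)).
Proof.
move=> Yy0 e e0; pose C := `|y0| + 3.
pose D := a2 * (n%:R * (2 * C + 1)).
have D0 : 0 <= D by rewrite mulr_ge0 ?(ltW half_kexp_gt0) // mulr_ge0 // addr_ge0 // mulr_ge0 // addr_ge0.
pose sg := Num.min 1 (e / (D + 1)).
have sg0 : 0 < sg by rewrite lt_min ltr01 divr_gt0 // ltr_wpDl.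
have sg1 : sg <= 1 by rewrite ge_min lexx.
have sge : D * sg <= e.
  apply: (@le_trans _ _ (D * (e / (D + 1)))).
    by rewrite ler_wpM2l // ge_min lexx orbT.
  rewrite mulrCA ger_pMr // ler_pdivrMr ?mul1r ?lerDl //.
  by rewrite ltr_wpDl.
have s30 : 0 < 3 / sg by rewrite divr_gt0.
have bb : bls (bump sg).
  apply: (bls_comp_linear (T := fun x => (3 / sg) *: x) (D := 3 / sg)).
  - by move=> x y; rewrite scalerDr.
  - by move=> x; rewrite scalerN.
  - by move=> x; rewrite normrZ gtr0_norm.
  - exact: bls_cutoff.
have b0 x : sg <= `|x| -> bump sg x = 0.
  move=> xs; apply: cutoff0; first by rewrite addr_gt0.
  rewrite normrZ gtr0_norm // -mulrA [_ * `|x|]mulrC mulrA ler_pdivlMr //.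
  by have := xs; lra.
have b01 x : 0 <= bump sg x by case/andP: (cutoff_01 1 ((3 / sg) *: x)).
have b11 x : bump sg x <= 1 by case/andP: (cutoff_01 1 ((3 / sg) *: x)).
have mb : measurable_fun setT (fun v : T => bump sg (rt v)).
  by apply: meas_row; exact: bls_continuous.
have ibox r : 0 <= r -> Itg mu (\1_(ball_box r) : T -> R) /\
    J mu (\1_(ball_box r) : T -> R) = (2 * r) ^+ n.
  move=> r0; have mB := @measurable_ball_box R n r.
  split.
    apply/integrableP; split; first exact/measurable_EFinP/measurable_indic.
    under eq_integral do rewrite /= ger0_norm //.
    by rewrite integral_indic // setIT [X in (X < _)%E](measure_ball_box r0) ltry.
  by rewrite /J /Rintegral integral_indic // setIT [X in fine X](measure_ball_box r0).
have ib : itg (bump sg).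
  apply: Itg_le (ibox _ (ltW sg0)).1 => // v.
  rewrite ger0_norm // indicE; have [vs|vs] := leP `|rt v| sg.
    by rewrite mem_set //; apply: ball_boxP => //; exact: ltW.
  by rewrite b0 // ltW.
pose N := I (bump sg).
have N0 : 0 < N.
  have r0 : 0 < sg / 3 by rewrite divr_gt0.
  have [i1 E] := ibox _ (ltW r0).
  apply: (@lt_le_trans _ _ ((2 * (sg / 3)) ^+ n)).
    by rewrite exprn_gt0 // mulr_gt0.
  rewrite -E; apply: J_le => // v; rewrite indicE.
  have [|_] := boolP (v \in _); last exact: b01.
  rewrite inE => vB; rewrite /bump cutoff1 // normrZ gtr0_norm //.
  have : `|rt v| <= sg / 3.
    apply: norm_le_coord => [|i]; first exact: ltW.
    by have := vB i; rewrite /= in_itv /= -ler_norml mxE.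
  move=> H; rewrite (le_trans (ler_wpM2l (ltW s30) H)) //.
  by rewrite mulrA divfK ?divff // gt_eqF.
have cN : 0 < c * N by rewrite mulr_gt0.
pose w z := (c * N)^-1 * bump sg (z - y0).
have bw : bls w by apply: blsZ; exact: (bls_translate (- y0) bb).
exists w.
  split=> // [x x5|].
    rewrite /w b0 ?mulr0 // (le_trans sg1) //.
    have := coord_le_norm (x - y0) i0; rewrite !mxE; apply: le_trans.
    have := le_trans (coord_le_norm x i0) x5.
    rewrite ler_norml ler_normr /Y in Yy0 * => /andP[? ?].
    by apply/orP; right; lra.
  exists (`|y0| + 1) => x xy; rewrite /w b0 ?mulr0 // (le_trans sg1) //.
  have := ler_distD 0 x y0; rewrite subr0 sub0r normrN.
  by have := lerB_dist x y0; lra.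
move=> x x3; rewrite far_potE //.
pose z := y0 - x.
have zC : `|z| <= C by rewrite (le_trans (ler_normB _ _)) // lerD2l.
have [i1 _] := itg_far x bw.
have <- := J_translate z (h := fun y => w (x + y) * kf y) (Itg_meas i1).
have zY : Y y0 by [].
have sqz y : `|y| <= sg -> 1 <= sq (y + z) /\ 1 <= `|y + z|.
  move=> ys; have H : `|y + z - y0| <= 4.
    have -> : y + z - y0 = y - x by rewrite /z; rewrite addrA addrAC addrK.
    by rewrite (le_trans (ler_normB _ _)) // (_ : 4 = 1 + 3) ?lerD // ?(le_trans ys) //; lra.
  split; first by apply: (Y_sq zY H); lra.
  have := le_trans (coord_le_norm _ i0) H; rewrite mxE [(- y0) 0 i0]mxE ler_norml.
  move=> /andP[H1 H2]; apply: le_trans (coord_le_norm (y + z) i0).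
  by rewrite ler_normr; apply/orP; left; rewrite /Y in zY; lra.
have sz : 1 <= sq z by have [] := sqz 0; rewrite ?normr0 ?(ltW sg0) // add0r.
have ic : itg (fun y => (c * N)^-1 * (c * riesz s z * bump sg y)).
  exact: ItgZ (ItgZ _ ib).
have i2 : itg (fun y => w (x + (y + z)) * kf (y + z)).
  exact: (Itg_translate z (h := fun y => w (x + y) * kf y) i1).
have Ez : riesz s z = I (fun y => (c * N)^-1 * (c * riesz s z * bump sg y)).
  rewrite (JZ _ (ItgZ _ ib)) (JZ _ ib) -/N; field.
  by rewrite !gt_eqF.
rewrite -/z [X in _ - X]Ez -(JB i2 ic).
have -> : e = I (fun y => N^-1 * (e * bump sg y)).
  by rewrite (JZ _ (ItgZ _ ib)) (JZ _ ib) -/N; field; rewrite gt_eqF.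
apply: J_norm_le; [exact: Itg_meas (ItgB i2 ic)| |exact: ItgZ (ItgZ _ ib)].
move=> v; rewrite /w; set y := rt v.
have -> : x + (y + z) - y0 = y by rewrite /z addrCA [x + _]addrC subrK addrK.
have [ys|ys] := leP `|y| sg; last first.
  by rewrite b0 ?(ltW ys) // !mulr0 mul0r subr0 normr0.
have [q1 q2] := sqz y ys.
rewrite /kfar q2 /kern.
have -> : (c * N)^-1 * bump sg y * (c * riesz s (y + z)) -
   (c * N)^-1 * (c * riesz s z * bump sg y) =
   N^-1 * ((riesz s (y + z) - riesz s z) * bump sg y).
  by field; rewrite !gt_eqF.
rewrite normrM gtr0_norm ?invr_gt0 // ler_pM2l ?invr_gt0 // normrM (ger0_norm (b01 _)).
apply: ler_wpM2r => //; apply: (le_trans (riesz_close sz q1 zC _)).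
  exact: le_trans ys sg1.
by apply: le_trans sge; apply: ler_wpM2l.
Qed.

End far_potentials.

(** * Density of the far potentials *)

Lemma continuous_mul {R : realType} {V : topologicalType} (z w : V -> R) :
  continuous z -> continuous w -> continuous (fun x => z x * w x).
Proof. by move=> cz cw x; exact: (cvgM (cz x) (cw x)). Qed.

Lemma continuous_opp {R : realType} {V : topologicalType} (z : V -> R) :
  continuous z -> continuous (fun x => - z x).
Proof. by move=> cz x; exact: (cvgN (cz x)). Qed.

Lemma continuous_expRcomp {R : realType} {V : topologicalType} (z : V -> R) :
  continuous z -> continuous (fun x => expR (z x)).
Proof.
move=> cz x; apply: (@continuous_comp _ _ _ z expR); first exact: cz.
exact: continuous_expR.
Qed.

Section exterior_density.
Context {R : realType} {n : nat}.
Implicit Types x y z : 'rV[R]_n.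

Variables (i0 : 'I_n) (s c : R).
Hypotheses (s0 : 0 < s) (s1 : s < 1) (c0 : 0 < c).

Local Notation V := (@V R n s c).
Local Notation a2 := (@half_kexp R n s).

Let Y y := 10 < y 0 i0.

Lemma norm_delta i : `|delta_mx 0 i : 'rV[R]_n| <= 1.
Proof.
apply: norm_le_coord => // j; rewrite mxE eqxx /=.
by case: eqP => _; rewrite ?normr1 ?normr0.
Qed.

(** Second differences in the position y of the source stay in V, and they
    converge to the Laplacian, which raises the exponent. *)
Lemma V_laplacian (b : R) : 0 < b -> 0 < 2 * b + 2 - n%:R ->
  (forall y, Y y -> V (fun x => npow b (sq (y - x)))) ->
  forall y, Y y -> V (fun x => npow (b + 1) (sq (y - x))).
Proof.
move=> b0 bn Vb y Yy; apply: V_lim => e e0.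
pose kap := 2 * b * (2 * b + 2 - n%:R).
have kap0 : 0 < kap by rewrite !mulr_gt0.
pose C := `|y| + 3.
pose M := n%:R * (2 * (b * (b + 1) * (b + 2)) * (1 + 2 * C) ^+ 3 + b * (b + 1)).
have M0 : 0 <= M.
  have b0' := ltW b0; have C0 : 0 <= C by rewrite addr_ge0.
  apply: mulr_ge0 => //; apply: addr_ge0; last by rewrite mulr_ge0 // addr_ge0.
  apply: mulr_ge0; last by rewrite exprn_ge0 // addr_ge0 // mulr_ge0.
  by rewrite mulr_ge0 // mulr_ge0 ?addr_ge0 // mulr_ge0 // addr_ge0.
pose h := Num.min 1 (Num.min ((y 0 i0 - 10) / 2) (kap * e / (M + 1))).
have M1 : 0 < M + 1 by rewrite ltr_wpDl.
have y10 : 0 < y 0 i0 - 10 by rewrite subr_gt0.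
have h0 : 0 < h by rewrite !lt_min ltr01 divr_gt0 //= divr_gt0 // mulr_gt0.
have h1 : h <= 1 by rewrite ge_min lexx.
have hy : h <= (y 0 i0 - 10) / 2 by rewrite !ge_min lexx orbT.
have hM : h <= kap * e / (M + 1) by rewrite !ge_min lexx !orbT.
have Yh i (t : R) : `|t| = h -> Y (y + t *: delta_mx 0 i).
  move=> th; rewrite /Y !mxE eqxx /=; have : - h <= t * (i0 == i)%:R.
    case: (i0 == i); rewrite ?mulr1 ?mulr0; last by rewrite oppr_le0 ltW.
    by rewrite lerNl -th -normrN ler_norm.
  by move: hy y10; lra.
exists (fun x => (kap * h ^+ 2)^-1 * \sum_i (npow b (sq (y + h *: delta_mx 0 i - x)) +
    npow b (sq (y - h *: delta_mx 0 i - x)) + - 2 * npow b (sq (y - x)))).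
  apply: (V_scale s0 s1 c0); apply: (V_sum s0 s1 c0) => i.
  apply: (V_add s0 s1 c0); last by apply: (V_scale s0 s1 c0); exact: Vb.
  apply: (V_add s0 s1 c0); apply: Vb; first by apply: Yh; rewrite gtr0_norm.
  by rewrite -scaleNr; apply: Yh; rewrite normrN gtr0_norm.
move=> x x3; set z := y - x.
have zC i : `|z 0 i| <= C.
  rewrite (le_trans (coord_le_norm _ _)) // (le_trans (ler_normB _ _)) //.
  by rewrite lerD2l.
have z1 i (t : R) : `|t| <= 1 -> 1 <= sq (z + t *: delta_mx 0 i).
  move=> t1; apply: (@Y_sq R n i0 y _ 4 Yy); last by lra.
  have -> : z + t *: delta_mx 0 i - y = t *: delta_mx 0 i - x.
    by apply/rowP => j; rewrite /z !mxE; ring.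
  rewrite (le_trans (ler_normB _ _)) // (_ : 4 = 1 + 3); last by ring.
  apply: lerD => //; rewrite normrZ.
  by rewrite -[leRHS]mulr1; apply: ler_pM => //; exact: norm_delta.
have := laplacian_npow i0 (ltW b0) h0 h1 zC z1.
have -> : \sum_i (npow b (sq (z + h *: delta_mx 0 i)) + npow b (sq (z - h *: delta_mx 0 i))
    - 2 * npow b (sq z)) = \sum_i (npow b (sq (y + h *: delta_mx 0 i - x)) +
    npow b (sq (y - h *: delta_mx 0 i - x)) + - 2 * npow b (sq (y - x))).
  by apply: eq_bigr => i _; rewrite /z (addrAC y (- x)) (addrAC y (- x) (- _)) mulNr.
rewrite -/M -/kap; set S := \sum_i _ => SM.
have kh : 0 < kap * h ^+ 2 by rewrite mulr_gt0 // exprn_gt0.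
have -> : (kap * h ^+ 2)^-1 * S - npow (b + 1) (sq z) =
    (kap * h ^+ 2)^-1 * (S - kap * npow (b + 1) (sq z) * h ^+ 2).
  by field; rewrite !gt_eqF.
rewrite normrM gtr0_norm ?invr_gt0 // mulrC ler_pdivrMr // (le_trans SM) //.
have -> : M * h ^+ 3 = M * h * h ^+ 2 by ring.
have -> : e * (kap * h ^+ 2) = kap * e * h ^+ 2 by ring.
apply: ler_wpM2r; first by rewrite exprn_ge0 // ltW.
apply: (@le_trans _ _ (M * (kap * e / (M + 1)))); first by rewrite ler_wpM2l.
by rewrite mulrCA ger_pMr ?mulr_gt0 // ler_pdivrMr // mul1r lerDl.
Qed.

Lemma V_riesz_power j y : Y y -> V (fun x => npow (a2 + j%:R) (sq (y - x))).
Proof.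
elim: j y => [|j IHj] y Yy.
  apply: V_eq (V_point s0 s1 c0 Yy) => x _.
  by rewrite addr0 rieszE.
have j0 : 0 <= j%:R :> R by [].
rewrite -natr1 addrA; apply: V_laplacian => //.
  by rewrite ltr_wpDr // half_kexp_gt0.
by rewrite /half_kexp /kexp; have := s0; lra.
Qed.

Lemma V_riesz_poly (p : {poly R}) y : Y y ->
  V (fun x => npow a2 (sq (y - x)) * p.[(sq (y - x))^-1]).
Proof.
move=> Yy.
have Vs := V_sum s0 s1 c0 (index_enum 'I_(size p))
  (fun i => V_scale s0 s1 c0 p`_i (V_riesz_power i Yy)).
apply: V_eq Vs => x x3; rewrite horner_coef mulr_sumr; apply: eq_bigr => i _.
have q1 : 1 <= sq (y - x).
  apply: (@Y_sq R n i0 y _ 3 Yy); last by lra.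
  by rewrite addrAC subrr add0r normrN.
have q0 := lt_le_trans ltr01 q1.
rewrite mulrCA; congr (_ * _); rewrite /npow opprD powRD; last by rewrite (gt_eqF q0) implybT.
by rewrite (powRN _ i%:R) powR_mulrn ?(ltW q0) // exprVn.
Qed.

(** |y - x|^(-n-2s) p(1/|y - x|^2) is dense among radial functions around y;
    the Gaussian is the one that factors. *)
Lemma V_gauss y : Y y -> V (fun x => expR (- (sq (y - x) / 2))).
Proof.
move=> Yy; apply: V_lim => e e0.
pose C := \sum_(i < n) (`|y| + 3) ^+ 2.
pose A (g : R -> R) := continuous g /\ exists p : {poly R}, forall q, 1 <= q -> g q = p.[q^-1].
pose mx q := Num.max 1 q : R.
have cmx : continuous mx.
  by move=> q; apply: (@continuous_max _ _ (fun=> 1) id); [exact: cst_continuous|exact: cvg_id].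
have mx1 q : 1 <= mx q by rewrite le_max lexx.
have mx0 q : 0 < mx q := lt_le_trans ltr01 (mx1 q).
have cpow b : continuous (fun q => npow b (mx q)).
  move=> q; apply: (@continuous_comp _ _ _ mx (npow b)); first exact: cmx.
  have [+ _] := is_derive_npow b (mx0 q).
  by move=> /derivable1_diffP/differentiable_continuous.
pose f q := expR (- (q / 2)) * npow (- a2) (mx q).
have cf : continuous f.
  move=> q; apply: cvgM; last exact: cpow.
  apply: (@continuous_comp _ _ _ (fun q : R => - (q / 2)) expR); last exact: continuous_expR.
  by apply: cvgN; apply: cvgM; [exact: cvg_id|exact: cvg_cst].
have [] := @stone_weierstrass R R `[1, C]%classic A _ _ _ _ _ _ f e cf e0.
- exact: segment_compact.
- by move=> g [].
- move=> a; split; first exact: cst_continuous.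
  by exists a%:P => q _; rewrite hornerC.
- move=> g h [cg [p gp]] [ch [r hr]]; split; first by move=> q; exact: (cvgD (cg q) (ch q)).
  by exists (p + r) => q q1; rewrite hornerD gp // hr.
- move=> g h [cg [p gp]] [ch [r hr]]; split; first by move=> q; exact: (cvgM (cg q) (ch q)).
  by exists (p * r) => q q1; rewrite hornerM gp // hr.
- move=> q r; rewrite /= !in_itv /= => /andP[q1 _] /andP[r1 _] qr.
  exists (fun q => npow 1 (mx q)).
    split; first exact: cpow.
    exists 'X => t t1; rewrite hornerX /npow /mx max_r // powRN powRr1 //.
    by rewrite (le_trans ler01).
  rewrite /npow /mx !max_r // !powRN !powRr1 ?(le_trans ler01) //.
  by move=> /invr_inj.
move=> g [cg [p gp]] fg.
exists (fun x => npow a2 (sq (y - x)) * p.[(sq (y - x))^-1]); first exact: V_riesz_poly.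
move=> x x3; set q := sq (y - x).
have q1 : 1 <= q.
  apply: (@Y_sq R n i0 y _ 3 Yy); last by lra.
  by rewrite addrAC subrr add0r normrN.
have q0 := lt_le_trans ltr01 q1.
have qC : q <= C.
  apply: ler_sum => i _; rewrite -[leLHS]real_normK ?num_real //.
  rewrite lerXn2r ?nnegrE ?addr_ge0 //.
  rewrite (le_trans (coord_le_norm _ _)) // (le_trans (ler_normB _ _)) //.
  by rewrite lerD2l.
have := fg q; rewrite /= in_itv /= q1 qC => /(_ isT).
rewrite gp // /f /mx max_r // => H.
have -> : expR (- (q / 2)) = npow a2 q * (expR (- (q / 2)) * npow (- a2) q).
  rewrite mulrCA /npow -powRD; last by rewrite (gt_eqF q0) implybT.
  by rewrite opprK addNr powRr0 mulr1.
rewrite -mulrBr normrM (ger0_norm (npow_ge0 _ _)) distrC.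
rewrite -[leRHS]mul1r; apply: ler_pM => //; first exact: npow_ge0.
by apply: npow_le1 => //; exact/ltW/half_kexp_gt0.
Qed.

Definition dot x y : R := \sum_i x 0 i * y 0 i.

(** |y - x|^2 = |y|^2 - 2 x.y + |x|^2. *)
Lemma V_exp y : Y y -> V (fun x => expR (- (sq x / 2)) * expR (dot x y)).
Proof.
move=> Yy; apply: V_eq (V_scale s0 s1 c0 (expR (sq y / 2)) (V_gauss Yy)) => x _.
rewrite -!expRD; congr expR.
have -> : sq (y - x) = sq y + sq x - 2 * dot x y.
  rewrite /sq /dot mulr_sumr -big_split -sumrB /=; apply: eq_bigr => i _.
  by rewrite !mxE; ring.
by field.
Qed.

Let S := fix S m (u : 'rV[R]_n -> R) : Prop :=
  if m is m'.+1 then exists a y v, [/\ Y y, S m' v & u = fun x => a * expR (dot x y) + v x]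
  else u = fun=> 0.

Let S_V m u : S m u -> V (fun x => expR (- (sq x / 2)) * u x).
Proof.
elim: m u => [|m IHm] u /=.
  by move=> ->; apply: V_eq (@V0 R n s c) => x _; rewrite mulr0.
move=> [a [y [v [Yy Sv ->]]]].
apply: V_eq (V_add s0 s1 c0 (V_scale s0 s1 c0 a (V_exp Yy)) (IHm _ Sv)) => x _.
by ring.
Qed.

Let S_add m1 m2 u v : S m1 u -> S m2 v -> S (m1 + m2) (fun x => u x + v x).
Proof.
elim: m1 u => [|m IHm] u /=.
  by move=> -> Sv; under eq_fun do rewrite add0r.
move=> [a [y [w [Yy Sw ->]]]] Sv; exists a, y, (fun x => w x + v x).
by split => //; [exact: IHm|apply/funext => x; rewrite addrA].
Qed.

Let S_mul m u (a : R) (h : 'rV[R]_n) : 0 <= h 0 i0 -> S m u ->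
  S m (fun x => a * expR (dot x h) * u x).
Proof.
move=> h0; elim: m u => [|m IHm] u /=.
  by move=> ->; apply/funext => x; rewrite mulr0.
move=> [b [y [v [Yy Sv ->]]]].
exists (a * b), (y + h), (fun x => a * expR (dot x h) * v x); split.
- by rewrite /Y mxE (lt_le_trans Yy) // lerDl.
- exact: IHm.
apply/funext => x; have -> : dot x (y + h) = dot x y + dot x h.
  by rewrite /dot -big_split; apply: eq_bigr => i _; rewrite !mxE mulrDr.
rewrite expRD; ring.
Qed.

Lemma sq_continuous : continuous (@sq R n).
Proof.
apply: (continuous_big (op := +%R)) => [|i _ z]; first exact: add_continuous.
apply: (@continuous_comp _ _ _ (fun y : 'rV[R]_n => y 0 i) (fun t => t ^+ 2)).
  exact: coord_continuous.
exact: exprn_continuous.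
Qed.

Lemma dot_continuous y : continuous (dot ^~ y).
Proof.
apply: (continuous_big (op := +%R)) => [|i _ z]; first exact: add_continuous.
exact: (cvgM (@coord_continuous _ _ _ 0 i z) (cvg_cst (y 0 i))).
Qed.

Lemma compact_norm_le (r : R) : compact [set x : 'rV[R]_n | `|x| <= r].
Proof.
have [r0|r0] := ltP r 0.
  rewrite (_ : [set _ | _] = set0); first exact: compact0.
  by apply/seteqP; split => // x /= xr; have := le_trans (normr_ge0 x) xr; rewrite leNgt r0.
rewrite (_ : [set _ | _] = [set v : 'rV[R]_n | forall i, `[- r, r]%classic (v ord0 i)]).
  by apply: (@rV_compact R n (fun=> `[- r, r]%classic)) => i; exact: segment_compact.
apply/seteqP; split=> x /= H.
  by move=> i; rewrite in_itv /= -ler_norml (le_trans (coord_le_norm _ _)).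
by apply: norm_le_coord => // i; have := H i; rewrite in_itv /= -ler_norml.
Qed.

(** Every continuous function is, uniformly on |x| <= 3, a limit of potentials
    of far away sources. The span of e^{x.y}, y in the half space Y, is stable
    under multiplication by e^{x.h}, h_{i0} >= 0; the multipliers of that span
    form an algebra to which the Stone-Weierstrass theorem applies. *)
Lemma far_potential_density (g : 'rV[R]_n -> R) : continuous g -> V g.
Proof.
move=> cg; apply: V_lim => e e0.
pose y0 : 'rV[R]_n := const_mx 11.
have Yy0 : Y y0 by rewrite /Y mxE; lra.
pose A (u : 'rV[R]_n -> R) := continuous u /\
  forall m v, S m v -> exists m', S m' (fun x => u x * v x).
pose f x := g x * expR (sq x / 2) * expR (- dot x y0).
have cf : continuous f.
  apply: continuous_mul.
    apply: continuous_mul => //; apply: continuous_expRcomp.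
    by apply: continuous_mul; [exact: sq_continuous|exact: cst_continuous].
  by apply: continuous_expRcomp; apply: continuous_opp; exact: dot_continuous.
pose B : R := expR (\sum_(i < n) 33).
have B0 : 0 < B by exact: expR_gt0.
have eB : 0 < e / B by rewrite divr_gt0.
have dl x (i : 'I_n) : dot x (delta_mx 0 i) = x 0 i.
  rewrite /dot (bigD1 i) //= mxE !eqxx mulr1 big1 ?addr0 // => j ji.
  by rewrite mxE (negbTE ji) andbF mulr0.
have [] := @stone_weierstrass R _ [set x : 'rV[R]_n | `|x| <= 3] A _ _ _ _ _ _ f _ cf eB.
- exact: compact_norm_le.
- by move=> u [].
- move=> a; split; first exact: cst_continuous.
  move=> m v Sv; exists m; have h0 : 0 <= (0 : 'rV[R]_n) 0 i0 by rewrite mxE.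
  have := S_mul a h0 Sv; congr (S m _); apply/funext => x.
  by rewrite /dot big1 ?expR0 ?mulr1 // => i _; rewrite mxE mulr0.
- move=> u w [cu Su] [cw Sw]; split; first by move=> x; exact: (cvgD (cu x) (cw x)).
  move=> m v Sv; have [m1 S1] := Su _ _ Sv; have [m2 S2] := Sw _ _ Sv.
  exists (m1 + m2)%N; have := S_add S1 S2; congr (S _ _); apply/funext => x.
  by rewrite mulrDl.
- move=> u w [cu Su] [cw Sw]; split; first by move=> x; exact: (cvgM (cu x) (cw x)).
  move=> m v Sv; have [m2 S2] := Sw _ _ Sv; have [m1 S1] := Su _ _ S2.
  by exists m1; move: S1; congr (S _ _); apply/funext => x; rewrite mulrA.
- move=> x y _ _ xy; have [i /eqP xyi] : exists i : 'I_n, x 0 i != y 0 i.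
    apply/existsP; rewrite -negb_forall; apply/negP => /forallP H; apply: xy.
    by apply/rowP => i; exact/eqP/H.
  exists (fun x => 1 * expR (dot x (delta_mx 0 i))).
    split.
      apply: continuous_mul; first exact: cst_continuous.
      apply: continuous_expRcomp; exact: dot_continuous.
    by move=> m v Sv; exists m; apply: S_mul => //; rewrite mxE; case: (_ && _).
  by rewrite !mul1r !dl => /expR_inj.
move=> u [cu Su] fu.
have S1 : S 1 (fun x => expR (dot x y0)).
  exists 1, y0, (fun=> 0); split => //.
  by apply/funext => x; rewrite addr0 mul1r.
have [m Sm] := Su _ _ S1.
exists (fun x => expR (- (sq x / 2)) * (u x * expR (dot x y0))); first exact: S_V Sm.
move=> x x3.
have -> : g x = expR (- (sq x / 2)) * (f x * expR (dot x y0)).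
  rewrite /f -mulrA -expRD addNr expR0 mulr1 mulrC -mulrA -expRD subrr expR0 mulr1 //.
rewrite -mulrBr -mulrBl !normrM !(gtr0_norm (expR_gt0 _)) distrC.
have b1 : expR (- (sq x / 2)) <= 1.
  by rewrite -expR0 ler_expR oppr_le0 divr_ge0 // sq_ge0.
have b2 : expR (dot x y0) <= B.
  rewrite ler_expR; apply: ler_sum => i _; rewrite mxE.
  have := le_trans (coord_le_norm x i) x3; rewrite ler_norml => /andP[_ ?].
  by lra.
rewrite -[leRHS]mul1r; apply: ler_pM => //; rewrite ?mulr_ge0 ?expR_ge0 //.
have -> : e = e / B * B by rewrite divfK // gt_eqF.
by apply: ler_pM => //; exact: fu.
Qed.

End exterior_density.

(** * Elliptic approximation *)

Section elliptic_approximation.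
Context {R : realType} {n : nat}.
Local Notation T := (n.-tuple (measurableTypeR R)).
Local Notation rt := (@row_of_tuple R n).
Local Notation mu := (@lebesgue_tuple R n).
Local Notation I W := (J mu (fun v => W (rt v))).
Local Notation itg W := (Itg mu (fun v => W (rt v))).
Implicit Types x y : 'rV[R]_n.

Variables (i0 : 'I_n) (s c : R).
Hypotheses (s0 : 0 < s) (s1 : s < 1) (c0 : 0 < c).

Local Notation k := (@kern R n s c).
Local Notation far_pot := (@far_pot R n s c).

Let k0 : forall y, 0 <= k y. Proof. by move=> y; exact: kern_ge0. Qed.
Let mk : measurable_fun setT (fun v : T => k (rt v)).
Proof. exact: measurable_kern. Qed.
Let Ik : itg (fun y => m2 y * k y). Proof. exact: itg_m2kern. Qed.
Let ik : itg (kfar k). Proof. exact: itg_kfar k0 mk Ik. Qed.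
Let mkf : measurable_fun setT (fun v : T => kfar k (rt v)).
Proof. exact: measurable_kfar mk. Qed.

(** The fractional Laplacian in symmetrized, absolutely convergent form. *)
Definition frac (u : 'rV[R]_n -> R) x : R :=
  I (fun y => (u x - (u (x + y) + u (x - y)) / 2) * k y).

Lemma bls_m2 u : bls u -> exists2 C, 0 <= C &
  forall x y, `|u x - (u (x + y) + u (x - y)) / 2| <= C * m2 y.
Proof.
move=> /bls_pos[C C0 [bu _ su]]; exists (2 * C) => [|x y]; first by rewrite mulr_ge0.
have := su x y; have := bu x; have := bu (x + y); have := bu (x - y).
rewrite /m2 /Order.min; case: ifP => _; rewrite !ler_norml ?mulr1.
  by move=> /andP[? ?] /andP[? ?] /andP[? ?] _; apply/andP; split; lra.
have : 0 <= C * `|y| ^+ 2 by rewrite mulr_ge0 ?exprn_ge0.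
by move=> ? _ _ _ /andP[? ?]; apply/andP; split; lra.
Qed.

Lemma itg_frac u x : bls u ->
  itg (fun y => (u x - (u (x + y) + u (x - y)) / 2) * k y).
Proof.
move=> bu; have [C C0 uC] := bls_m2 bu; have cu := bls_continuous bu.
apply: Itg_le (ItgZ C Ik).
  apply: measurable_funM => //; apply: measurable_funB => //.
  apply: measurable_funM => //; apply: measurable_funD.
    exact: (meas_shift x false cu).
  exact: (meas_shift x true cu).
by move=> v; rewrite normrM (ger0_norm (k0 _)) mulrA ler_wpM2r.
Qed.

Lemma fracD u v x : bls u -> bls v ->
  frac (fun x => u x + v x) x = frac u x + frac v x.
Proof.
move=> bu bv; rewrite -(JD (itg_frac x bu) (itg_frac x bv)); congr J.
by apply/funext => w; field.
Qed.

Lemma fracZ a u x : bls u -> frac (fun x => a * u x) x = a * frac u x.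
Proof.
move=> bu; rewrite -(JZ a (itg_frac x bu)); congr J.
by apply/funext => w; field.
Qed.

Lemma bls_far_pot w : bls w -> bls (far_pot w).
Proof.
move=> bw; have [C C0 [b l sd]] := bls_pos bw; exists (C * I (kfar k)).
have kf0 (v : T) : 0 <= kfar k (rt v) by exact: kfar_ge0.
have av (p q B : R) : `|p| <= B -> `|q| <= B -> `|(p + q) / 2| <= B.
  by rewrite !ler_norml => /andP[? ?] /andP[? ?]; apply/andP; split; lra.
have ip x := itg_far_pot s0 s1 c0 x bw.
split=> [x|x h|x h].
- rewrite -(JZ C ik); apply: J_norm_le (ItgZ C ik); first exact: Itg_meas (ip x).
  by move=> v; rewrite normrM (ger0_norm (kf0 _)) ler_wpM2r // av.
- rewrite mulrAC -(JZ _ ik) -(JB (ip _) (ip _)).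
  apply: J_norm_le (ItgZ _ ik); first exact: Itg_meas (ItgB (ip _) (ip _)).
  move=> v; rewrite -mulrBl normrM (ger0_norm (kf0 _)) ler_wpM2r //.
  have := av _ _ _ (l (x + rt v) h) (l (x - rt v) h).
  by rewrite (addrAC x (rt v)) (addrAC x (- rt v)); congr (`|_| <= _); field.
rewrite mulrAC -(JZ _ ik) -(JZ 2 (ip x)) -(JD (ip _) (ip _)).
rewrite -(JB (ItgD (ip _) (ip _)) (ItgZ 2 (ip x))).
apply: J_norm_le (ItgZ _ ik).
  exact: Itg_meas (ItgB (ItgD (ip _) (ip _)) (ItgZ 2 (ip x))).
move=> v; rewrite mulrA -!mulrDl -mulrBl normrM (ger0_norm (kf0 _)) ler_wpM2r //.
have := av _ _ _ (sd (x + rt v) h) (sd (x - rt v) h).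
rewrite (addrAC x (rt v) h) (addrAC x (- rt v) h).
rewrite (addrAC x (rt v) (- h)) (addrAC x (- rt v) (- h)).
by congr (`|_| <= _); field.
Qed.

Section fixed_cutoff.
Variable chi : 'rV[R]_n -> R.
Hypotheses (chi1 : bnd 1 chi) (bchi : bls chi).
Local Notation Lchi := (Lchi k chi).

Lemma Lchi_itg u x : bls u -> itg (fun y => (u x - Q chi u x y) * k y).
Proof.
move=> bu; have cu := bls_continuous bu; have [C [b _ sd]] := bu.
have H := itg_Lchi k0 mk Ik chi1 bchi x cu b sd. exact: H.
Qed.

Lemma LchiD u v x : bls u -> bls v ->
  Lchi (fun x => u x + v x) x = Lchi u x + Lchi v x.
Proof.
move=> bu bv; rewrite -(JD (Lchi_itg x bu) (Lchi_itg x bv)); congr J.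
by apply/funext => w; rewrite Q_add; ring.
Qed.

Lemma LchiB u v x : bls u -> bls v ->
  Lchi (fun x => u x - v x) x = Lchi u x - Lchi v x.
Proof.
move=> bu bv; rewrite -(JB (Lchi_itg x bu) (Lchi_itg x bv)); congr J.
by apply/funext => w; rewrite Q_sub; ring.
Qed.

Lemma Lchi_bounded u : bls u -> exists G, bnd G (Lchi u).
Proof.
move=> bu; have [C C0 [b _ sd]] := bls_pos bu.
exists ((C + 2 * C) * I (fun y => m2 y * k y)) => x; rewrite -(JZ _ Ik).
apply: J_norm_le (ItgZ _ Ik); first exact: Itg_meas (Lchi_itg x bu).
by move=> v; rewrite normrM (ger0_norm (k0 _)) mulrA ler_wpM2r // (Q_m2 chi1).
Qed.

Lemma bls_solution lam f : 0 < lam -> bls f -> exists2 z, bls z &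
  (forall x, lam * z x + Lchi z x = f x) /\
  (forall H, bnd H f -> bnd (H / lam) z).
Proof.
move=> lam0 bf; have [C C0 [bC lC sC]] := bls_pos bf.
have [Cx Cx0 [_ lx sx]] := bls_pos bchi.
have [z [_ bz] zf] := resolvent_solution k0 mk Ik chi1 bchi Cx0 lx sx lam0 bC lC sC C0.
exists z => //; split => // H bH x; rewrite ler_pdivlMr // mulrC.
by apply: (maximum_principle k0 mk Ik chi1 bchi lam0 bz) => y; rewrite zf.
Qed.

(** lam (lam + L^chi)^-1 tends to the identity as lam grows: so the functions
    that L^chi maps to the C^{1,1} class are dense. *)
Lemma domain_density F e : bls F -> 0 < e -> exists2 F', bls F' &
  bls (Lchi F') /\ forall x, `|F' x - F x| <= e.
Proof.
move=> bF e0; have [G GF] := Lchi_bounded bF; have G0 := bnd_ge0 GF.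
pose lam := G / e + 1.
have lam0 : 0 < lam by rewrite ltr_wpDl // divr_ge0 // ltW.
have [z bz [zF _]] := bls_solution lam0 (blsZ lam bF).
exists z => //; split.
  have E : Lchi z = fun x => lam * F x - lam * z x by apply/funext => x; rewrite -zF; ring.
  by rewrite E; apply: blsB; exact: blsZ.
move=> x.
have := maximum_principle k0 mk Ik chi1 bchi lam0 (blsB bz bF) (G := G).
move=> /(_ _ x) H; rewrite -(ler_pM2l lam0); apply: le_trans (H _) _.
  move=> y; rewrite LchiB //.
  have -> : lam * (z y - F y) + (Lchi z y - Lchi F y) = - Lchi F y.
    by have := zF y; lra.
  by rewrite normrN.
by rewrite /lam mulrDl divfK ?mul1r ?lerDl ?ltW // gt_eqF.
Qed.

End fixed_cutoff.

Let chi : 'rV[R]_n -> R := cutoff 3.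
Let zeta : 'rV[R]_n -> R := fun x => cutoff 4 (2 *: x).

Let chi1 : bnd 1 chi.
Proof. by move=> x; have /andP[? ?] := cutoff_01 3 x; rewrite ger0_norm. Qed.

Let bzeta : bls zeta.
Proof.
apply: (bls_comp_linear (T := fun x : 'rV[R]_n => 2 *: x) (D := 2)).
- by move=> x y; rewrite scalerDr.
- by move=> x; rewrite scalerN.
- by move=> x; rewrite normrZ ger0_norm.
- exact: bls_cutoff.
Qed.

(** The elliptic step: u + L u is prescribed exactly near the ball, while u is
    only required to be close to F there. *)
Theorem elliptic_approximation h F e : bls h -> bls F -> 0 < e ->
  exists u, [/\ bls u, exists r, forall x, r <= `|x| -> u x = 0,
    forall x, `|x| <= 2 -> `|u x - F x| <= e &
    forall x, `|x| <= 2 -> u x + frac u x = h x].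
Proof.
move=> bh bF e0; have e2 : 0 < e / 2 by rewrite divr_gt0.
have bchi : bls chi by exact: bls_cutoff.
have [F' bF' [bL FF']] := domain_density chi1 bchi bF e2.
pose r0 x := h x - (F' x + Lchi k chi F' x).
have br0 : bls r0 by apply: blsB => //; exact: blsD.
(* the potential of w cancels the residual r0 near the ball, up to e / 2 *)
have [w [bw w5 [rw wr]] wr0] :=
  far_potential_density i0 s0 s1 c0 (bls_continuous (blsN br0)) e2.
(* what remains is small and is solved for exactly, by a small function z *)
pose h' x := zeta x * (r0 x + far_pot w x).
have bh' : bls h' by apply: blsM => //; apply: blsD => //; exact: bls_far_pot.
have h'e : bnd (e / 2) h'.
  move=> x; rewrite /h'; have [x3|x3] := leP `|x| 3.
    have /andP[z0 z1] := cutoff_01 4 (2 *: x).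
    rewrite normrM (ger0_norm z0) -[leRHS]mul1r; apply: ler_pM => //.
    by have := wr0 x x3; rewrite opprK addrC.
  rewrite /zeta cutoff0 ?mul0r ?normr0 ?(ltW e2) ?addr_gt0 //.
  by rewrite normrZ ger0_norm //; lra.
have [z bz [zh zb]] := bls_solution chi1 bchi ltr01 bh'.
have {}zb : bnd (e / 2) z by have := zb _ h'e; rewrite divr1.
pose g x := F' x + z x.
have bg : bls g by exact: blsD.
exists (fun x => chi x * g x + w x); split.
- by apply: blsD => //; exact: blsM.
- exists (Num.max 5 rw) => x; rewrite ge_max => /andP[x5 xr].
  rewrite wr // /chi cutoff0 ?mul0r ?addr0 ?addr_gt0 //.
  by apply: le_trans x5; lra.
- move=> x x2; rewrite /chi cutoff1; last by lra.
  rewrite w5; last by lra.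
  rewrite mul1r addr0 /g; have := FF' x; have := zb x; rewrite !ler_norml.
  by move=> /andP[? ?] /andP[? ?]; apply/andP; split; lra.
move=> x x2.
(* short jumps stay where chi = 1 and w = 0; long jumps see chi g and w *)
have E : frac (fun x => chi x * g x + w x) x = Lchi k chi g x - far_pot w x.
  rewrite -(JB (Lchi_itg chi1 bchi x bg) (itg_far_pot s0 s1 c0 x bw)); congr J.
  apply/funext => v; set y := rt v.
  have x1 : chi x = 1 by apply: cutoff1; lra.
  have wx : w x = 0 by apply: w5; lra.
  rewrite x1 wx /kfar /Q; have [y1|y1] := ltP `|y| 1; last by field.
  have near1 u : `|u| < 1 -> chi (x + u) = 1 /\ w (x + u) = 0.
    move=> u1; have : `|x + u| <= 3 by rewrite (le_trans (ler_normD _ _)) //; lra.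
    move=> xu; have -> : chi (x + u) = 1 by exact: cutoff1.
    by rewrite w5 //; lra.
  have y1' : `|- y| < 1 by rewrite normrN.
  have [p1 p2] := near1 y y1; have [q1 q2] := near1 _ y1'.
  by rewrite p1 p2 q1 q2; field.
have := zh x; rewrite mul1r => zx.
rewrite E /chi cutoff1; last by lra.
rewrite w5; last by lra.
rewrite (LchiD chi1 bchi x bF' bz) -/chi /g.
have : h' x = r0 x + far_pot w x.
  by rewrite /h' /zeta cutoff1 ?mul1r // normrZ ger0_norm //; lra.
by rewrite -zx /r0; lra.
Qed.

End elliptic_approximation.

(** * Polynomials in time *)

HB.instance Definition _ (T1 T2 : ptopologicalType) := Pointed.on (T1 * T2)%type.

Section separated_functions.
Context {R : realType} {n : nat}.
Local Notation P := ('rV[R]_n * R)%type.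

(** The Horner form makes the product by t and by a function of x immediate;
    products of two such polynomials are never computed. *)
Fixpoint tpoly (m : nat) (G : P -> R) : Prop :=
  if m is m'.+1 then
    exists g G', [/\ bls g, tpoly m' G' & G = fun p => g p.1 + p.2 * G' p]
  else G = fun=> 0.

Lemma tpoly_bls m g G : bls g -> tpoly m G -> tpoly m (fun p => g p.1 * G p).
Proof.
move=> bg; elim: m G => [|m IHm] G /=.
  by move=> ->; apply/funext => p; rewrite mulr0.
move=> [h [G' [bh tG' ->]]]; exists (fun x => g x * h x), (fun p => g p.1 * G' p).
by split; [exact: blsM|exact: IHm|apply/funext => p; ring].
Qed.

Lemma tpoly_time m G : tpoly m G -> tpoly m.+1 (fun p => p.2 * G p).
Proof.
move=> tG; exists (fun=> 0), G; split => //; first exact: bls_cst.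
by apply/funext => p; rewrite add0r.
Qed.

Lemma tpoly_add m1 m2 G H : tpoly m1 G -> tpoly m2 H ->
  exists m, tpoly m (fun p => G p + H p).
Proof.
elim: m1 m2 G H => [|m1 IHm] [|m2] G H /=.
- by move=> -> ->; exists 0%N => /=; apply/funext => p; rewrite addr0.
- move=> -> [h [H' [bh tH ->]]]; exists m2.+1, h, H'; split => //.
  by apply/funext => p; rewrite add0r.
- move=> [g [G' [bg tG ->]]] ->; exists m1.+1, g, G'; split => //.
  by apply/funext => p; rewrite addr0.
move=> [g [G' [bg tG ->]]] [h [H' [bh tH ->]]]; have [m tm] := IHm _ _ _ tG tH.
exists m.+1, (fun x => g x + h x), (fun p => G' p + H' p); split => //.
  exact: blsD.
by apply/funext => p; ring.
Qed.

Lemma tpoly_coef m G : tpoly m G -> exists2 gs : seq ('rV[R]_n -> R),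
  (forall j, bls (nth (fun=> 0) gs j)) &
  forall p, G p = \sum_(j < size gs) p.2 ^+ j * nth (fun=> 0) gs j p.1.
Proof.
elim: m G => [|m IHm] G /=.
  move=> ->; exists [::] => [j|p]; last by rewrite big_ord0.
  by rewrite nth_nil; exact: bls_cst.
move=> [g [G' [bg /IHm[gs bgs G'E] ->]]]; exists (g :: gs) => [[|j] //=|p].
rewrite /= big_ord_recl expr0 mul1r G'E mulr_sumr; congr (_ + _).
by apply: eq_bigr => j _; rewrite exprS mulrA.
Qed.

Lemma step_lower (t : R) : 0 <= t -> t <= 1 -> step t = t ^+ 2 / 2.
Proof.
move=> t0 t1; rewrite /step (max_r t0) !max_l ?expr0n /=; last 2 first.
- by lra.
- by lra.
by ring.
Qed.

(** The multipliers of tpoly form an algebra that contains t and the C^{1,1}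
    functions of x, so it separates points; the polynomial is the multiplier
    applied to 1. *)
Lemma tpoly_dense (F : P -> R) (e : R) : continuous F -> 0 < e ->
  exists2 gs : seq ('rV[R]_n -> R), (forall j, bls (nth (fun=> 0) gs j)) &
  forall x t, `|x| <= 2 -> `|t| <= 2 ->
    `|F (x, t) - \sum_(j < size gs) t ^+ j * nth (fun=> 0) gs j x| <= e.
Proof.
move=> cF e0.
pose A (G : P -> R) := continuous G /\
  forall m H, tpoly m H -> exists m', tpoly m' (fun p => G p * H p).
pose K : set P := [set x : 'rV[R]_n | `|x| <= 2] `*` `[-2, 2]%classic.
have cK : compact K.
  by apply: compact_setX; [exact: compact_norm_le|exact: segment_compact].
have Abls g : bls g -> A (fun p => g p.1).
  move=> bg; split.
    move=> p; apply: (@continuous_comp _ _ _ fst g); first exact: cvg_fst.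
    exact: bls_continuous.
  by move=> m H tH; exists m; exact: tpoly_bls.
have [] := @stone_weierstrass R _ K A cK _ _ _ _ _ F e cF e0.
- by move=> G [].
- by move=> a; apply: (Abls (fun=> a)); exact: bls_cst.
- move=> G H [cG tG] [cH tH]; split; first by move=> p; exact: (cvgD (cG p) (cH p)).
  move=> m W tW; have [m1 t1] := tG _ _ tW; have [m2 t2] := tH _ _ tW.
  have [m3 t3] := tpoly_add t1 t2; exists m3; move: t3; congr (tpoly _ _).
  by apply/funext => p; ring.
- move=> G H [cG tG] [cH tH]; split; first by move=> p; exact: (cvgM (cG p) (cH p)).
  move=> m W tW; have [m2 t2] := tH _ _ tW; have [m1 t1] := tG _ _ t2.
  exists m1; move: t1; congr (tpoly _ _).
  by apply/funext => p; ring.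
- move=> [x t] [y u] [/= x2 t2] [/= y2 u2] xy.
  have [tu|tu] := eqVneq t u; last first.
    exists snd; last exact/eqP.
    by split; [move=> p; exact: cvg_snd|move=> m H tH; exists m.+1; exact: tpoly_time].
  have [i xyi] : exists i : 'I_n, x 0 i != y 0 i.
    apply/existsP; rewrite -negb_forall; apply/negP => /forallP H; apply: xy.
    by rewrite tu; congr pair; apply/rowP => i; exact/eqP/H.
  exists (fun p : 'rV[R]_n * R => step ((p.1 0 i + 2) / 4)).
    apply: (Abls (fun x : 'rV[R]_n => step ((x 0 i + 2) / 4))).
    apply: (bls_coord (f := fun a : R => step ((a + 2) / 4))).
    suff b4 : bls (fun a : R => step (a / 4)).
      exact: (bls_translate (2 : R) b4).
    apply: (bls_comp_linear (T := fun a : R => a / 4) (D := 1)) (@bls_step R).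
    - by move=> a b; rewrite mulrDl.
    - by move=> a; rewrite mulNr.
    - by move=> a; rewrite normrM (ger0_norm (_ : 0 <= 4^-1)) //; have := normr_ge0 a; lra.
  move=> /=; have := le_trans (coord_le_norm x i) x2.
  have := le_trans (coord_le_norm y i) y2; rewrite !ler_norml.
  move=> /andP[? ?] /andP[? ?]; rewrite !step_lower; try lra.
  move=> H; move/eqP: xyi; apply.
  have : ((x 0 i + 2) / 4) ^+ 2 = ((y 0 i + 2) / 4) ^+ 2 by lra.
  by move=> /eqP; rewrite eqf_sqr => /orP[/eqP|/eqP]; lra.
move=> G [cG tG] FG.
have t1 : tpoly 1 (fun=> 1).
  exists (fun=> 1), (fun=> 0); split => //; first exact: bls_cst.
  by apply/funext => p; rewrite mulr0 addr0.
have [m tm] := tG _ _ t1; have [gs bgs GE] := tpoly_coef tm.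
exists gs => // x t x2 t2; have := FG (x, t); rewrite -[G _]mulr1 GE; apply.
by split => //=; rewrite in_itv /= -ler_norml.
Qed.

End separated_functions.

(** * Caloric approximation *)

Section caloric_approximation.
Context {R : realType} {n : nat}.
Local Notation P := ('rV[R]_n * R)%type.
Implicit Types x y : 'rV[R]_n.
Implicit Types gs ps : seq ('rV[R]_n -> R).

Variables (i0 : 'I_n) (s c : R).
Hypotheses (s0 : 0 < s) (s1 : s < 1) (c0 : 0 < c).

Local Notation frac := (@frac R n s c).
Local Notation z0 := ((fun=> 0) : 'rV[R]_n -> R).

Lemma frac0 x : frac (fun=> 0) x = 0.
Proof.
rewrite /frac [X in J _ X](_ : _ = fun=> 0) ?J0 //.
by apply/funext => v; rewrite addr0 mul0r subrr mul0r.
Qed.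

Lemma frac_sum (I : Type) (r : seq I) (a : I -> R) (u : I -> 'rV[R]_n -> R) x :
  (forall i, bls (u i)) ->
  frac (fun x => \sum_(i <- r) a i * u i x) x = \sum_(i <- r) a i * frac (u i) x.
Proof.
move=> bu; elim: r => [|i r IHr].
  by under eq_fun do rewrite big_nil; rewrite big_nil frac0.
under [in LHS]eq_fun do rewrite big_cons; rewrite big_cons.
rewrite (fracD s0 s1 c0 x (blsZ (a i) (bu i)) (bls_sum _ (fun i => blsZ (a i) (bu i)))).
by rewrite (fracZ s0 s1 c0) // IHr.
Qed.

Definition compact_bls (u : 'rV[R]_n -> R) :=
  bls u /\ exists r, forall x, r <= `|x| -> u x = 0.

(** Solving the elliptic problem successively for psi_m, ..., psi_0 makes
    sum_j t^j / j! psi_j a solution of u_t + u + L u = 0. *)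
Lemma elliptic_chain gs e : 0 < e -> (forall j, bls (nth z0 gs j)) ->
  exists ps, [/\ size ps = size gs, forall j, compact_bls (nth z0 ps j),
    forall j x, (j < size gs)%N -> `|x| <= 2 -> `|nth z0 ps j x - nth z0 gs j x| <= e &
    forall j x, `|x| <= 2 -> nth z0 ps j x + frac (nth z0 ps j) x = - nth z0 ps j.+1 x].
Proof.
move=> e0; elim: gs => [|g gs IHgs] bgs.
  exists [::]; split => // j.
    by rewrite nth_nil; split; [exact: bls_cst|exists 0].
  by move=> x _; rewrite !nth_nil frac0 addr0 oppr0.
have [|ps [sz cps cl ch]] := IHgs; first by move=> j; exact: (bgs j.+1).
have [u [bu cu ug ue]] := elliptic_approximation i0 s0 s1 c0
  (blsN (cps 0%N).1) (bgs 0%N) e0.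
exists (u :: ps); split => /=.
- by rewrite sz.
- by case=> [|j] /=; [split|exact: cps].
- by case=> [|j] x //= js x2; [exact: ug|exact: cl].
- by case=> [|j] x x2 /=; [exact: ue|exact: ch].
Qed.

Definition texp ps t x : R := \sum_(j < size ps) t ^+ j / j`!%:R * nth z0 ps j x.

Lemma is_derive_texp ps x (t : R) :
  is_derive t (1 : R) (fun t => texp ps t x) (texp (behead ps) t x).
Proof.
have d (j : 'I_(size ps)) : is_derive t (1 : R) (fun t : R => t ^+ j / j`!%:R * nth z0 ps j x)
    (if (j : nat) is i.+1 then t ^+ i / i`!%:R * nth z0 ps j x else 0).
  case: j => -[|i] ij /=.
    have -> : (fun t : R => t ^+ 0 / 0`!%:R * nth z0 ps 0 x) = cst (nth z0 ps 0 x).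
      by apply/funext => v; rewrite expr0 fact0 divr1 mul1r.
    exact: is_derive_cst.
  have f0 : i`!%:R != 0 :> R by rewrite pnatr_eq0 -lt0n fact_gt0.
  have -> : (fun t : R => t ^+ i.+1 / i.+1`!%:R * nth z0 ps i.+1 x) =
      (nth z0 ps i.+1 x / i.+1`!%:R) \*: (fun t : R => t) ^+ i.+1.
    by apply/funext => v; rewrite /= exprfctE /GRing.scale /=; ring.
  apply: is_derive_eq; rewrite /GRing.scale /= factS natrM.
  have i1 : i.+1%:R != 0 :> R by rewrite pnatr_eq0.
  by move: i1; rewrite -natr1 => i1; field; rewrite f0 i1.
have := is_derive_sum d.
rewrite (_ : \sum_(i < size ps) _ = fun t => texp ps t x); last first.
  by apply/funext => u; rewrite fct_sumE.
move=> /is_derive_eq; apply; rewrite /texp size_behead.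
case: ps d => [|p ps] d /=; first by rewrite !big_ord0.
by rewrite big_ord_recl /= add0r; apply: eq_bigr => j _ /=.
Qed.

Definition plateau (t : R) : R := step (5 - t) * step (5 + t).

Lemma plateau1 t : `|t| <= 3 -> plateau t = 1.
Proof.
by rewrite ler_norml => /andP[? ?]; rewrite /plateau !step_ge2 ?mulr1 //; lra.
Qed.

Lemma plateau0 t : 5 <= `|t| -> plateau t = 0.
Proof.
rewrite ler_normr => /orP[] t5; rewrite /plateau.
  by rewrite (step_le0 (t := 5 - t)) ?mul0r //; lra.
by rewrite (step_le0 (t := 5 + t)) ?mulr0 //; lra.
Qed.

Lemma plateau_01 t : 0 <= plateau t <= 1.
Proof.
have /andP[? ?] := step_01 (5 - t); have /andP[? ?] := step_01 (5 + t).
by rewrite mulr_ge0 //= mulr_ile1.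
Qed.

Lemma plateau_continuous : continuous plateau.
Proof.
have cs := bls_continuous (@bls_step R).
have c1 : continuous (step \o (fun t : R => 5 - t)).
  move=> t; apply: continuous_comp; last exact: cs.
  by apply: cvgB; [exact: cvg_cst|exact: cvg_id].
have c2 : continuous (step \o (fun t : R => 5 + t)).
  move=> t; apply: continuous_comp; last exact: cs.
  by apply: cvgD; [exact: cvg_cst|exact: cvg_id].
exact: continuous_mul c1 c2.
Qed.

Lemma texp_continuous ps : (forall j, bls (nth z0 ps j)) ->
  continuous (fun p : P => texp ps p.2 p.1).
Proof.
move=> bps; apply: (continuous_big (op := +%R)) => [|j _]; first exact: add_continuous.
have c1 : continuous (nth z0 ps j \o (fst : P -> _)).
  move=> p; apply: continuous_comp; first exact: cvg_fst.
  exact: bls_continuous (bps j) _.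
have c2 : continuous ((fun t : R => t ^+ j) \o (snd : P -> _)).
  by move=> p; apply: continuous_comp; [exact: cvg_snd|exact: exprn_continuous].
exact: continuous_mul (continuous_mul c2 (fun p => cvg_cst _)) c1.
Qed.

(** The approximant is e^t sum_j t^j / j! psi_j, cut off for |t| > 3. The factor
    e^t turns the equation of the sum into u_t + L u = 0, and it has to be
    removed from F first. *)
Theorem caloric_approximation (F : P -> R) (e : R) : continuous F -> 0 < e ->
  exists u D : P -> R, exists C r : R, [/\ continuous u /\ continuous D,
    forall x t, r <= `|x| \/ r <= `|t| -> u (x, t) = 0,
    forall x t y, `|u (x, t) - (u (x + y, t) + u (x - y, t)) / 2| <= C * m2 y,
    forall x t, `|t| < 3 -> is_derive t (1 : R) (fun t => u (x, t)) (D (x, t)) &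
    forall x t, `|x| <= 2 -> `|t| <= 2 ->
      D (x, t) + frac (fun x => u (x, t)) x = 0 /\ `|u (x, t) - F (x, t)| <= e].
Proof.
move=> cF e0; have e2 : 0 < e / 2 by rewrite divr_gt0.
have cG : continuous (fun p : P => expR (- p.2) * F p).
  apply: continuous_mul => //; apply: continuous_expRcomp; apply: continuous_opp.
  by move=> p; exact: cvg_snd.
have e3 : 0 < e / 2 / expR 2 by rewrite divr_gt0 // expR_gt0.
have [gs0 bgs0 FG] := tpoly_dense cG e3.
pose gs := mkseq (fun j => fun x => j`!%:R * nth z0 gs0 j x) (size gs0).
have sz0 : size gs = size gs0 by rewrite size_mkseq.
have bgs j : bls (nth z0 gs j).
  have [js|js] := ltnP j (size gs0); last by rewrite nth_default ?sz0 //; exact: bls_cst.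
  by rewrite nth_mkseq //; exact: blsZ.
pose Bd : R := \sum_(j < size gs0) 2 ^+ j.
have Bd0 : 0 <= Bd by apply: sumr_ge0 => j _; exact: exprn_ge0.
pose e4 := e / 2 / expR 2 / (Bd + 1).
have e40 : 0 < e4 by rewrite divr_gt0 // ltr_wpDl.
have [ps [sz cps cl ch]] := elliptic_chain e40 bgs.
have bps j : bls (nth z0 ps j) by case: (cps j).
have bps' j : bls (nth z0 (behead ps) j) by rewrite nth_behead; exact: bps.
pose a (j : nat) (t : R) := plateau t * expR t * (t ^+ j / j`!%:R).
pose u (p : P) := plateau p.2 * expR p.2 * texp ps p.2 p.1.
pose D (p : P) := expR p.2 * (texp ps p.2 p.1 + texp (behead ps) p.2 p.1).
have uE x t : u (x, t) = \sum_(j < size ps) a j t * nth z0 ps j x.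
  by rewrite /u /texp mulr_sumr; apply: eq_bigr => j _; rewrite mulrA.
have fact1 j : (j`!%:R : R)^-1 <= 1.
  by rewrite invf_le1 ?ltr0n ?fact_gt0 // ler1n fact_gt0.
have a_le j t : `|a j t| <= expR 5 * 5 ^+ j.
  have [t5|t5] := leP 5 `|t|.
    by rewrite /a plateau0 // !mul0r normr0 mulr_ge0 ?expR_ge0 ?exprn_ge0.
  have /andP[p0 p1] := plateau_01 t.
  rewrite /a; move: (plateau t) p0 p1 => q p0 p1.
  rewrite !normrM (ger0_norm p0) (gtr0_norm (expR_gt0 _)); apply: ler_pM => //.
  - by rewrite mulr_ge0 // expR_ge0.
  - rewrite -[leRHS]mul1r; apply: ler_pM => //; rewrite ?expR_ge0 //.
    by rewrite ler_expR (le_trans (ler_norm _)) // ltW.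
  rewrite -[leRHS]mulr1; apply: ler_pM => //.
    by rewrite normrX lerXn2r ?nnegrE // ltW.
  by rewrite ger0_norm ?invr_ge0.
have /choice[Cf CfP] : forall j, exists C, 0 <= C /\ forall x y,
    `|nth z0 ps j x - (nth z0 ps j (x + y) + nth z0 ps j (x - y)) / 2| <= C * m2 y.
  by move=> j; have [C C0 H] := bls_m2 (bps j); exists C.
have /choice[rf rfP] : forall j, exists r, forall x, r <= `|x| -> nth z0 ps j x = 0.
  by move=> j; case: (cps j).
exists u, D, (\sum_(j < size ps) expR 5 * 5 ^+ j * Cf j),
  (Num.max 5 (\sum_(j < size ps) `|rf j|)); split.
- split.
    apply: continuous_mul; last exact: texp_continuous.
    apply: continuous_mul.
      have c1 : continuous (plateau \o (snd : P -> _)); last exact: c1.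
      by move=> p; apply: continuous_comp; [exact: cvg_snd|exact: plateau_continuous].
    by apply: continuous_expRcomp => p; exact: cvg_snd.
  apply: continuous_mul; first by apply: continuous_expRcomp => p; exact: cvg_snd.
  by move=> p; apply: cvgD; [exact: texp_continuous|exact: texp_continuous].
- move=> x t [|]; rewrite ge_max => /andP[r5 rr].
    rewrite uE big1 // => j _; rewrite rfP ?mulr0 // (le_trans _ rr) //.
    by rewrite (bigD1 j) //= (le_trans (ler_norm _)) // lerDl sumr_ge0.
  by rewrite /u /= plateau0 // !mul0r.
- move=> x t y; rewrite !uE -big_split mulr_suml -sumrB mulr_suml /=.
  rewrite (le_trans (ler_norm_sum _ _ _)) //; apply: ler_sum => j _.
  have -> : a j t * nth z0 ps j x -
     (a j t * nth z0 ps j (x + y) + a j t * nth z0 ps j (x - y)) / 2 =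
     a j t * (nth z0 ps j x - (nth z0 ps j (x + y) + nth z0 ps j (x - y)) / 2) by ring.
  rewrite normrM -mulrA; apply: ler_pM => //; exact: (CfP j).2.
- move=> x t t3.
  apply: (@near_eq_is_derive _ _ _ (fun t => expR t * texp ps t x)).
    near=> v; rewrite /u /= plateau1 ?mul1r //; near: v.
    exists (3 - `|t|); first by rewrite /= subr_gt0.
    move=> v /= tv; rewrite -(subrK t v) (le_trans (ler_normD _ _)) //.
    by rewrite distrC; lra.
  have d1 := is_derive_texp ps x t.
  by apply: is_derive_eq; rewrite /D /GRing.scale /= ; ring.
move=> x t x2 t2; have pt : plateau t = 1 by rewrite plateau1 //; lra.
split.
  have -> : frac (fun x => u (x, t)) x =
      \sum_(j < size ps) a j t * frac (nth z0 ps j) x.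
    rewrite -(@frac_sum _ _ (fun j : 'I_(size ps) => a j t) (fun j => nth z0 ps j)) //.
    by congr (frac _ x); apply/funext => w; exact: uE.
  rewrite /D /= /texp size_behead.
  have -> : \sum_(j < (size ps).-1) t ^+ j / j`!%:R * nth z0 (behead ps) j x =
      \sum_(j < size ps) t ^+ j / j`!%:R * nth z0 ps j.+1 x.
    clear -ps; case: ps => [|p ps]; first by rewrite !big_ord0.
    by rewrite /= big_ord_recr /= [nth _ _ (size ps)]nth_default // mulr0 addr0.
  rewrite -big_split mulr_sumr -big_split /= big1 // => j _.
  by have := ch j x x2; rewrite /a pt mul1r => H; rewrite -[nth z0 ps j.+1 x]opprK -H; ring.
have Fe : F (x, t) = expR t * (expR (- t) * F (x, t)).
  by rewrite mulrA -expRD subrr expR0 mul1r.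
rewrite /u /= pt mul1r Fe -mulrBr normrM (gtr0_norm (expR_gt0 _)).
have et : expR t <= expR 2 by rewrite ler_expR (le_trans (ler_norm _)).
have -> : e = expR 2 * (e / 2 / expR 2 + e / 2 / expR 2).
  by field; rewrite gt_eqF // expR_gt0.
apply: ler_pM => //.
have := FG x t x2 t2; rewrite /=; set S := \sum_(j < size gs0) _ => H.
rewrite -(subrKA S) (le_trans (ler_normD _ _)) //; apply: lerD; last by rewrite distrC.
rewrite /texp sz sz0 /S -sumrB (le_trans (ler_norm_sum _ _ _)) //.
apply: (@le_trans _ _ (\sum_(j < size gs0) 2 ^+ j * e4)).
  apply: ler_sum => j _.
  have -> : t ^+ j / j`!%:R * nth z0 ps j x - t ^+ j * nth z0 gs0 j x =
      t ^+ j / j`!%:R * (nth z0 ps j x - nth z0 gs j x).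
    rewrite nth_mkseq //; field.
    by rewrite pnatr_eq0 -lt0n fact_gt0.
  rewrite normrM; apply: ler_pM => //; last by apply: cl => //; rewrite sz0.
  rewrite -[leRHS]mulr1 normrM; apply: ler_pM => //.
    by rewrite normrX lerXn2r ?nnegrE.
  by rewrite ger0_norm ?invr_ge0.
rewrite -mulr_suml -/Bd /e4 mulrCA ger_pMr // ler_pdivrMr ?mul1r ?lerDl //.
by rewrite ltr_wpDl.
Unshelve. all: by end_near. Qed.

End caloric_approximation.
(** * A smooth bump function *)

Lemma is_derive_small {R : realType} {V : normedModType R} (f : V -> R) (x v : V) (d : R) :
  (forall e : R, 0 < e -> exists2 eta : R, 0 < eta &
     forall h : R, `|h| <= eta -> `|f (h *: v + x) - f x - h * d| <= e * `|h|) ->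
  is_derive x v f d.
Proof.
move=> H.
have cv : h^-1 *: (f (h *: v + x) - f x) @[h --> 0^'] --> d.
  apply/cvgrPdist_le => e /H[eta eta0 He]; near=> h.
  have h0 : h != 0 by near: h; exact: nbhs_dnbhs_neq.
  have he : `|h| <= eta.
    near: h; apply: dnbhs0_le; exact: eta0.
  have -> : d - h^-1 *: (f (h *: v + x) - f x) = - (h^-1 * (f (h *: v + x) - f x - h * d)).
    by rewrite /GRing.scale /=; field.
  rewrite normrN normrM normfV ler_pdivrMl ?normr_gt0 // [leRHS]mulrC.
  exact: He.
have dv : derivable f x v by apply/cvg_ex; exists d.
by apply: DeriveDef => //; exact: (cvg_lim _ cv).
Unshelve. all: by end_near. Qed.

Lemma is_derive_quadratic {R : realType} {V : normedModType R} (f : V -> R) (x v : V) (d C : R) :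
  (forall h : R, `|f (h *: v + x) - f x - h * d| <= C * h ^+ 2) -> is_derive x v f d.
Proof.
move=> H; have C0 : 0 <= C.
  by have := H 1; rewrite expr1n mulr1; apply: le_trans.
apply: is_derive_small => e e0; exists (e / (C + 1)); first by rewrite divr_gt0 // ltr_wpDl.
move=> h; rewrite ler_pdivlMr ?ltr_wpDl // => he.
rewrite (le_trans (H h)) // -real_normK ?num_real // expr2 mulrA ler_wpM2r //.
by rewrite (le_trans _ he) // mulrC ler_wpM2l // lerDl.
Qed.

Section bump.
Context {R : realType}.
Implicit Types (p : {poly R}) (t : R) (N m : nat).

(** All the derivatives of exp (-1 / (1 - t^2)) belong to this family. *)
Definition bump_term N p t : R :=
  if `|t| < 1 then p.[t] * (1 - t ^+ 2)^-1 ^+ N * expR (- (1 - t ^+ 2)^-1) else 0.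

Lemma one_sub_sqr_gt0 t : `|t| < 1 -> 0 < 1 - t ^+ 2.
Proof. by rewrite subr_gt0 -real_normK ?num_real // expr_lt1. Qed.

Lemma horner_bound p : exists2 C : R, 0 <= C & forall t, `|t| <= 1 -> `|p.[t]| <= C.
Proof.
exists (\sum_(i < size p) `|p`_i|) => [|t t1]; first exact: sumr_ge0.
rewrite horner_coef (le_trans (ler_norm_sum _ _ _)) //; apply: ler_sum => i _.
by rewrite normrM ler_piMr // normrX exprn_ile1.
Qed.

(* e^x >= x^(N+2) / (N+2)! at x = 1 / (1 - t^2) *)
Lemma bump_term_le N p : exists2 C : R, 0 <= C &
  forall t, `|t| < 1 -> `|bump_term N p t| <= C * (1 - t ^+ 2) ^+ 2.
Proof.
have [C C0 pC] := horner_bound p; exists (C * N.+2`!%:R); first by rewrite mulr_ge0.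
move=> t t1; rewrite /bump_term t1; have := one_sub_sqr_gt0 t1.
move: (1 - t ^+ 2) => w w0; have wi0 : 0 < w^-1 by rewrite invr_gt0.
rewrite !normrM -!mulrA; apply: ler_pM => //; first by apply: pC; exact: ltW.
have := expR_ge1Dxn N.+1 (ltW wi0); set F : R := N.+2`!%:R => H.
have F0 : 0 < F by rewrite /F ltr0n fact_gt0.
rewrite expRN !ger0_norm ?exprn_ge0 ?invr_ge0 ?expR_ge0 //; last exact: ltW.
rewrite ler_pdivrMr ?expR_gt0 //.
apply: (@le_trans _ _ (F * w ^+ 2 * (w^-1 ^+ N.+2 / F))); last first.
  rewrite ler_wpM2l //; first by rewrite mulr_ge0 ?exprn_ge0 // ltW.
  by rewrite (le_trans _ H) // lerDr.
rewrite -[N.+2]addn2 exprD (_ : F * _ * _ = w^-1 ^+ N * ((w * w^-1) ^+ 2 * (F / F))).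
  by rewrite !divff ?gt_eqF // expr1n !mulr1.
by rewrite exprMn; ring.
Qed.

Lemma bump_term_bounded N p : exists2 C : R, 0 <= C & forall t, `|bump_term N p t| <= C.
Proof.
have [C C0 H] := bump_term_le N p; exists C => // t.
have [t1|t1] := ltP `|t| 1; last by rewrite /bump_term ltNge t1 /= normr0.
rewrite (le_trans (H t t1)) // ler_piMr // exprn_ile1 ?(ltW (one_sub_sqr_gt0 t1)) //.
by rewrite gerBl sqr_ge0.
Qed.

Definition bump_deriv N p : {poly R} :=
  p^`() * (1 - 'X^2) ^+ 2 + (2 * N%:R)%:P * 'X * (1 - 'X^2) * p - 2%:P * 'X * p.

(** At |t| = 1 the derivative vanishes, since bump_term is then at most a
    multiple of (1 - t^2)^2, quadratically small. *)
Lemma is_derive_bump_term N p t :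
  is_derive t (1 : R) (bump_term N p) (bump_term N.+2 (bump_deriv N p) t).
Proof.
have [t1|t1] := ltP `|t| 1.
  apply: (@near_eq_is_derive _ _ _
    (fun t => p.[t] * (1 - t ^+ 2)^-1 ^+ N * expR (- (1 - t ^+ 2)^-1))).
    near=> v; rewrite /bump_term ifT //; near: v.
    exists (1 - `|t|); first by rewrite /= subr_gt0.
    move=> v /= tv; rewrite -(subrK t v) (le_lt_trans (ler_normD _ _)) //.
    by rewrite distrC; lra.
  have w0 := one_sub_sqr_gt0 t1; have wn : 1 - t ^+ 2 != 0 by rewrite gt_eqF.
  have dw : is_derive t (1 : R) (fun t : R => 1 - t ^+ 2) (- (2 * t)).
    have -> : (fun t : R => 1 - t ^+ 2) = cst 1 - (fun t : R => t) ^+ 2.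
      by apply/funext => v; rewrite /= exprfctE.
    by apply: is_derive_eq; rewrite /GRing.scale /=; ring.
  have di : is_derive t (1 : R) (fun t : R => (1 - t ^+ 2)^-1)
      (2 * t * (1 - t ^+ 2)^-1 ^+ 2).
    have := is_deriveV (f := fun t : R => 1 - t ^+ 2) wn dw.
    move=> /is_derive_eq; apply; rewrite /GRing.scale /=; rewrite exprVn; ring.
  have de : is_derive t (1 : R) (fun t : R => expR (- (1 - t ^+ 2)^-1))
      (- (2 * t * (1 - t ^+ 2)^-1 ^+ 2) * expR (- (1 - t ^+ 2)^-1)).
    have dn := is_deriveN di.
    have := @is_derive1_comp _ expR (fun t : R => - (1 - t ^+ 2)^-1) t _ _ _ dn.
    by move=> H; apply: is_derive_eq; rewrite mulrC.
  have dn : is_derive t (1 : R) (fun t : R => (1 - t ^+ 2)^-1 ^+ N)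
      (N%:R * (2 * t) * (1 - t ^+ 2)^-1 ^+ N.+1).
    case: N => [|N].
      by have -> : (fun t : R => (1 - t ^+ 2)^-1 ^+ 0) = cst 1 by []; rewrite !mul0r; exact: is_derive_cst.
    have -> : (fun t : R => (1 - t ^+ 2)^-1 ^+ N.+1) = (fun t : R => (1 - t ^+ 2)^-1) ^+ N.+1.
      by apply/funext => v; rewrite exprfctE.
    apply: is_derive_eq; rewrite /GRing.scale /= !exprS; ring.
  have dp := is_derive_poly p t.
  have := is_deriveM (is_deriveM dp dn) de.
  move=> /is_derive_eq; apply.
  have hd : (bump_deriv N p).[t] = p^`().[t] * (1 - t ^+ 2) ^+ 2 +
      2 * N%:R * t * (1 - t ^+ 2) * p.[t] - 2 * t * p.[t].
    by rewrite /bump_deriv !(hornerE, horner_exp).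
  rewrite /bump_term t1 hd /GRing.scale /= mulrfctE /= -[N.+2]addn2 -[N.+1]addn1 !exprD.
  move: ((1 - t ^+ 2)^-1 ^+ N) (expR _) => iN E.
  by field.
have -> : bump_term N.+2 (bump_deriv N p) t = 0 by rewrite /bump_term ltNge t1.
have [C C0 H] := bump_term_le N p.
apply: (@is_derive_quadratic _ _ _ _ _ _ (C * 4)) => h.
rewrite [bump_term N p t]/bump_term ltNge t1 /= mulr0 !subr0 /GRing.scale /= mulr1.
have [h1|h1] := ltP `|h + t| 1; last first.
  by rewrite /bump_term ltNge h1 /= normr0 mulr_ge0 ?sqr_ge0 // mulr_ge0.
rewrite (le_trans (H _ h1)) // -mulrA ler_wpM2l //.
have -> : 4 * h ^+ 2 = (2 * `|h|) ^+ 2 by rewrite exprMn real_normK ?num_real //; ring.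
rewrite lerXn2r ?nnegrE //; first exact/ltW/one_sub_sqr_gt0.
have := ler_normB (h + t) h; rewrite (_ : h + t - h = t) => [tt|]; last by ring.
rewrite -real_normK ?num_real // (_ : 1 - _ = (1 - `|h + t|) * (1 + `|h + t|)); last by ring.
rewrite mulrC; apply: ler_pM; rewrite ?subr_ge0; try lra.
Unshelve. all: by end_near. Qed.

Fixpoint bump_poly m : {poly R} :=
  if m is m'.+1 then bump_deriv m'.*2 (bump_poly m') else 1.

Definition bump m t : R := bump_term m.*2 (bump_poly m) t.

Lemma is_derive_bump m t : is_derive t (1 : R) (bump m) (bump m.+1 t).
Proof. exact: is_derive_bump_term. Qed.

Lemma bump0 m t : 1 <= `|t| -> bump m t = 0.
Proof. by rewrite /bump /bump_term ltNge => ->. Qed.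

Lemma bump_bounded m : exists2 C : R, 0 <= C & forall t, `|bump m t| <= C.
Proof. exact: bump_term_bounded. Qed.

Lemma bump_ge0 t : 0 <= bump 0 t.
Proof. by rewrite /bump /bump_term; case: ifP => //; rewrite /= !hornerE expR_ge0. Qed.

Lemma bump_gt0 t : `|t| <= 2^-1 -> expR (- 2) <= bump 0 t.
Proof.
move=> t2; rewrite /bump /bump_term ifT ?(le_lt_trans t2) ?invf_lt1 ?ltr1n //.
rewrite /= !hornerE ler_expR lerN2 -[leRHS]invrK lef_pV2 ?posrE //; last first.
  by apply: one_sub_sqr_gt0; rewrite (le_lt_trans t2) // invf_lt1 ?ltr1n.
have : t ^+ 2 <= 2^-1 ^+ 2 by rewrite -[t ^+ 2]real_normK ?num_real // lerXn2r ?nnegrE.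
by lra.
Qed.

End bump.
(** * Integration over space-time *)

Lemma uniform_continuity_compact {R : realType} {V : normedModType R} (g : V -> R)
    (A : set V) (e : R) : compact A -> {within A, continuous g} -> 0 < e ->
  exists2 eta : R, 0 < eta &
    forall x y, A x -> A y -> `|x - y| <= eta -> `|g x - g y| <= e.
Proof.
move=> /compact_near_coveringP cA /subspace_continuousP cg e0.
have : \forall h \near 0^'+, A `<=`
    (fun x => A x -> forall y, A y -> `|x - y| <= h -> `|g x - g y| <= e).
  apply: cA => x Ax; have e2 : 0 < e / 2 by rewrite divr_gt0.
  have /cvgrPdist_le/(_ _ e2)/nbhs_normP[d /= d0 Hd] := cg x Ax.
  have d2 : 0 < d / 2 by rewrite divr_gt0.
  have cl y : A y -> `|x - y| < d -> `|g x - g y| <= e / 2.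
    by move=> Ay xy; exact: (Hd y).
  near=> z h => Az y Ay zy.
  have zx : `|x - z| < d / 2 by near: z; exact: cvgr_dist_lt.
  have hd : h < d / 2 by near: h; exact: nbhs_right_lt.
  rewrite (splitr e) -(subrKA (g x)) (le_trans (ler_normD _ _)) // lerD //.
    by rewrite distrC cl // (lt_trans zx) // ltr_pdivrMr // ltr_pMr // ltr1n.
  apply: cl => //; rewrite -(subrKA z) (le_lt_trans (ler_normD _ _)) // (splitr d) ltrD //.
  exact: le_lt_trans zy hd.
move=> [eta /= eta0 H]; exists (eta / 2); first by rewrite divr_gt0.
move=> x y Ax Ay xy; apply: (H (eta / 2)) => //=; last by rewrite divr_gt0.
by rewrite sub0r normrN gtr0_norm ?divr_gt0 // ltr_pdivrMr // ltr_pMr // ltr1n.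
Unshelve. all: by end_near. Qed.

Lemma uniform_continuity_ball {R : realType} {V : normedModType R} (g : V -> R) (r e : R) :
  (forall r : R, compact [set x : V | `|x| <= r]) -> continuous g -> 0 < e ->
  exists2 eta : R, 0 < eta & forall x y, `|x| <= r -> `|x - y| <= eta -> `|g x - g y| <= e.
Proof.
move=> cV cg e0.
have [eta eta0 H] := uniform_continuity_compact (cV (r + 1)) (continuous_subspaceT cg) e0.
exists (Num.min eta 1); first by rewrite lt_min eta0 ltr01.
move=> x y xr; rewrite le_min => /andP[xy xy1]; apply: H => //=.
  by rewrite (le_trans xr) // lerDl.
rewrite -(subrK x y) (le_trans (ler_normD _ _)) // addrC distrC lerD //.
Qed.

Section line.
Context {R : realType} {V : normedModType R}.

Lemma is_derive_line (g : V -> R) (x v : V) (t d : R) :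
  is_derive t (1 : R) (fun t : R => g (t *: v + x)) d <-> is_derive (t *: v + x) v g d.
Proof.
have E : (fun h : R => h^-1 *: (g (h *: v + (t *: v + x)) - g (t *: v + x))) =
    (fun h : R => h^-1 *: ((fun t : R => g (t *: v + x)) (h *: (1 : R) + t) -
      (fun t : R => g (t *: v + x)) t)).
  by apply/funext => h /=; rewrite [h *: 1]mulr1 addrA scalerDl.
split=> -[dg gE]; split; move: dg gE; rewrite /derivable /derive E //.
Qed.

End line.

Section space_time_integral.
Context {R : realType} {n : nat}.
Local Notation P := ('rV[R]_n * R)%type.
Local Notation T := (n.+1.-tuple (measurableTypeR R)).
Local Notation mu := (@lebesgue_tuple R n.+1).
Local Notation rt := (@row_of_tuple R n.+1).
Implicit Types (p q z : P) (g h : P -> R).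

(** Space-time integrals are integrals over tuples of length n + 1 whose first
    entry is the time. *)
Definition pt (w : 'rV[R]_n.+1) : P := (\row_i w 0 (lift ord0 i), w 0 ord0).

Definition unpt p : 'rV[R]_n.+1 :=
  \row_j if unlift ord0 j is Some i then p.1 0 i else p.2.

Lemma ptD (w w' : 'rV[R]_n.+1) : pt (w + w') = pt w + pt w'.
Proof. by rewrite /pt mxE; congr pair; apply/rowP => i; rewrite !mxE. Qed.

Lemma ptN (w : 'rV[R]_n.+1) : pt (- w) = - pt w.
Proof. by rewrite /pt mxE; congr pair; apply/rowP => i; rewrite !mxE. Qed.

Lemma unptK p : pt (unpt p) = p.
Proof.
rewrite /pt [RHS]surjective_pairing; congr pair; last by rewrite mxE unlift_none.
by apply/rowP => i; rewrite !mxE liftK.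
Qed.

Definition co (i : option 'I_n) p : R := if i is Some j then p.1 0 j else p.2.

Lemma coP p (r : R) : 0 <= r -> (forall i, `|co i p| <= r) -> `|p| <= r.
Proof.
move=> r0 H; rewrite prod_normE ge_max (H None) andbT.
by apply: norm_le_coord => // i; exact: (H (Some i)).
Qed.

Lemma co_le_norm i p : `|co i p| <= `|p|.
Proof.
rewrite prod_normE le_max; case: i => [j|] /=; last by rewrite lexx orbT.
by rewrite coord_le_norm.
Qed.

Lemma co_continuous i : continuous (co i).
Proof.
case: i => [j|] p; last exact: cvg_snd.
apply: (@continuous_comp _ _ _ fst (fun x : 'rV[R]_n => x 0 j)); first exact: cvg_fst.
exact: coord_continuous.
Qed.

Lemma norm_le_pt (w : 'rV[R]_n.+1) : `|w| <= `|pt w|.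
Proof.
apply: norm_le_coord => // j; case: (unliftP ord0 j) => [i|] ->.
  by have := co_le_norm (Some i) (pt w); rewrite /= mxE.
exact: (co_le_norm None (pt w)).
Qed.

Definition JP h : R := J mu (fun v => h (pt (rt v))).
Definition ItgP h := Itg mu (fun v => h (pt (rt v))).

Lemma measurable_pt h : continuous h -> measurable_fun setT (fun v : T => h (pt (rt v))).
Proof.
move=> ch; apply: (@measurable_continuous_comp _ _ _ _ h
   (fun v : T => \row_i rt v 0 (lift ord0 i)) (fun v : T => rt v 0 ord0)) => //.
  by move=> i; under eq_fun do rewrite mxE; exact: measurable_row_coord.
exact: measurable_row_coord.
Qed.

Lemma JP_translate p h : continuous h -> JP (fun q => h (q + p)) = JP h.
Proof.
move=> ch; rewrite /JP -(@J_translate _ _ (unpt p) (h \o pt)) /=.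
  by under [in RHS]eq_fun do rewrite ptD unptK.
exact: measurable_pt.
Qed.

Lemma JP_reflect p h : continuous h -> JP (fun q => h (p - q)) = JP h.
Proof.
move=> ch; rewrite -(JP_translate p ch) /JP.
rewrite -[RHS](@J_opp _ _ (fun w => h (pt w + p))); last first.
  apply: (@measurable_pt (fun q => h (q + p))) => q.
  apply: (@continuous_comp _ _ _ (fun q => q + p) h); last exact: ch.
  by apply: cvgD; [exact: cvg_id|exact: cvg_cst].
by under [in RHS]eq_fun do rewrite ptN addrC.
Qed.

Lemma Itg_box (r : R) : 0 <= r -> Itg mu (\1_(ball_box r)).
Proof.
move=> r0; have mb := @measurable_ball_box R n.+1 r.
apply/integrableP; split; first exact/measurable_EFinP/measurable_indic.
rewrite (eq_integral (fun v => (\1_(ball_box r) v)%:E)) => [|v _]; last first.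
  by rewrite /= ger0_norm.
by rewrite integral_indic // setIT [X in (X < _)%E](measure_ball_box r0) ltry.
Qed.

Lemma compact_ball_pair (r : R) : compact [set p : P | `|p| <= r].
Proof.
rewrite (_ : [set _ | _] = [set x : 'rV[R]_n | `|x| <= r] `*` `[- r, r]%classic).
  by apply: compact_setX; [exact: compact_norm_le|exact: segment_compact].
apply/seteqP; split => p /=; rewrite prod_normE ge_max in_itv /= -ler_norml.
  by move=> /andP[].
by move=> [-> ->].
Qed.

Lemma bounded_on_ball g (r : R) : continuous g ->
  exists2 C : R, 0 <= C & forall p, `|p| <= r -> `|g p| <= C.
Proof.
move=> cg; have := @continuous_compact _ _ g _ (continuous_subspaceT cg) (@compact_ball_pair r).
move=> /compact_bounded [M [_ HM]]; exists (`|M| + 1) => [|p pr].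
  by rewrite addr_ge0.
apply: (HM (`|M| + 1)) => /=; last by exists p.
by rewrite (le_lt_trans (ler_norm _)) // ltrDl.
Qed.

Lemma ItgP_compact h (r : R) : continuous h -> (forall q, r <= `|q| -> h q = 0) -> ItgP h.
Proof.
move=> ch hr; have r0 : 0 <= `|r| by [].
have [C C0 hC] := bounded_on_ball `|r| ch.
apply: Itg_le (measurable_pt ch) _ (ItgZ C (Itg_box r0)) => v.
have [qr|qr] := leP `|r| `|pt (rt v)|.
  by rewrite hr ?normr0 ?mulr_ge0 // (le_trans (ler_norm _)).
rewrite indicE mem_set ?mulr1; first exact/hC/ltW.
by apply: ball_boxP => //; rewrite (le_trans (norm_le_pt _)) // ltW.
Qed.

Lemma JP_ge_box h (r c : R) : 0 < r -> continuous h -> ItgP h -> (forall q, 0 <= h q) ->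
  0 < c -> (forall q, `|q| <= r -> c <= h q) -> 0 < JP h.
Proof.
move=> r0 ch Ih h0 c0 hc.
have : J mu (fun v => c * \1_(ball_box r) v) <= JP h.
  apply: J_le => [|//|v]; first by apply: ItgZ; apply: Itg_box; exact: ltW.
  rewrite indicE; have [vb|vb] := boolP (v \in _); last by rewrite mulr0.
  rewrite mulr1; apply: hc; apply: coP => [|i]; first exact: ltW.
  move: vb; rewrite inE => vb.
  case: i => [j|]; rewrite /= !mxE.
    by have := vb (lift ord0 j); rewrite /= in_itv /= -ler_norml.
  by have := vb ord0; rewrite /= in_itv /= -ler_norml.
apply: lt_le_trans; rewrite JZ; last by apply: Itg_box; exact: ltW.
rewrite mulr_gt0 // /J /Rintegral integral_indic ?setIT //; last exact: measurable_ball_box.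
by rewrite [X in fine X](measure_ball_box (ltW r0)) /= exprn_gt0 // mulr_gt0.
Qed.

End space_time_integral.
(** * Mollification *)

Section mollifier.
Context {R : realType} {n : nat}.
Local Notation P := ('rV[R]_n * R)%type.
Local Notation I := (option 'I_n).
Local Notation mu := (@lebesgue_tuple R n.+1).
Local Notation rt := (@row_of_tuple R n.+1).
Implicit Types (p q z : P) (g G : P -> R) (i j : I) (a : seq I) (m : nat).

Variables (d kappa : R).
Hypothesis d0 : 0 < d.

Definition profile m (t : R) : R := d^-1 ^+ m * bump m (t / d).

Lemma is_derive_profile m t : is_derive t (1 : R) (profile m) (profile m.+1 t).
Proof.
have dd : is_derive t (1 : R) (fun t : R => t / d) d^-1.
  have -> : (fun t : R => t / d) = d^-1 \*: (fun t : R => t).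
    by apply/funext => u; rewrite /= /GRing.scale /= mulrC.
  by apply: is_derive_eq; rewrite /GRing.scale /= mulr1.
have db := @is_derive1_comp _ (bump m) (fun t : R => t / d) t _ _ (is_derive_bump m (t / d)) dd.
have -> : profile m = d^-1 ^+ m \*: (bump m \o (fun t : R => t / d)) by [].
by apply: is_derive_eq; rewrite /profile /GRing.scale /= exprS; ring.
Qed.

Lemma profile0 m t : d <= `|t| -> profile m t = 0.
Proof.
by move=> dt; rewrite /profile bump0 ?mulr0 // normrM normfV (gtr0_norm d0) ler_pdivlMr // mul1r.
Qed.

Lemma profile_bounded m : exists2 C : R, 0 <= C & forall t, `|profile m t| <= C.
Proof.
have [C C0 H] := @bump_bounded R m; have di : 0 <= d^-1 ^+ m by rewrite exprn_ge0 // invr_ge0 ltW.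
exists (d^-1 ^+ m * C) => [|t]; first exact: mulr_ge0.
by rewrite /profile normrM (ger0_norm di) ler_wpM2l.
Qed.

Lemma profile_lip m : exists2 C : R, 0 <= C & forall t u, `|profile m u - profile m t| <= C * `|u - t|.
Proof.
have [C C0 H] := profile_bounded m.+1; exists C => // t u.
by apply: (mean_value_bound (df := profile m.+1)) => v _ _; [exact: is_derive_profile|exact: H].
Qed.

Lemma profile_taylor m : exists2 C : R, 0 <= C &
  forall t h : R, `|profile m (t + h) - profile m t - h * profile m.+1 t| <= C * h ^+ 2.
Proof.
have [C C0 H] := profile_lip m.+1; exists C => // t h.
pose f u := profile m u - u * profile m.+1 t.
have -> : profile m (t + h) - profile m t - h * profile m.+1 t = f (t + h) - f t.
  by rewrite /f; ring.
have -> : C * h ^+ 2 = C * `|h| * `|t + h - t|.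
  by rewrite [t + h]addrC addrK -mulrA -expr2 real_normK ?num_real.
apply: (mean_value_bound (df := fun u => profile m.+1 u - profile m.+1 t)) => v v1 v2.
  have dp := is_derive_profile m v.
  have -> : f = profile m - profile m.+1 t \*: (fun u : R => u).
    by apply/funext => u; rewrite /f /= /GRing.scale /= [u * _]mulrC.
  by apply: is_derive_eq; rewrite /GRing.scale /= mulr1.
rewrite (le_trans (H _ _)) // ler_wpM2l // ler_norml.
move: v1 v2; have [h0|h0] := leP 0 h.
  by rewrite (min_idPl _) ?lerDl // (max_idPr _) ?lerDl // (ger0_norm h0); lra.
by rewrite (min_idPr _) ?gerDl ?(ltW h0) // (max_idPl _) ?gerDl ?(ltW h0) // (ltr0_norm h0); lra.
Qed.

Lemma profile_continuous m : continuous (profile m).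
Proof.
move=> t; apply: differentiable_continuous; apply/derivable1_diffP.
by have [] := is_derive_profile m t.
Qed.

(** The derivative of the kernel in the directions listed by a. *)
Definition K a q : R := kappa * \prod_(i : I) profile (count_mem i a) (co i q).

Lemma K_continuous a : continuous (K a).
Proof.
apply: continuous_mul; first exact: cst_continuous.
elim: (index_enum I) => [|i l IHl].
  by under eq_fun do rewrite big_nil; exact: cst_continuous.
under eq_fun do rewrite big_cons; apply: continuous_mul => // q.
by apply: (@continuous_comp _ _ _ (co i) (profile _)); [exact: co_continuous|exact: profile_continuous].
Qed.

Lemma K0 a q : d <= `|q| -> K a q = 0.
Proof.
move=> dq; have [i di] : exists i, d <= `|co i q|.
  apply: contrapT => /forallNP H; suff : `|q| < d by rewrite ltNge dq.
  have H' i : `|co i q| < d by rewrite ltNge; exact/negP.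
  rewrite prod_normE gt_max (H' None) andbT.
  by apply: norm_lt_coord => // i; exact: (H' (Some i)).
by rewrite /K (bigD1 i) //= profile0 // mul0r mulr0.
Qed.

Lemma co_dir i j (h : R) q : co i (h *: dir j + q) = (if i == j then h else 0) + co i q.
Proof.
case: i j => [i|] [j|]; rewrite /= ?mxE /= ?scaler0 ?mulr0 //; last by rewrite [h *: 1]mulr1.
by rewrite (inj_eq Some_inj); case: eqP => _; rewrite ?mulr1 ?mulr0.
Qed.

Lemma K_shift a i : exists2 C : R, 0 <= C &
  forall (h : R) q, `|K a (h *: dir i + q) - K a q - h * K (i :: a) q| <= C * h ^+ 2.
Proof.
have /choice[B BP] : forall j, exists C, forall t, 0 <= C /\ `|profile (count_mem j a) t| <= C.
  by move=> j; have [C C0 H] := profile_bounded (count_mem j a); exists C.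
have B0 j : 0 <= B j by case: (BP j 0).
have [C C0 H] := profile_taylor (count_mem i a).
exists (`|kappa| * \prod_(j | j != i) B j * C) => [|h q].
  by rewrite !mulr_ge0 // prodr_ge0.
pose A := kappa * \prod_(j | j != i) profile (count_mem j a) (co j q).
have KD b w : K b w = kappa * \prod_(j | j != i) profile (count_mem j b) (co j w) *
    profile (count_mem i b) (co i w) by rewrite /K (bigD1 i) //=; ring.
have KE (h' : R) : K a (h' *: dir i + q) = A * profile (count_mem i a) (co i q + h').
  rewrite KD co_dir eqxx [h' + _]addrC; congr (_ * _ * _).
  by apply: eq_bigr => j ji; rewrite co_dir (negbTE ji) add0r.
have K1 : K a q = A * profile (count_mem i a) (co i q).
  by have := KE 0; rewrite scale0r add0r addr0.
have K2 : K (i :: a) q = A * profile (count_mem i a).+1 (co i q).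
  rewrite KD /= eqxx add1n; congr (_ * _ * _).
  by apply: eq_bigr => j ji; rewrite eq_sym (negbTE ji).
rewrite KE K1 K2 (_ : _ - _ - _ = A * (profile (count_mem i a) (co i q + h) -
  profile (count_mem i a) (co i q) - h * profile (count_mem i a).+1 (co i q))); last by ring.
rewrite normrM -[leRHS]mulrA; apply: ler_pM => //.
rewrite /A normrM ler_wpM2l // normr_prod; apply: ler_prod => j _.
by rewrite normr_ge0 /=; case: (BP j (co j q)).
Qed.

(** With g (p - q), and not g (p + q), M (i :: a) g is the derivative of M a g
    in the direction i, without a sign. *)
Definition M a g p : R := JP (fun q => g (p - q) * K a q).

Lemma reflect_continuous g p : continuous g -> continuous (fun q => g (p - q)).
Proof.
move=> cg q; apply: (@continuous_comp _ _ _ (fun q => p - q) g); last exact: cg.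
by apply: cvgB; [exact: cvg_cst|exact: cvg_id].
Qed.

Lemma itg_M a g p : continuous g -> ItgP (fun q => g (p - q) * K a q).
Proof.
move=> cg; apply: (@ItgP_compact _ _ _ d) => [|q dq]; last by rewrite K0 ?mulr0.
by apply: continuous_mul; [exact: reflect_continuous|exact: K_continuous].
Qed.

Lemma itg_K a : ItgP (fun q => `|K a q|).
Proof.
apply: (@ItgP_compact _ _ _ d) => [q|q dq]; last by rewrite K0 ?normr0.
by apply: (@continuous_comp _ _ _ (K a)); [exact: K_continuous|exact: norm_continuous].
Qed.

(** Derivatives of the mollification are controlled by the values of g: for a
    fixed d, uniform smallness gives C^k smallness. *)
Lemma M_le a g p e : continuous g -> (forall q, `|q| <= d -> `|g (p - q)| <= e) ->
  `|M a g p| <= e * JP (fun q => `|K a q|).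
Proof.
move=> cg ge; rewrite -JZ; last exact: itg_K.
apply: J_norm_le => [|v|]; first by have := itg_M a p cg => /Itg_meas.
  have [qd|qd] := leP `|pt (rt v)| d; first by rewrite normrM ler_wpM2r // ge.
  by rewrite K0 ?(ltW qd) // mulr0 normr0 mulr0.
exact: (ItgZ _ (itg_K a)).
Qed.

Lemma MD a g (h : P -> R) p : continuous g -> continuous h ->
  M a (fun q => g q + h q) p = M a g p + M a h p.
Proof.
move=> cg ch; rewrite /M /JP -JD; try exact: itg_M.
by congr (J _ _); apply/funext => v; rewrite mulrDl.
Qed.

Lemma MZ a c g p : continuous g -> M a (fun q => c * g q) p = c * M a g p.
Proof.
move=> cg; rewrite /M /JP -JZ; last exact: itg_M.
by congr (J _ _); apply/funext => v; rewrite mulrA.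
Qed.

Lemma translate_continuous g p : continuous g -> continuous (fun q => g (p + q)).
Proof.
move=> cg q; apply: (@continuous_comp _ _ _ (fun q => p + q) g); last exact: cg.
by apply: cvgD; [exact: cvg_cst|exact: cvg_id].
Qed.

Lemma M_continuous a g : continuous g -> continuous (M a g).
Proof.
move=> cg p; set k := JP (fun q => `|K a q|); have k0 : 0 <= k by apply: J_ge0.
apply/cvgrPdist_le => e e0; have e1 : 0 < e / (k + 1) by rewrite divr_gt0 // ltr_wpDl.
have [eta eta0 H] := uniform_continuity_ball (`|p| + d) (@compact_ball_pair R n) cg e1.
near=> z; have zp : `|p - z| <= eta by near: z; exact: cvgr_dist_le.
have -> : M a g p - M a g z = M a (fun q => g q - g (z - p + q)) p.
  have cz := @translate_continuous g (z - p) cg.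
  rewrite (MD a p cg (g := g) (h := fun q => - g (z - p + q))); last exact: continuous_opp.
  congr (_ + _); under eq_fun do rewrite -mulN1r; rewrite MZ // mulN1r; congr (- _).
  by rewrite /M; congr JP; apply/funext => q; rewrite addrA subrK.
apply: (@le_trans _ _ (e / (k + 1) * k)); last first.
  by rewrite mulrAC ler_pdivrMr ?ltr_wpDl // ler_pM2l // lerDl.
apply: M_le => [q|q qd].
  by apply: (cvgB (cg q)); exact: (@translate_continuous g (z - p) cg).
apply: H; first by rewrite (le_trans (ler_normB _ _)) // lerD2l.
by rewrite [z - p + _]addrA subrK opprD opprK addrACA addNr addr0.
Unshelve. all: by end_near. Qed.

(** The derivative falls on the kernel once the integral is rewritten as that
    of g q * K (p - q). *)
Lemma is_derive_M a i g p (r : R) : continuous g -> (forall q, r <= `|q| -> g q = 0) ->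
  is_derive p (dir i) (M a g) (M (i :: a) g p).
Proof.
move=> cg gr; have [C C0 H] := K_shift a i.
have ME b z : M b g z = JP (fun q => g q * K b (z - q)).
  rewrite -(JP_reflect z) /M; first by congr JP; apply/funext => q; rewrite subKr.
  by apply: continuous_mul => //; apply: reflect_continuous; exact: K_continuous.
have Ig b z : ItgP (fun q => g q * K b (z - q)).
  apply: (@ItgP_compact _ _ _ r) => [|q rq]; last by rewrite gr // mul0r.
  by apply: continuous_mul => //; apply: reflect_continuous; exact: K_continuous.
have Ia : ItgP (fun q => `|g q|).
  apply: (@ItgP_compact _ _ _ r) => [q|q rq]; last by rewrite gr // normr0.
  by apply: (@continuous_comp _ _ _ g); [exact: cg|exact: norm_continuous].
apply: (@is_derive_quadratic _ _ _ _ _ _ (C * JP (fun q => `|g q|))) => h.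
rewrite !ME {1}/JP {1}/JP -JB; try exact: Ig.
rewrite {1}/JP -JZ; last exact: Ig.
rewrite -JB; [|by apply: ItgB; exact: Ig|by apply: ItgZ; exact: Ig].
rewrite mulrAC -JZ //; apply: J_norm_le => [|v|]; last by apply: ItgZ.
  apply: (Itg_meas (mu := mu)); apply: ItgB; first by apply: ItgB; exact: Ig.
  by apply: ItgZ; exact: Ig.
set q := pt (rt v); rewrite -[h *: dir i + p - q]addrA.
have -> : g q * K a (h *: dir i + (p - q)) - g q * K a (p - q) - h * (g q * K (i :: a) (p - q)) =
   g q * (K a (h *: dir i + (p - q)) - K a (p - q) - h * K (i :: a) (p - q)) by ring.
by rewrite normrM mulrC ler_wpM2r.
Qed.

Lemma partials_M a g (r : R) : continuous g -> (forall q, r <= `|q| -> g q = 0) ->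
  partials a (M [::] g) = M a g.
Proof.
move=> cg gr; elim: a => //= i a ->; apply/funext => p.
by have [_] := is_derive_M a i p cg gr.
Qed.

Lemma Coo_M g (r : R) (Omega : set P) : continuous g -> (forall q, r <= `|q| -> g q = 0) ->
  Coo_on Omega (M [::] g).
Proof.
move=> cg gr k; split => [i a _ p _|a _ p _]; rewrite (partials_M a cg gr).
  by have [] := is_derive_M a i p cg gr.
exact: M_continuous.
Qed.

Lemma M_supp g (r : R) p : (forall q, r <= `|q| -> g q = 0) -> r + d <= `|p| ->
  M [::] g p = 0.
Proof.
move=> gr rp; rewrite /M /JP [X in J _ X](_ : _ = fun=> 0) ?J0 //.
apply/funext => v; set q := pt (rt v).
have [qd|qd] := leP d `|q|; first by rewrite K0 // mulr0.
rewrite gr ?mul0r // (le_trans _ (lerB_dist _ _)) // lerBrDr (le_trans _ rp) //.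
by rewrite lerD2l ltW.
Qed.

(** By the mean value theorem and the uniform continuity of G', the difference
    quotients of G converge to G' uniformly near p. *)
Lemma is_derive_M_inner i G G' p : continuous G -> continuous G' ->
  (forall z, `|z - p| <= d + d -> is_derive z (dir i) G (G' z)) ->
  is_derive p (dir i) (M [::] G) (M [::] G' p).
Proof.
move=> cG cG' dG; set k := JP (fun q => `|K [::] q|); have k0 : 0 <= k by apply: J_ge0.
apply: is_derive_small => e e0; have e1 : 0 < e / (k + 1) by rewrite divr_gt0 // ltr_wpDl.
have [eta eta0 H] := uniform_continuity_ball (`|p| + d) (@compact_ball_pair R n) cG' e1.
exists (Num.min eta d); first by rewrite lt_min eta0.
move=> h; rewrite le_min => /andP[he hd].
have dir1 : `|dir i : P| <= 1.
  by apply: coP => // j; have := co_dir j i 1 0; rewrite scale1r addr0 => ->;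
    case: j => [j|] /=; rewrite ?mxE addr0; case: ifP; rewrite ?normr1 ?normr0.
have cT (f : P -> R) z : continuous f -> continuous (fun q => f (z + q)).
  exact: translate_continuous.
have -> : M [::] G (h *: dir i + p) - M [::] G p - h * M [::] G' p =
    M [::] (fun q => (G (h *: dir i + q) - G q) - h * G' q) p.
  have c1 : continuous (fun q => - G q) by exact: continuous_opp.
  have c2 := cT G (h *: dir i) cG.
  have c3 : continuous (fun q => - h * G' q).
    by apply: continuous_mul => //; exact: cst_continuous.
  have c4 : continuous (fun q => G (h *: dir i + q) - G q) by move=> q; exact: (cvgB (c2 q) (cG q)).
  under [in RHS]eq_fun do rewrite -mulNr.
  rewrite (MD [::] p c4 c3) (MD [::] p c2 c1) MZ // mulNr; congr (_ + _ - _).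
    by rewrite /M; congr JP; apply/funext => q; rewrite addrA.
  by under [in RHS]eq_fun do rewrite -mulN1r; rewrite MZ // mulN1r.
have cQ : continuous (fun q => (G (h *: dir i + q) - G q) - h * G' q).
  move=> q; apply: (cvgB (cvgB (cT _ _ cG q) (cG q))).
  by apply: continuous_mul => //; exact: cst_continuous.
apply: (@le_trans _ _ (e / (k + 1) * `|h| * k)); last first.
  rewrite mulrAC ler_wpM2r // mulrAC ler_pdivrMr ?ltr_wpDl // ler_pM2l // lerDl //.
apply: M_le => // q qd.
pose f t := G (t *: dir i + (p - q)) - t * G' (p - q).
have -> : G (h *: dir i + (p - q)) - G (p - q) - h * G' (p - q) = f h - f 0.
  by rewrite /f scale0r add0r; ring.
have -> : e / (k + 1) * `|h| = e / (k + 1) * `|h - 0| by rewrite subr0.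
have th (t : R) : Num.min 0 h <= t -> t <= Num.max 0 h -> `|t| <= `|h|.
  by rewrite ler_norml; have [h0|h0] := leP 0 h; [rewrite (ger0_norm h0)|rewrite (ltr0_norm h0)]; lra.
have nd (t : R) : `|t *: dir i : P| <= `|t|.
  by rewrite normrZ ler_piMr.
apply: (mean_value_bound (df := fun t => G' (t *: dir i + (p - q)) - G' (p - q))) => t t1 t2.
  have d1 : is_derive t (1 : R) (fun t : R => G (t *: dir i + (p - q))) (G' (t *: dir i + (p - q))).
    apply/is_derive_line; apply: dG.
    rewrite addrA addrAC addrK (le_trans (ler_normB _ _)) // lerD //.
    by rewrite (le_trans (nd t)) // (le_trans (th t t1 t2)).
  have -> : f = (fun t : R => G (t *: dir i + (p - q))) - G' (p - q) \*: (fun t : R => t).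
    by apply/funext => u; rewrite /f /= /GRing.scale /= [u * _]mulrC.
  by apply: is_derive_eq; rewrite /GRing.scale /= mulr1.
rewrite distrC; apply: H; first by rewrite (le_trans (ler_normB _ _)) // lerD2l.
by rewrite opprD addrCA subrr addr0 normrN (le_trans (nd t)) // (le_trans (th t t1 t2)).
Qed.

End mollifier.

(** * The fractional Laplacian of a mollification *)

Section fubini.
Context d1 d2 {T1 : measurableType d1} {T2 : measurableType d2} {R : realType}.
Variables (m1 : {sigma_finite_measure set T1 -> \bar R})
  (m2 : {sigma_finite_measure set T2 -> \bar R}).

Lemma EFin_J d (T : measurableType d) (mu : {measure set T -> \bar R}) (f : T -> R) :
  Itg mu f -> (J mu f)%:E = (\int[mu]_x (f x)%:E)%E.
Proof. by move=> If; rewrite /J /Rintegral fineK //; exact: integrable_fin_num. Qed.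

Lemma J_fubini (H : T1 * T2 -> R) (A : T1 -> R) (B : T2 -> R) :
  measurable_fun setT H -> Itg m1 A -> Itg m2 B ->
  (forall x, 0 <= A x) -> (forall y, 0 <= B y) ->
  (forall x y, `|H (x, y)| <= A x * B y) ->
  J m1 (fun x => J m2 (fun y => H (x, y))) = J m2 (fun y => J m1 (fun x => H (x, y))).
Proof.
move=> mH IA IB A0 B0 HAB.
have mE : measurable_fun setT (EFin \o H) by exact/measurable_EFinP.
have I2 x : Itg m2 (fun y => H (x, y)).
  by apply: (Itg_le _ (HAB x)); [exact: measurable_fun_pair2|exact: ItgZ].
have I1 y : Itg m1 (fun x => H (x, y)).
  have HAB' x : `|H (x, y)| <= B y * A x by rewrite mulrC.
  by apply: (Itg_le _ HAB'); [exact: measurable_fun_pair1|exact: ItgZ].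
have I : (m1 \x m2)%E.-integrable setT (EFin \o H).
  apply/(integrable12ltyP m1 m2 mE).
  have le x : (\int[m2]_y `|(EFin \o H) (x, y)| <= (J m2 B * A x)%:E)%E.
    have -> : (\int[m2]_y `|(EFin \o H) (x, y)| = (J m2 (fun y => `|H (x, y)|))%:E)%E.
      by rewrite EFin_J //; exact: Itg_abs.
    rewrite lee_fin mulrC -JZ //; apply: J_le => //; first exact: Itg_abs.
    exact: ItgZ.
  apply: (@le_lt_trans _ _ (\int[m1]_x (J m2 B * A x)%:E)%E).
    apply: ge0_le_integral => //.
    - by move=> x _; exact: integral_ge0.
    - apply: (measurable_fun_fubini_tonelli_F (m2 := m2)
        (fun xy => `|(EFin \o H) xy|%E)) => //.
      exact: measurableT_comp.
    - by apply/measurable_EFinP; exact: Itg_meas (ItgZ _ IA).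
  by rewrite -EFin_J ?ltry //; exact: ItgZ.
have := Fubini I; rewrite /= => E; rewrite /J /Rintegral; congr fine.
transitivity (\int[m1]_x \int[m2]_y (H (x, y))%:E)%E.
  by apply: eq_integral => x _; rewrite -EFin_J.
by rewrite E; apply: eq_integral => y _; rewrite -EFin_J.
Qed.

End fubini.

Section mollified_solution.
Context {R : realType} {n : nat}.
Local Notation P := ('rV[R]_n * R)%type.
Local Notation rt := (@row_of_tuple R n).
Local Notation rt1 := (@row_of_tuple R n.+1).
Local Notation mu := (@lebesgue_tuple R n).
Local Notation mu1 := (@lebesgue_tuple R n.+1).
Implicit Types (p q z : P) (G : P -> R).

Lemma mollifier_exists (d : R) : 0 < d -> exists kappa : R,
  (forall q, 0 <= @K R n d kappa [::] q) /\ JP (@K R n d kappa [::]) = 1.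
Proof.
move=> d0; pose k1 := JP (@K R n d 1 [::]).
have K1ge0 q : 0 <= @K R n d 1 [::] q.
  by rewrite /K mul1r prodr_ge0 // => i _; rewrite /profile expr0 mul1r bump_ge0.
have IK : ItgP (@K R n d 1 [::]).
  apply: (@ItgP_compact _ _ _ d); first exact: K_continuous.
  by move=> q; exact: K0.
have k1gt0 : 0 < k1.
  apply: (@JP_ge_box _ _ _ (d / 2) (\prod_(i : option 'I_n) expR (- 2))) => //.
  - by rewrite divr_gt0.
  - exact: K_continuous.
  - by apply: prodr_gt0 => i _; exact: expR_gt0.
  move=> q qd; rewrite /K mul1r; apply: ler_prod => i _.
  rewrite expR_ge0 /= /profile expr0 mul1r; apply: bump_gt0.
  rewrite normrM normfV (gtr0_norm d0) ler_pdivrMr // mulrC.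
  exact: le_trans (co_le_norm _ _) qd.
have E q : @K R n d k1^-1 [::] q = k1^-1 * @K R n d 1 [::] q by rewrite /K mul1r.
exists k1^-1; split => [q|]; first by rewrite E mulr_ge0 // invr_ge0 ltW.
rewrite /JP; under eq_fun do rewrite E.
by rewrite JZ // -/(JP _) -/k1 mulVf // gt_eqF.
Qed.

Variables (d kappa : R).
Hypotheses (d0 : 0 < d) (K_ge0 : forall q, 0 <= @K R n d kappa [::] q)
  (K_mass : JP (@K R n d kappa [::]) = 1).

Local Notation K := (@K R n d kappa).
Local Notation M := (@M R n d kappa).

Let IK : ItgP (K [::]).
Proof. by apply: (ItgP_compact (r := d)) => [|q]; [exact: K_continuous|exact: K0]. Qed.

Lemma M_close G p (y e : R) : continuous G ->
  (forall q, `|q| <= d -> `|G (p - q) - y| <= e) -> `|M [::] G p - y| <= e.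
Proof.
move=> cG H.
have absK : (fun q => `|K [::] q|) = K [::] by apply/funext => q; rewrite ger0_norm.
have cy : continuous (fun _ : P => - y) by exact: cst_continuous.
have -> : M [::] G p - y = M [::] (fun q => G q + (fun=> - y) q) p.
  rewrite MD //; congr (_ + _); rewrite {1}/M /JP JZ //.
  by rewrite -/(JP _) K_mass mulr1.
rewrite -[e]mulr1 -K_mass -absK; apply: M_le => // w.
exact: (cvgD (cG w) (cy w)).
Qed.

Variables (s c : R).
Hypotheses (s0 : 0 < s) (s1 : s < 1) (c0 : 0 < c).
Variables (u : P -> R) (C : R).
Hypotheses (cu : continuous u)
  (u2 : forall x t y, `|u (x, t) - (u (x + y, t) + u (x - y, t)) / 2| <= C * m2 y).

Local Notation frac := (@frac R n s c).

Lemma m2_bound_ge0 : (1 <= n)%N -> 0 <= C.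
Proof.
move=> n1; have := u2 0 0 (const_mx 1); rewrite (m2_const (Ordinal n1)) mulr1.
exact: le_trans.
Qed.

Let second_difference_continuous x t y :
  continuous (fun q : P => (u (x - q.1, t - q.2) -
     (u (x - q.1 + y, t - q.2) + u (x - q.1 - y, t - q.2)) / 2) * K [::] q).
Proof.
apply: continuous_mul; last exact: K_continuous.
have cc w : continuous (fun q : P => u (x - q.1 + w, t - q.2)).
  have -> : (fun q : P => u (x - q.1 + w, t - q.2)) = (fun q => u ((x + w, t) - q)).
    by apply/funext => q; rewrite [x - _ + _]addrAC.
  exact: reflect_continuous.
have c1 : continuous (fun q : P => u (x - q.1, t - q.2)).
  by have := cc 0; under eq_fun do rewrite addr0.
move=> q; apply: (cvgB (c1 q)).
exact: (cvgM (cvgD (cc y q) (cc (- y) q)) (cvg_cst _)).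
Qed.

Lemma second_difference_M x t y :
  M [::] u (x, t) - (M [::] u (x + y, t) + M [::] u (x - y, t)) / 2 =
  JP (fun q => (u (x - q.1, t - q.2) -
     (u (x - q.1 + y, t - q.2) + u (x - q.1 - y, t - q.2)) / 2) * K [::] q).
Proof.
have I p := itg_M kappa d0 [::] p cu.
have -> : (M [::] u (x + y, t) + M [::] u (x - y, t)) / 2 =
   2^-1 * (M [::] u (x + y, t) + M [::] u (x - y, t)) by rewrite mulrC.
rewrite /M /JP -JD; try exact: I.
rewrite -JZ; last by apply: ItgD; exact: I.
rewrite -JB; [|exact: I|by apply: ItgZ; apply: ItgD; exact: I].
congr (J _ _); apply/funext => v; set q := pt _.
have E w : (w, t) - q = (w - q.1, t - q.2) by [].
by rewrite !E [x + y - _]addrAC [x - y - _]addrAC; ring.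
Qed.

Lemma second_difference_M_le x t y :
  `|M [::] u (x, t) - (M [::] u (x + y, t) + M [::] u (x - y, t)) / 2| <= C * m2 y.
Proof.
rewrite second_difference_M /JP.
rewrite -[leRHS]mulr1 -[X in _ <= _ * X]K_mass -JZ //.
apply: J_norm_le => [|v|]; last exact: ItgZ.
- exact: (measurable_pt (@second_difference_continuous x t y)).
- by rewrite normrM (ger0_norm (K_ge0 _)) ler_wpM2r.
Qed.

(** The second differences of u are at most C m2 y, so Fubini applies. *)
Lemma frac_M x t : (1 <= n)%N -> frac (fun x => M [::] u (x, t)) x =
  JP (fun q => frac (fun x => u (x, t - q.2)) (x - q.1) * K [::] q).
Proof.
move=> n1; have C0 := m2_bound_ge0 n1.
have Ik : Itg mu (fun v => m2 (rt v) * kern s c (rt v)) by exact: itg_m2kern.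
pose VW := (n.-tuple (measurableTypeR R) * n.+1.-tuple (measurableTypeR R))%type.
pose Q (vw : VW) : P := pt (rt1 vw.2).
pose H (vw : VW) : R :=
  (u (x - (Q vw).1, t - (Q vw).2) - (u (x - (Q vw).1 + rt vw.1, t - (Q vw).2) +
     u (x - (Q vw).1 - rt vw.1, t - (Q vw).2)) / 2) * kern s c (rt vw.1) * K [::] (Q vw).
have mc1 i : measurable_fun setT (fun vw : VW => rt vw.1 0 i).
  exact: (measurableT_comp (@measurable_row_coord R n i) measurable_fst).
have mc2 i : measurable_fun setT (fun vw : VW => rt1 vw.2 0 i).
  exact: (measurableT_comp (@measurable_row_coord R n.+1 i) measurable_snd).
have mu' (e : R) : measurable_fun setT (fun vw : VW => u (x - (Q vw).1 + e *: rt vw.1,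
       t - (Q vw).2)).
  apply: (measurable_continuous_comp (phi := fun vw => x - (Q vw).1 + e *: rt vw.1)
    (tau := fun vw => t - (Q vw).2)) => //.
    move=> i; rewrite (_ : (fun vw => _) =
      (fun vw => x 0 i - rt1 vw.2 0 (lift ord0 i) + e * rt vw.1 0 i)).
      by apply: measurable_funD; [exact: measurable_funB|exact: measurable_funM].
    by apply/funext => vw; rewrite !mxE.
  apply: measurable_funB => //; exact: mc2.
have mH : measurable_fun setT H.
  apply: measurable_funM; last first.
    exact: (measurableT_comp (measurable_pt (@K_continuous R n d kappa [::])) measurable_snd).
  apply: measurable_funM; last first.
    exact: (measurableT_comp (measurable_kern s c) measurable_fst).
  have := mu' 0; under eq_fun do rewrite scale0r addr0; move=> m0.
  have := mu' 1; under eq_fun do rewrite scale1r; move=> mp.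
  have := mu' (-1); under eq_fun do rewrite scaleN1r; move=> mn.
  by apply: measurable_funB => //; apply: measurable_funM => //; exact: measurable_funD.
have k0 (y : 'rV[R]_n) : 0 <= kern s c y := kern_ge0 s c0 y.
have A0 (v : n.-tuple (measurableTypeR R)) : 0 <= C * (m2 (rt v) * kern s c (rt v)).
  by apply: mulr_ge0 => //; apply: mulr_ge0 => //; exact: m2_ge0.
have HAB v w : `|H (v, w)| <= C * (m2 (rt v) * kern s c (rt v)) * K [::] (pt (rt1 w)).
  rewrite /H normrM [X in X * _ <= _]normrM (ger0_norm (K_ge0 _)) (ger0_norm (k0 _)).
  by rewrite ler_wpM2r // mulrA ler_wpM2r.
have IH v : Itg mu1 (fun w => H (v, w)).
  apply: (Itg_le _ (HAB v)); last exact: ItgZ.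
  exact: measurable_fun_pair2.
have IH' w : Itg mu (fun v => H (v, w)).
  have HAB' v : `|H (v, w)| <= K [::] (pt (rt1 w)) * (C * (m2 (rt v) * kern s c (rt v))).
    by rewrite mulrC.
  apply: (Itg_le _ HAB'); last by do 2 apply: ItgZ.
  exact: measurable_fun_pair1.
have E := J_fubini (m1 := mu) (m2 := mu1) mH (ItgZ C Ik) IK A0 (fun w => K_ge0 _) HAB.
transitivity (J mu (fun v => J mu1 (fun w => H (v, w)))).
  rewrite /frac; congr (J mu _); apply/funext => v.
  rewrite second_difference_M mulrC /JP -JZ; last first.
    apply: (ItgP_compact (r := d)) (@second_difference_continuous x t _) _ => q dq.
    by rewrite K0 ?mulr0.
  by congr (J _ _); apply/funext => w; rewrite /H /=; ring.
rewrite E /JP; congr (J _ _); apply/funext => w.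
rewrite /frac mulrC -JZ.
  by congr (J _ _); apply/funext => v; rewrite /H /Q /=; ring.
apply: Itg_le (ItgZ C Ik) => [|v].
  apply: measurable_funM; last exact: measurable_kern.
  have mw e := measurable_fun_pair1 w (mu' e).
  apply: measurable_funB => //; apply: measurable_funM => //; apply: measurable_funD.
    by have := mw 1; under eq_fun do rewrite scale1r.
  by have := mw (-1); under eq_fun do rewrite scaleN1r.
by rewrite normrM (ger0_norm (k0 _)) mulrA ler_wpM2r.
Qed.

End mollified_solution.
(** * The normalizing constant *)

Section gamma.
Context {R : realType}.
Local Notation mu := (@lebesgue_measure R).

Let f (z r : R) : R := if 0 < r then r `^ (z - 1) * expR (- r) else 0.

Let f_ge0 z r : 0 <= f z r.
Proof. by rewrite /f; case: ifP => // _; rewrite mulr_ge0 ?powR_ge0 ?expR_ge0. Qed.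

Let measurable_f z : measurable_fun setT (f z).
Proof.
apply: measurable_fun_ifT => //; first exact: measurable_fun_ltr.
apply: measurable_funM; first exact: measurable_powR.
by apply: (measurableT_comp (@measurable_expR R)); exact: oppr_measurable.
Qed.

Let measure_segment (b : R) : 0 <= b -> mu `[0, b]%classic = b%:E.
Proof.
move=> b0; rewrite lebesgue_measure_itv /= lte_fin oppr0 addr0.
by case: ltP => // b0'; congr EFin; apply/le_anti; rewrite b0 b0'.
Qed.

Let pow2N k : 2 ^- k = 2 `^ (- k%:R) :> R.
Proof. by rewrite powRN powR_mulrn. Qed.

Let pow2X (w : R) k : (2 `^ w) ^+ k = 2 `^ (w * k%:R) :> R.
Proof. by rewrite powRrM powR_mulrn ?powR_ge0. Qed.

Let pow2_ge1 (w : R) : 0 <= w -> 1 <= 2 `^ w :> R.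
Proof. by move=> w0; rewrite -[leLHS](powRr0 2) ler_powR // ler1n. Qed.

(** r^(z-1) is at most 2^|z-1| 2^(-j(z-1)) when 2^(-j-1) < r <= 2^-j. *)
Let itg_f_near (z : R) : 0 < z -> Itg mu (fun r => if r <= 1 then f z r else 0).
Proof.
move=> z0.
apply: (@Itg_geometric R _ (measurableTypeR R) mu _ (fun j => `[0, 2 ^- j]%classic)
  (fun j => 2 `^ `|z - 1| * 2 `^ ((1 - z) * j%:R)) (2 `^ `|z - 1|) (2 `^ (- z))).
- apply: measurable_fun_ifT => //; last exact: measurable_f.
  by apply: measurable_fun_ler; [exact: measurable_id|exact: measurable_cst].
- by move=> r; case: ifP.
- by move=> j; exact: measurable_itv.
- by move=> j; rewrite mulr_ge0 ?powR_ge0.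
- exact: powR_ge0.
- rewrite powRN invf_lt1 ?powR_gt0 //; have := gt0_ltr_powR z0 (x := 1) (y := 2).
  by rewrite !nnegrE powR1; apply; rewrite ?ler01 ?ler0n ?ltr1n.
- move=> j; rewrite [X in (_ * X <= _)%E]measure_segment ?invr_ge0 ?exprn_ge0 // -EFinM lee_fin.
  rewrite -mulrA (_ : 2 `^ ((1 - z) * j%:R) * _ = (2 `^ (- z)) ^+ j) //.
  rewrite pow2N pow2X -powRD ?pnatr_eq0 ?implybT //.
  by congr (_ `^ _); ring.
move=> r; rewrite /f; case: ifPn => [r1|_]; last by left.
case: ifPn => [r0|_]; last by left.
right; have [|j [j1 j2]] := @dyadic_interval R r^-1; first by rewrite invf_ge1.
have r_le : r <= 2 ^- j by rewrite -[leLHS]invrK lef_pV2 ?posrE ?exprn_gt0 ?invr_gt0.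
have r_ge : 2 ^- j.+1 <= r.
  by rewrite -[leRHS]invrK lef_pV2 ?posrE ?exprn_gt0 ?invr_gt0 // ltW.
exists j; first by rewrite /= in_itv /= r_le ltW.
apply: (@le_trans _ _ (r `^ (z - 1))).
  by rewrite ler_piMr ?powR_ge0 // expR_le1 oppr_le0 ltW.
have [z1|z1] := leP 1 z.
  apply: (@le_trans _ _ (2 `^ ((1 - z) * j%:R))); last first.
    by rewrite ler_peMl ?powR_ge0 // pow2_ge1.
  rewrite (_ : (1 - z) * j%:R = - j%:R * (z - 1)); last by ring.
  by rewrite powRrM -pow2N ge0_ler_powR ?nnegrE ?subr_ge0 ?(ltW r0).
rewrite -powRD ?pnatr_eq0 ?implybT // ltr0_norm ?subr_lt0 // opprB.
rewrite (_ : 1 - z + _ = - (- j.+1%:R * (1 - z))); last by rewrite -natr1; ring.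
rewrite powRN powRrM -pow2N -opprB powRN lef_pV2 ?posrE ?powR_gt0 ?invr_gt0 ?exprn_gt0 //.
by rewrite ge0_ler_powR ?nnegrE ?subr_ge0 ?(ltW z1) ?(ltW r0) // invr_ge0 exprn_ge0.
Qed.

(** e^r >= r^m / m! with m >= z + 1 bounds the integrand by m! / r^2. *)
Let itg_f_far (z : R) : 0 < z -> Itg mu (fun r => if 1 <= r then f z r else 0).
Proof.
move=> z0; pose N := (Num.trunc (z + 1)).+1.
have zN : z + 1 <= N.+1%:R.
  by rewrite (le_trans (ltW (truncnS_gt _))) // ler_nat leqnSn.
pose C : R := N.+1`!%:R.
apply: (@Itg_geometric R _ (measurableTypeR R) mu _ (fun j => `[0, 2 ^+ j.+1]%classic)
  (fun j => C * (2 ^- j) ^+ 2) (C * 2) 2^-1).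
- apply: measurable_fun_ifT => //; last exact: measurable_f.
  by apply: measurable_fun_ler; [exact: measurable_cst|exact: measurable_id].
- by move=> r; case: ifP.
- by move=> j; exact: measurable_itv.
- by move=> j; rewrite mulr_ge0 ?exprn_ge0 ?invr_ge0 ?exprn_ge0.
- by rewrite invr_ge0.
- by rewrite invf_lt1 ?ltr1n.
- move=> j; rewrite [X in (_ * X <= _)%E]measure_segment ?exprn_ge0 // -EFinM lee_fin.
  rewrite [leRHS](_ : _ = C * 2 * 2 ^- j); last by rewrite exprVn.
  rewrite [2 ^+ j.+1]exprS; have : 2 ^+ j != 0 :> R by rewrite expf_neq0.
  by move: (2 ^+ j : R) => a a0; rewrite le_eqVlt; apply/orP; left; apply/eqP; field.
move=> r; rewrite /f; case: ifPn => [r1|_]; last by left.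
have r0 : 0 < r by rewrite (lt_le_trans ltr01).
rewrite r0; right; have [j [j1 j2]] := dyadic_interval r1.
exists j; first by rewrite /= in_itv /= (ltW r0) (ltW j2).
have ri : r^-1 <= 2 ^- j by rewrite lef_pV2 ?posrE ?exprn_gt0.
apply: (@le_trans _ _ (C * r^-1 ^+ 2)); last first.
  by rewrite ler_wpM2l // lerXn2r ?nnegrE ?invr_ge0 ?exprn_ge0 ?(ltW r0).
have := expR_ge1Dxn N (ltW r0); rewrite -/C => H.
have C0 : 0 < C by rewrite ltr0n fact_gt0.
rewrite expRN ler_pdivrMr ?expR_gt0 //.
apply: (@le_trans _ _ (C * r^-1 ^+ 2 * (r ^+ N.+1 / C))); last first.
  rewrite ler_wpM2l ?mulr_ge0 ?exprn_ge0 ?invr_ge0 ?(ltW r0) ?(ltW C0) //.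
  by rewrite (le_trans _ H) // lerDr.
apply: (@le_trans _ _ (r `^ (N.+1%:R - 2))); first by rewrite ler_powR //; lra.
have -> : r `^ (N.+1%:R - 2) = r ^+ N.+1 * r^-1 ^+ 2.
  rewrite powRD; last by rewrite (gt_eqF r0) implybT.
  by rewrite powRN !powR_mulrn ?(ltW r0) // exprVn.
rewrite (_ : C * _ * _ = r ^+ N.+1 * r^-1 ^+ 2 * (C / C)); last by ring.
by rewrite divff ?gt_eqF // mulr1.
Qed.

Lemma Gamma_gt0 (z : R) : 0 < z -> 0 < Gamma z.
Proof.
move=> z0; have E : Gamma z = J mu (f z).
  rewrite /Gamma /J Rintegral_mkcond; congr Rintegral; apply/funext => r.
  rewrite /patch mem_setE in_itv /= andbT /f.
  by case: ifP.
have If : Itg mu (f z).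
  apply: (@Itg_le _ (measurableTypeR R) R mu _ _ (measurable_f z) _
    (ItgD (itg_f_near z0) (itg_f_far z0))) => r.
  rewrite ger0_norm //; have [r1|r1] := leP r 1; first by rewrite lerDl; case: ifP.
  by rewrite add0r ifT // ltW.
pose c : R := Num.min 1 (2 `^ (z - 1)) * expR (- 2).
have m0 : 0 < Num.min 1 (2 `^ (z - 1)) :> R by rewrite lt_min ltr01 powR_gt0.
have c0 : 0 < c by rewrite mulr_gt0 // expR_gt0.
have I1 : Itg mu (\1_(`[1, 2]%classic : set R)) by exact: integrable_indic_itv.
have : J mu (fun r => c * \1_(`[1, 2]%classic : set R) r) <= Gamma z.
  rewrite E; apply: J_le => //; first exact: ItgZ.
  move=> r; rewrite indicE; have [|] := boolP (r \in _); last by rewrite mulr0.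
  rewrite inE /= in_itv /= => /andP[r1 r2]; have r0 : 0 < r by rewrite (lt_le_trans ltr01).
  rewrite mulr1 /f r0; apply: ler_pM; rewrite ?(ltW m0) ?expR_ge0 //; last by rewrite ler_expR lerN2.
  rewrite ge_min; have [z1|z1] := leP 1 z.
    by rewrite -[leLHS](powRr0 r) ler_powR ?subr_ge0.
  apply/orP; right; rewrite -opprB !powRN lef_pV2 ?posrE ?powR_gt0 //.
  by rewrite ge0_ler_powR ?nnegrE ?subr_ge0 ?(ltW z1) ?(ltW r0).
apply: lt_le_trans; rewrite JZ // mulr_gt0 // /J /Rintegral integral_indic // setIT.
by rewrite [X in fine X](@lebesgue_measure_itv R `[1, 2]%R) /= lte_fin ltr1n /= subr_gt0 ltr1n.
Qed.

Lemma frac_const_gt0 n (s : R) : 0 < s -> s < 1 -> 0 < @frac_const R n s.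
Proof.
move=> s0 s1; rewrite /frac_const divr_gt0 // mulr_gt0 ?powR_gt0 ?pi_gt0 ?Gamma_gt0 //.
- by rewrite mulr_gt0 // powR_gt0.
- by rewrite ltr_wpDl // divr_ge0.
- by rewrite subr_gt0.
Qed.

End gamma.
(** * The principal value *)

Section principal_value.
Context {R : realType} {n : nat}.
Local Notation P := ('rV[R]_n * R)%type.
Local Notation T := (n.-tuple (measurableTypeR R)).
Local Notation rt := (@row_of_tuple R n).
Local Notation mu := (@lebesgue_tuple R n).
Implicit Types x y : 'rV[R]_n.

Lemma enorm_le_norm y : enorm y ^+ 2 <= n.+1%:R * `|y| ^+ 2.
Proof.
rewrite sqr_enorm (@le_trans _ _ (\sum_(i < n) `|y| ^+ 2)) //.
  apply: ler_sum => i _; rewrite -[_ ^+ 2]real_normK ?num_real // lerXn2r ?nnegrE //.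
  exact: coord_le_norm.
rewrite sumr_const card_ord -[leLHS]mulr_natl ler_wpM2r ?exprn_ge0 //.
by rewrite ler_nat leqnSn.
Qed.

Variables (s : R).
Hypotheses (s0 : 0 < s) (s1 : s < 1).
Local Notation riesz := (@riesz R n s).

Let outer (rho : R) y : R := if rho <= enorm y then riesz y else 0.

Let r0 y : 0 <= riesz y. Proof. exact: riesz_ge0. Qed.
Let mr : measurable_fun setT (fun v : T => riesz (rt v)).
Proof. exact: measurable_riesz. Qed.
Let Ir : Itg mu (fun v => m2 (rt v) * riesz (rt v)). Proof. exact: Itg_m2riesz. Qed.

Let measurable_outer rho : measurable_fun setT (fun v : T => outer rho (rt v)).
Proof.
apply: measurable_fun_ifT => //; apply: measurable_fun_ler => //.
by apply: meas_row; exact: enorm_continuous.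
Qed.

Let itg_outer rho : 0 < rho -> Itg mu (fun v => outer rho (rt v)).
Proof.
move=> rho0; pose c := Num.min 1 (rho ^+ 2 / n.+1%:R).
have c0 : 0 < c by rewrite lt_min ltr01 divr_gt0 // exprn_gt0.
apply: Itg_le (ItgZ c^-1 Ir); first exact: measurable_outer.
move=> v; rewrite /outer; case: ifPn => [rv|_]; last first.
  rewrite normr0; apply: mulr_ge0; first by rewrite invr_ge0 ltW.
  by apply: mulr_ge0 => //; exact: m2_ge0.
rewrite ger0_norm // mulrA ler_peMl // mulrC ler_pdivlMr // mul1r.
rewrite /c /m2 le_min !ge_min lexx /=; apply/orP; right.
rewrite ler_pdivrMr // mulrC (le_trans _ (enorm_le_norm _)) //.
by rewrite lerXn2r ?nnegrE ?enorm_ge0 // ltW.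
Qed.

Variables (w : 'rV[R]_n -> R) (B C : R) (x : 'rV[R]_n).
Hypotheses (cw : continuous w) (wB : forall y, `|w y| <= B) (C0 : 0 <= C)
  (w2 : forall y, `|w x - (w (x + y) + w (x - y)) / 2| <= C * m2 y).

Let sd y : R := w x - (w (x + y) + w (x - y)) / 2.

Let mD : measurable_fun setT (fun v : T => w (x + rt v)).
Proof. exact: (meas_shift x false cw). Qed.

Let mB : measurable_fun setT (fun v : T => w (x - rt v)).
Proof. exact: (meas_shift x true cw). Qed.

Let msd : measurable_fun setT (fun v : T => sd (rt v)).
Proof.
by apply: measurable_funB => //; apply: measurable_funM => //; exact: measurable_funD.
Qed.

Let itg_sd : Itg mu (fun v => sd (rt v) * riesz (rt v)).
Proof.
apply: Itg_le (ItgZ C Ir); first exact: measurable_funM.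
move=> v; rewrite normrM (ger0_norm (r0 _)) mulrA; apply: ler_wpM2r; first exact: r0.
exact: w2.
Qed.

Let itg_jump rho : 0 < rho -> Itg mu (fun v => (w x - w (x + rt v)) * outer rho (rt v)).
Proof.
move=> rho0; apply: Itg_le (ItgZ (B + B) (itg_outer rho0)).
  by apply: measurable_funM => //; exact: measurable_funB.
have o0 y : 0 <= outer rho y by rewrite /outer; case: ifP.
move=> v; rewrite normrM (ger0_norm (o0 _)) ler_wpM2r //.
by rewrite (le_trans (ler_normB _ _)) // lerD.
Qed.

Let symmetrize rho : 0 < rho ->
  J mu (fun v => (w x - w (x + rt v)) * outer rho (rt v)) =
  J mu (fun v => sd (rt v) * outer rho (rt v)).
Proof.
move=> rho0; pose g y := (w x - w (x + y)) * outer rho y.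
have Ig : Itg mu (fun v => g (rt v)) by exact: itg_jump.
have Ig' : Itg mu (fun v => g (- rt v)) by apply: (@Itg_opp R n g).
have := @J_opp R n g (Itg_meas Ig) => E.
change (J mu (fun v => g (rt v)) = J mu (fun v => sd (rt v) * outer rho (rt v))).
transitivity (J mu (fun v => 2^-1 * (g (rt v) + g (- rt v)))).
  rewrite JZ; last exact: ItgD.
  have H (a b : R) : b = a -> a = 2^-1 * (a + b) by move=> ->; field.
  by rewrite (JD Ig Ig'); exact: H E.
congr (J _ _); apply/funext => v; rewrite /g /sd.
have -> : outer rho (- rt v) = outer rho (rt v) by rewrite /outer enormN rieszN.
by field.
Qed.

(** Odd parts cancel over the complement of a ball, and the remaining
    symmetrized integrand converges absolutely. *)
Lemma principal_value :
  (forall rho : R, 0 < rho -> Itg mu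
     (fun v => if rho <= enorm (rt v) then (w x - w (x + rt v)) * riesz (rt v) else 0)) /\
  J mu (fun v => if rho <= enorm (rt v) then (w x - w (x + rt v)) * riesz (rt v) else 0)
     @[rho --> 0^'+] --> J mu (fun v => sd (rt v) * riesz (rt v)).
Proof.
have E (rho : R) : (fun v : T => if rho <= enorm (rt v)
    then (w x - w (x + rt v)) * riesz (rt v) else 0) =
    (fun v => (w x - w (x + rt v)) * outer rho (rt v)).
  by apply/funext => v; rewrite /outer; case: ifP; rewrite ?mulr0.
split=> [rho rho0|]; first by rewrite E; exact: itg_jump.
have bound rho : 0 < rho -> `|J mu (fun v => sd (rt v) * riesz (rt v)) -
    J mu (fun v => (w x - w (x + rt v)) * outer rho (rt v))| <= C * omega riesz rho.
  move=> rho0; have Io := itg_outer rho0.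
  have Iso : Itg mu (fun v => sd (rt v) * outer rho (rt v)).
    apply: Itg_le (Itg_abs itg_sd); first exact: measurable_funM.
    move=> v; rewrite !normrM ler_wpM2l // /outer; case: ifP => // _.
    by rewrite normr0.
  rewrite symmetrize // -JB // /omega -JZ; last exact: itg_near r0 mr Ir _.
  apply: J_norm_le => [|v|]; last by apply: ItgZ; exact: itg_near r0 mr Ir _.
    exact: Itg_meas (ItgB itg_sd Iso).
  rewrite -mulrBr /outer; case: ifPn => [_|].
    by rewrite subrr mulr0 normr0 mulr_ge0 //; case: ifP => // _; rewrite mulr_ge0 ?m2_ge0.
  rewrite -ltNge => /ltW vr; rewrite ifT; last exact: le_trans (norm_le_enorm _) vr.
  rewrite subr0 normrM (ger0_norm (r0 _)) mulrA; apply: ler_wpM2r; first exact: r0.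
  exact: w2.
apply/cvgrPdist_le => e e0.
have e1 : 0 < e / (C + 1) by rewrite divr_gt0 // ltr_wpDl.
have /cvgrPdist_le/(_ _ e1)[m _ Hm] := omega_cvg0 r0 mr Ir.
near=> rho; have rho0 : 0 < rho by near: rho; exact: nbhs_right_gt.
have rm : rho <= m.+2%:R^-1 by near: rho; apply: nbhs_right_le; rewrite invr_gt0.
rewrite E (le_trans (bound rho rho0)) //.
have := Hm m (leqnn m); rewrite /= sub0r normrN => Ho.
have om : omega riesz rho <= e / (C + 1).
  by rewrite (le_trans (omega_le r0 mr Ir rm)) // (le_trans (ler_norm _)).
rewrite (le_trans (ler_wpM2l C0 om)) // mulrCA ger_pMr // ler_pdivrMr ?ltr_wpDl // mul1r lerDl //.
Unshelve. all: by end_near. Qed.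

End principal_value.

Lemma frac_laplacian_frac {R : realType} {n : nat} (s B C t : R) (u : 'rV[R]_n * R -> R)
    (x : 'rV[R]_n) : 0 < s -> s < 1 -> continuous (fun x => u (x, t)) ->
  (forall y, `|u (y, t)| <= B) -> 0 <= C ->
  (forall y, `|u (x, t) - (u (x + y, t) + u (x - y, t)) / 2| <= C * m2 y) ->
  frac_laplacian_exists s u x t /\
  frac_laplacian s u x t = frac s (frac_const n s) (fun x => u (x, t)) x.
Proof.
move=> s0 s1 cu uB C0 u2.
have mD (rho : R) : measurable (@ball_compl R n rho).
  have me : measurable_fun setT (fun v : n.-tuple (measurableTypeR R) => enorm (row_of_tuple v)).
    by apply: meas_row; exact: enorm_continuous.
  have -> : @ball_compl R n rho =
      (fun v => enorm (row_of_tuple v)) @^-1` `[rho, +oo[%classic.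
    by apply/seteqP; split => v /=; rewrite in_itv /= andbT.
  by rewrite -[X in measurable X]setTI; exact: me.
have [Ig cg] := principal_value s0 s1 cu uB C0 u2.
have E (rho : R) : (fun v => frac_integrand s u x t (row_of_tuple v)) \_ (@ball_compl R n rho) =
    (fun v => if rho <= enorm (row_of_tuple v) then
       (u (x, t) - u (x + row_of_tuple v, t)) * riesz s (row_of_tuple v) else 0).
  apply/funext => v; rewrite /patch mem_setE; case: ifP => //.
have trE (rho : R) : frac_truncated s u x t rho = J (lebesgue_tuple n) (fun v =>
     if rho <= enorm (row_of_tuple v) then
       (u (x, t) - u (x + row_of_tuple v, t)) * riesz s (row_of_tuple v) else 0).
  by rewrite /frac_truncated Rintegral_mkcond E.
have cg' : frac_truncated s u x t rho @[rho --> 0^'+] --> J (lebesgue_tuple n) (fun v =>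
    (u (x, t) - (u (x + row_of_tuple v, t) + u (x - row_of_tuple v, t)) / 2) *
      riesz s (row_of_tuple v)).
  by under eq_fun do rewrite trE.
split.
  split=> [rho rho0|]; last by apply/cvg_ex; eexists; exact: cg'.
  apply/(integrable_mkcond _ (mD rho)).
  have := Ig rho rho0; rewrite -E /Itg; congr (_.-integrable _ _).
  by apply/funext => v; rewrite /patch /=; case: ifP.
rewrite /frac_laplacian (cvg_lim _ cg') // /frac -JZ.
  by congr (J _ _); apply/funext => v; rewrite /kern mulrCA.
apply: Itg_le (ItgZ C (Itg_m2riesz s0 s1)).
  apply: measurable_funM; last exact: measurable_riesz.
  apply: measurable_funB => //; apply: measurable_funM => //; apply: measurable_funD.
    exact: (meas_shift x false cu).
  exact: (meas_shift x true cu).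
by move=> v; rewrite normrM (ger0_norm (riesz_ge0 _ _)) mulrA ler_wpM2r ?riesz_ge0.
Qed.
(** * Extension of f to a continuous function on space-time *)

Lemma compact_closure_bounded {R : realType} {n : nat} (A : set ('rV[R]_n * R)) (r : R) :
  (forall p, A p -> `|p| <= r) -> compact (closure A).
Proof.
move=> Ar; have cB := @compact_ball_pair R n r.
have clB := compact_closed (@norm_hausdorff R _) cB.
apply: subclosed_compact cB _; first exact: closed_closure.
by move/closure_id: clB => ->; apply: closure_subset => p; exact: Ar.
Qed.

(** There are finitely many words of length at most k. *)
Lemma near_words {I : finType} {X : Type} (F : set_system X) (FF : Filter F)
    (Q : seq I -> X -> Prop) k : (forall a, (size a <= k)%N -> \forall x \near F, Q a x) ->
  \forall x \near F, forall a, (size a <= k)%N -> Q a x.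
Proof.
elim: k Q => [|k IHk] Q QF.
  by apply: filterS (QF [::] isT) => x Qx [].
have H : \forall x \near F, forall i a, (size a <= k)%N -> Q (i :: a) x.
  by apply: filter_forall => i; apply: IHk => a ak; exact: QF.
by apply: filterS2 (QF [::] isT) H => x Q0 Q1 [|i a] // ak; exact: Q1.
Qed.

Lemma is_derive_scale {R : realType} {V : normedModType R} (g : V -> R) (z v : V) (r d : R) :
  is_derive (r *: z) v g d -> is_derive z v (fun p => g (r *: p)) (r * d).
Proof.
move=> dg; have z0 : 0 *: v + z = z by rewrite scale0r add0r.
rewrite -[z in is_derive z]z0; apply/is_derive_line.
have d1 : is_derive (r * 0) (1 : R) (fun t : R => g (t *: v + r *: z)) d.
  by apply/is_derive_line; rewrite mulr0 scale0r add0r.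
have d2 : is_derive (0 : R) (1 : R) (fun t : R => r * t) r.
  have -> : (fun t : R => r * t) = r \*: (fun t : R => t) by [].
  by apply: is_derive_eq; rewrite /GRing.scale /= mulr1.
have := @is_derive1_comp _ (fun t : R => g (t *: v + r *: z)) (fun t => r * t) 0 _ _ d1 d2.
rewrite mulrC; congr (is_derive _ _ _ _); apply/funext => t /=.
by rewrite scalerDr scalerA.
Qed.

Section gauge.
Context {R : realType} {n : nat}.
Local Notation P := ('rV[R]_n * R)%type.
Implicit Types p q z : P.

Definition gauge p : R := Num.max (enorm p.1) `|p.2|.

Lemma cylinderP p : cylinder R n p <-> gauge p < 1.
Proof.
rewrite /cylinder /unit_ball /gauge /= gt_max in_itv /= -ltr_norml.
by split => [[-> ->]|/andP[]].
Qed.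

Lemma norm_le_gauge p : `|p| <= gauge p.
Proof.
rewrite /gauge prod_normE ge_max !le_max norm_le_enorm /=.
by rewrite lexx orbT.
Qed.

Lemma gauge_continuous : continuous gauge.
Proof.
move=> p; apply: (@continuous_max _ _ (fun p : P => enorm p.1) (fun p : P => `|p.2|)).
  apply: (@continuous_comp _ _ _ fst (@enorm R n)); first exact: cvg_fst.
  exact: enorm_continuous.
by apply: (@continuous_comp _ _ _ snd (fun t : R => `|t|)); [exact: cvg_snd|exact: norm_continuous].
Qed.

Lemma gaugeZ (r : R) p : 0 <= r -> gauge (r *: p) = r * gauge p.
Proof.
move=> r0; rewrite /gauge maxr_pMr // normrM (ger0_norm r0); congr (Num.max _ _).
rewrite /enorm; have -> : \sum_i (r *: p).1 0 i ^+ 2 = r ^+ 2 * \sum_i p.1 0 i ^+ 2.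
  by rewrite mulr_sumr; apply: eq_bigr => i _; rewrite !mxE exprMn.
by rewrite sqrtrM ?sqr_ge0 // sqrtr_sqr ger0_norm.
Qed.

Lemma near_gauge_lt p (c : R) : gauge p < c -> \forall z \near p, gauge z < c.
Proof. by move=> pc; exact: (cvgr_lt _ (@gauge_continuous p)). Qed.

Lemma near_gauge_gt p (c : R) : c < gauge p -> \forall z \near p, c < gauge z.
Proof. by move=> pc; exact: (cvgr_gt _ (@gauge_continuous p)). Qed.

Lemma compact_closure_cylinder : compact (closure (cylinder R n)).
Proof.
apply: (@compact_closure_bounded _ _ _ 1) => p /cylinderP/ltW.
exact: le_trans (norm_le_gauge p).
Qed.

(** A continuous cutoff, equal to 1 on the cylinder dilated by 1 + d and to 0
    outside the one dilated by 1 + 2 d. *)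
Definition window (d : R) p : R := Num.min 1 (Num.max 0 ((1 + 2 * d - gauge p) / d)).

Lemma window1 d p : 0 < d -> gauge p <= 1 + d -> window d p = 1.
Proof.
move=> d0 pd; have H : 1 <= (1 + 2 * d - gauge p) / d by rewrite ler_pdivlMr // mul1r; lra.
by rewrite /window (max_idPr _) ?(le_trans ler01) // (min_idPl _).
Qed.

Lemma window0 d p : 0 < d -> 1 + 2 * d <= gauge p -> window d p = 0.
Proof.
move=> d0 pd; have H : (1 + 2 * d - gauge p) / d <= 0.
  by rewrite ler_pdivrMr // mul0r; lra.
by rewrite /window (max_idPl H) (min_idPr ler01).
Qed.

Lemma window_continuous d : continuous (window d).
Proof.
move=> p; apply: (@continuous_min _ _ (fun=> 1)
  (fun p => Num.max 0 ((1 + 2 * d - gauge p) / d))); first exact: cst_continuous.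
apply: (@continuous_max _ _ (fun=> 0) (fun p => (1 + 2 * d - gauge p) / d)).
  exact: cst_continuous.
exact: (cvgM (cvgB (cvg_cst _) (@gauge_continuous p)) (cvg_cst _)).
Qed.

End gauge.

Section dilation.
Context {R : realType} {n : nat}.
Local Notation P := ('rV[R]_n * R)%type.
Local Notation I := (option 'I_n).
Local Notation Omega := (cylinder R n).
Implicit Types (p q z : P) (a : seq I).

Variables (f : P -> R) (k : nat).
Hypothesis fk : Ck_closure k Omega f.

Lemma partials_uniform a (e : R) : (size a <= k)%N -> 0 < e ->
  exists2 eta : R, 0 < eta & forall p q, Omega p -> Omega q -> `|p - q| <= eta ->
    `|partials a f p - partials a f q| <= e.
Proof.
move=> ak e0; have [g cg fg] := fk.2 a ak.
have [eta eta0 H] := uniform_continuity_compact compact_closure_cylinder cg e0.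
exists eta => // p q Op Oq pq; rewrite !fg //; apply: H => //; exact: subset_closure.
Qed.

Lemma partials_bounded a : (size a <= k)%N ->
  exists2 B : R, 0 <= B & forall p, Omega p -> `|partials a f p| <= B.
Proof.
move=> ak; have [g cg fg] := fk.2 a ak.
have /compact_bounded[M [_ HM]] := continuous_compact cg compact_closure_cylinder.
exists (`|M| + 1) => [|p Op]; first by rewrite addr_ge0.
rewrite fg //; apply: (HM (`|M| + 1)) => /=.
  by rewrite (le_lt_trans (ler_norm _)) // ltrDl.
by exists p => //; exact: subset_closure.
Qed.

Lemma partials_continuous a p : (size a <= k)%N -> Omega p ->
  {for p, continuous (partials a f)}.
Proof.
move=> ak Op; apply/cvgrPdist_le => e e0.
have [eta eta0 H] := partials_uniform ak e0.
have /cylinderP/near_gauge_lt Np := Op.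
near=> z; have Oz : Omega z by apply/cylinderP; near: z.
by apply: H => //; near: z; exact: cvgr_dist_le.
Unshelve. all: by end_near. Qed.

(** p |-> f (ratio d *: p) is defined on the cylinder dilated by 1 + 3 d, which
    contains a neighbourhood of the support of window d. *)
Definition ratio (d : R) : R := (1 + 3 * d)^-1.

Lemma ratio_gt0 d : 0 < d -> 0 < ratio d.
Proof. by move=> d0; rewrite invr_gt0; lra. Qed.

Lemma ratio_lt1 d : 0 < d -> ratio d < 1.
Proof. by move=> d0; rewrite invf_lt1; lra. Qed.

Lemma ratio_ge d : 0 < d -> 1 - ratio d <= 3 * d.
Proof.
move=> d0; have q0 : 0 < 1 + 3 * d by lra.
rewrite lerBlDr -lerBlDl -[leRHS]mul1r ler_pdivlMr //.
have : 0 <= d * d by rewrite mulr_ge0 // ltW.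
lra.
Qed.

Lemma ratio_cylinder d p : 0 < d -> gauge p < 1 + 3 * d -> Omega (ratio d *: p).
Proof.
move=> d0 pd; apply/cylinderP; rewrite gaugeZ; last exact/ltW/ratio_gt0.
by rewrite mulrC ltr_pdivrMr ?mul1r //; lra.
Qed.

Lemma expr_ge (r : R) m : 0 <= r -> r <= 1 -> 1 - r ^+ m <= m%:R * (1 - r).
Proof.
move=> r0 r1; elim: m => [|m IHm]; first by rewrite expr0 subrr mul0r.
rewrite exprS -natr1; have : r * (1 - r ^+ m) <= 1 - r ^+ m.
  by rewrite ler_piMl // subr_ge0 exprn_ile1.
lra.
Qed.

(** The derivatives of p |-> f (ratio d *: p). *)
Definition dilated (d : R) a p : R := ratio d ^+ size a * partials a f (ratio d *: p).

Lemma dilated_close a (e : R) : (size a <= k)%N -> 0 < e ->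
  \forall d \near 0^'+, forall p, Omega p -> `|dilated d a p - partials a f p| <= e.
Proof.
move=> ak e0; have e2 : 0 < e / 2 by rewrite divr_gt0.
have [eta eta0 H] := partials_uniform ak e2.
have [B B0 fB] := partials_bounded ak.
have q0 : 0 < (size a)%:R * 3 * B + 1 :> R by rewrite ltr_wpDl // !mulr_ge0.
near=> d => p Op.
have d0 : 0 < d by near: d; exact: nbhs_right_gt.
have r0 := ratio_gt0 d0; have r1 := ratio_lt1 d0; have r3 := ratio_ge d0.
have p1 : gauge p < 1 by exact/cylinderP.
have Orp : Omega (ratio d *: p) by apply: ratio_cylinder => //; lra.
have deta : 3 * d <= eta.
  rewrite mulrC -ler_pdivlMr //; near: d; apply: nbhs_right_le; exact: divr_gt0.
have dB : d * ((size a)%:R * 3 * B + 1) <= e / 2.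
  rewrite -ler_pdivlMr //; near: d; apply: nbhs_right_le; exact: divr_gt0.
rewrite (splitr e) /dilated.
have -> : ratio d ^+ size a * partials a f (ratio d *: p) - partials a f p =
  - ((1 - ratio d ^+ size a) * partials a f (ratio d *: p)) +
  (partials a f (ratio d *: p) - partials a f p) by ring.
rewrite (le_trans (ler_normD _ _)) // lerD //.
  rewrite normrN normrM ger0_norm ?subr_ge0 ?exprn_ile1 ?(ltW r0) ?(ltW r1) //.
  apply: (@le_trans _ _ ((size a)%:R * (3 * d) * B)).
    apply: ler_pM => //; rewrite ?subr_ge0 ?exprn_ile1 ?(ltW r0) ?(ltW r1) //; last exact: fB.
    by rewrite (le_trans (expr_ge _ (ltW r0) (ltW r1))) // ler_wpM2l.
  apply: le_trans dB; rewrite mulrDr mulr1 (_ : _ * _ * B = d * ((size a)%:R * 3 * B)); last by ring.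
  by rewrite lerDl ltW.
apply: H => //; rewrite -[X in _ - X]scale1r -scalerBl normrZ.
rewrite distrC ger0_norm ?subr_ge0 ?(ltW r1) // -[eta]mulr1.
apply: ler_pM => //; rewrite ?subr_ge0 ?(ltW r1) //; first exact: le_trans r3 deta.
by rewrite (le_trans (norm_le_gauge p)) // ltW.
Unshelve. all: by end_near. Qed.

Definition extension (d : R) a p : R := window d p * dilated d a p.

Lemma extension_cylinder d a p : 0 < d -> Omega p -> extension d a p = dilated d a p.
Proof. by move=> d0 /cylinderP p1; rewrite /extension window1 ?mul1r //; lra. Qed.

Lemma extension_continuous d a : 0 < d -> (size a <= k)%N -> continuous (extension d a).
Proof.
move=> d0 ak p; have [p3|p3] := ltP (gauge p) (1 + 3 * d).
  have c1 : {for p, continuous (fun z => partials a f (ratio d *: z))}.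
    apply: (@continuous_comp _ _ _ (fun z => ratio d *: z) (partials a f)).
      exact: scaler_continuous.
    by apply: partials_continuous => //; exact: ratio_cylinder.
  exact: (cvgM (@window_continuous R n d p) (cvgM (cvg_cst _) c1)).
have p2 : 1 + 2 * d < gauge p by lra.
apply/cvgrPdist_le => e e0; near=> z.
rewrite /extension !window0 ?mul0r ?subrr ?normr0 ?(ltW e0) ?(ltW p2) //.
by apply: ltW; near: z; exact: near_gauge_gt.
Unshelve. all: by end_near. Qed.

Lemma is_derive_extension d a i z : 0 < d -> (size a < k)%N -> gauge z < 1 + d ->
  is_derive z (dir i) (extension d a) (extension d (i :: a) z).
Proof.
move=> d0 ak zd; have Orz : Omega (ratio d *: z) by apply: ratio_cylinder => //; lra.
apply: (@near_eq_is_derive _ _ _ (dilated d a)).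
  near=> p; rewrite /extension window1 ?mul1r //.
  by apply: ltW; near: p; exact: near_gauge_lt.
rewrite /extension window1 ?mul1r //; last exact: ltW.
have /derivableP/is_derive_scale d1 := fk.1 i a ak _ Orz.
have -> : dilated d a = ratio d ^+ size a \*: (fun p => partials a f (ratio d *: p)).
  by apply/funext.
by apply: is_derive_eq; rewrite /GRing.scale /dilated /= /partial exprS mulrCA mulrA.
Unshelve. all: by end_near. Qed.

End dilation.
(** * Approximation of derivatives and conclusion *)

Section derivatives.
Context {R : realType} {n : nat}.
Local Notation P := ('rV[R]_n * R)%type.
Local Notation Omega := (cylinder R n).
Implicit Types (p q z : P) (a : seq (option 'I_n)) (k : nat).

(** On an open set, derivatives at a point only see the nearby values. *)
Lemma partialsB (u f : P -> R) k a p :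
  has_partials k Omega u -> has_partials k Omega f -> (size a <= k)%N -> Omega p ->
  partials a (fun p => u p - f p) p = partials a u p - partials a f p.
Proof.
move=> du df; elim: a p => [//|i a IHa] p ak Op.
have /cylinderP/near_gauge_lt Np := Op.
rewrite /= /partial -(deriveB (du i a ak p Op) (df i a ak p Op)); apply: near_eq_derive.
near=> z; rewrite IHa //; first exact: ltnW.
by apply/cylinderP; near: z.
Unshelve. all: by end_near. Qed.

Lemma Ck_norm_le k (f : P -> R) (e : R) :
  (forall a p, (size a <= k)%N -> Omega p -> `|partials a f p| <= e) ->
  (Ck_norm k Omega f <= e%:E)%E.
Proof.
move=> H; apply: ge_ereal_sup => _ [a ak <-]; apply: ge_ereal_sup => _ [p Op <-].
by rewrite lee_fin H.
Qed.

(** Mollification commutes with differentiation where the differentiated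
    functions are derivatives of each other. *)
Lemma partials_M_inner (d kappa r : R) (k : nat) (G : seq (option 'I_n) -> P -> R) :
  0 < d -> (forall a, (size a <= k)%N -> continuous (G a)) ->
  (forall q, r <= `|q| -> G [::] q = 0) ->
  (forall a i p z, (size a < k)%N -> Omega p -> `|z - p| <= d + d ->
     is_derive z (dir i) (G a) (G (i :: a) z)) ->
  forall a p, (size a <= k)%N -> Omega p ->
    M d kappa a (G [::]) p = M d kappa [::] (G a) p.
Proof.
move=> d0 cG Gr dG; elim=> [//|i a IHa] p ak Op.
have /cylinderP/near_gauge_lt Np := Op.
have d1 := is_derive_M kappa d0 a i p (cG [::] isT) Gr.
have d2 := is_derive_M_inner kappa d0 (cG a (ltnW ak)) (cG (i :: a) ak)
  (fun z => dG a i p z ak Op).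
have d3 : is_derive p (dir i) (M d kappa a (G [::])) (M d kappa [::] (G (i :: a)) p).
  apply: near_eq_is_derive d2; near=> z; rewrite IHa //; first exact: ltnW.
  by apply/cylinderP; near: z.
by case: d1 => _ <-; case: d3 => _ <-.
Unshelve. all: by end_near. Qed.

End derivatives.

Lemma slice_continuous {R : realType} {V : normedModType R} (v : V * R -> R) (t : R) :
  continuous v -> continuous (fun y => v (y, t)).
Proof.
move=> cv y; apply/cvgrPdist_le => e e0.
have /cvgrPdist_le/(_ _ e0)/nbhs_normP[d d0 Hd] := cv (y, t).
near=> z; apply: (Hd (z, t)); rewrite /= prod_normE /= subrr normr0 gt_max d0 andbT.
by near: z; exact: cvgr_dist_lt.
Unshelve. all: by end_near. Qed.

Lemma near_right_ex {R : realType} (Q : R -> Prop) :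
  (\forall x \near 0^'+, Q x) -> exists2 x : R, 0 < x & Q x.
Proof.
move=> HQ; have [x [x0 Qx]] := filter_ex (filterI (nbhs_right_gt (0 : R)) HQ).
by exists x.
Qed.

Section caloric.
Context {R : realType} {n : nat}.
Local Notation P := ('rV[R]_n * R)%type.
Local Notation Omega := (cylinder R n).
Implicit Types (p q z : P).

(** Mollification averages the equation over translations by less than d, which
    stay in the region |x| <= 2, |t| <= 2 where u solves it. *)
Lemma mollified_equation (s d kappa C r : R) (u D : P -> R) (i0 : 'I_n) :
  0 < s -> s < 1 -> 0 < d -> d <= 2^-1 ->
  (forall q, 0 <= @K R n d kappa [::] q) -> JP (@K R n d kappa [::]) = 1 ->
  continuous u -> continuous D -> (forall q, r <= `|q| -> u q = 0) ->
  (forall x t y, `|u (x, t) - (u (x + y, t) + u (x - y, t)) / 2| <= C * m2 y) ->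
  (forall x t, `|t| < 3 -> is_derive t (1 : R) (fun t => u (x, t)) (D (x, t))) ->
  (forall x t, `|x| <= 2 -> `|t| <= 2 ->
      D (x, t) + frac s (frac_const n s) (fun x => u (x, t)) x = 0) ->
  forall x t, Omega (x, t) ->
    frac_laplacian_exists s (M d kappa [::] u) x t /\
    partial None (M d kappa [::] u) (x, t) + frac_laplacian s (M d kappa [::] u) x t = 0.
Proof.
move=> s0 s1 d0 d2 K0' K1 cu cD ur u2 du eq x t Oxt.
have n1 : (1 <= n)%N by exact: leq_trans (ltn_ord i0).
have c0 := frac_const_gt0 n s0 s1.
have xt1 : `|(x, t)| < 1 by rewrite (le_lt_trans (norm_le_gauge _)) //; exact/cylinderP.
have close q : `|q| <= d -> `|(x, t) - q| <= 2.
  by move=> qd; rewrite (le_trans (ler_normB _ _)) //; lra.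
set v := M d kappa [::] u; have cv : continuous v by exact: M_continuous.
have [B B0 vB] : exists2 B : R, 0 <= B & forall p, `|v p| <= B.
  have [B B0 HB] := bounded_on_ball (r + d) cv; exists B => // p.
  have [pr|/ltW pr] := leP `|p| (r + d); first exact: HB.
  by rewrite /v (M_supp kappa d0 ur pr) normr0.
have v2 y : `|v (x, t) - (v (x + y, t) + v (x - y, t)) / 2| <= C * m2 y.
  exact: second_difference_M_le.
have C0 := m2_bound_ge0 u2 n1.
have cx := @slice_continuous _ _ v t cv.
have [ex ->] := frac_laplacian_frac s0 s1 cx (fun y => vB (y, t)) C0 v2.
split=> //; rewrite (frac_M d0 K0' s0 s1 c0 cu u2 x t n1).
have -> : partial None v (x, t) = M d kappa [::] D (x, t).
  have [] // := @is_derive_M_inner _ _ d kappa d0 None u D (x, t) cu cD _.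
  move=> z zxt; have z3 : `|z.2| < 3.
    rewrite (le_lt_trans (co_le_norm None z)) // -(subrK (x, t) z).
    by rewrite (le_lt_trans (ler_normD _ _)) //; lra.
  have zE (h : R) : h *: dir None + (z.1, 0) = (z.1, h) :> P.
    by congr pair; rewrite /= ?scaler0 ?add0r // addr0 [h *: 1]mulr1.
  rewrite [z in is_derive z](_ : z = z.2 *: dir None + (z.1, 0)); last by rewrite zE -surjective_pairing.
  apply/is_derive_line; rewrite [z in D z]surjective_pairing.
  by under eq_fun do rewrite zE; exact: du.
rewrite /M [X in _ + X](_ : _ = JP (fun q => - (D ((x, t) - q) * K d kappa [::] q))).
  by rewrite /JP JN ?subrr //; exact: itg_M.
rewrite /JP; congr (J _ _); apply/funext => w; set q := pt _.
have [qd|/ltW qd] := leP `|q| d; last by rewrite K0 // !mulr0 oppr0.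
have := close q qd; rewrite prod_normE ge_max => /andP[x2 t2].
by rewrite -mulNr; congr (_ * _); apply/eqP; rewrite -addr_eq0 addrC; apply/eqP; exact: eq.
Qed.

End caloric.

Theorem theorem1 (R : realType) (n k : nat) (s eps : R)
    (f : 'rV[R]_n * R -> R) :
  (1 <= n)%N -> 0 < s -> s < 1 ->
  Ck_closure k (cylinder R n) f ->
  0 < eps ->
  exists u : 'rV[R]_n * R -> R,
    [/\ Coo_on (cylinder R n) u,
        continuous u,
        compact (supp u),
        (forall x t, cylinder R n (x, t) ->
           frac_laplacian_exists s u x t /\
           partial None u (x, t) + frac_laplacian s u x t = 0) &
        (Ck_norm k (cylinder R n) (fun p => (u p - f p)%R) <= eps%:E)%E].
Proof.
move=> n1 s0 s1 fk eps0; pose i0 : 'I_n := Ordinal n1.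
have e3 : 0 < eps / 3 by rewrite divr_gt0.
have c0 := frac_const_gt0 n s0 s1.
(* dilating f by ratio dl < 1 makes it available around the closed cylinder *)
have [dl dl0 Hdl] : exists2 dl : R, 0 < dl & forall a, (size a <= k)%N ->
    forall p, cylinder R n p -> `|dilated f dl a p - partials a f p| <= eps / 3.
  by apply: near_right_ex; apply: near_words => a ak; exact: (dilated_close fk ak e3).
pose G := extension f dl.
have cG a : (size a <= k)%N -> continuous (G a) by move=> ak; exact: (extension_continuous fk dl0 ak).
have Gr q : 1 + 2 * dl <= `|q| -> G [::] q = 0.
  by move=> qr; rewrite /G /extension window0 ?mul0r // (le_trans qr) // norm_le_gauge.
have cyl1 p : cylinder R n p -> `|p| <= 1.
  by move=> /cylinderP/ltW; exact: le_trans (norm_le_gauge p).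
have cB := @compact_ball_pair R n.
have dl2 : 0 < dl / 2 by rewrite divr_gt0.
have [eta eta0 Heta] := uniform_continuity_ball 1 cB (@gauge_continuous R n) dl2.
have nearG : \forall d \near 0^'+, forall a, (size a <= k)%N ->
    forall p q, cylinder R n p -> `|q| <= d -> `|G a (p - q) - G a p| <= eps / 3.
  apply: near_words => a ak.
  have [et et0 Het] := uniform_continuity_ball 1 cB (cG a ak) e3.
  near=> d => p q Op qd; rewrite distrC; apply: Het; first exact: cyl1.
  rewrite opprB addrCA subrr addr0 (le_trans qd) //.
  by near: d; exact: nbhs_right_le.
have [d d0 [d1 d2 Hd]] : exists2 d : R, 0 < d & [/\ d <= 2^-1, d + d <= eta &
    forall a, (size a <= k)%N -> forall p q, cylinder R n p -> `|q| <= d ->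
      `|G a (p - q) - G a p| <= eps / 3].
  apply: near_right_ex; near=> d; split; last by near: d; exact: nearG.
    by near: d; apply: nbhs_right_le; rewrite invr_gt0.
  rewrite -mulr2n -mulr_natr -ler_pdivlMr //.
  by near: d; apply: nbhs_right_le; rewrite divr_gt0.
have [kappa [K_ge0 K_mass]] := @mollifier_exists R n d d0.
(* the accuracy of the caloric approximation is chosen after the kernel, since
   k derivatives of the mollification cost the mass of those of the kernel *)
have [e' e'0 He'] : exists2 e' : R, 0 < e' & forall a, (size a <= k)%N ->
    e' * JP (fun q => `|@K R n d kappa a q|) <= eps / 3.
  apply: near_right_ex; apply: near_words => a ak.
  set m := JP _; have m0 : 0 <= m by apply: J_ge0.
  near=> e'; have e1 : e' <= eps / 3 / (m + 1).
    by near: e'; apply: nbhs_right_le; rewrite divr_gt0 // ltr_wpDl.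
  rewrite (le_trans (ler_wpM2r m0 e1)) // mulrAC ler_pdivrMr ?ltr_wpDl //.
  by rewrite ler_pM2l // lerDl.
have [u0 [D [C [r [[cu cD] ur u2 du eq]]]]] :=
  caloric_approximation i0 s0 s1 c0 (cG [::] isT) e'0.
have {}ur q : r <= `|q| -> u0 q = 0.
  rewrite [q in u0 q]surjective_pairing prod_normE le_max => /orP rq; exact: ur.
pose u := M d kappa [::] u0.
have su : Coo_on (cylinder R n) u by exact: Coo_M ur.
exists u; split => //.
- exact: M_continuous.
- apply: (@compact_closure_bounded _ _ _ (r + d)) => p.
  by apply: contraNT; rewrite -ltNge => /ltW pr; apply/eqP; exact: M_supp ur pr.
- apply: (@mollified_equation R n s d kappa C r u0 D i0) => //.
  by move=> x t x2 t2; have [] := eq x t x2 t2.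
apply: Ck_norm_le => a p ak Op.
rewrite (partialsB (su k).1 fk.1 ak Op) /u (partials_M kappa d0 a cu ur).
have MG : M d kappa a (G [::]) p = M d kappa [::] (G a) p.
  apply: (@partials_M_inner R n d kappa (1 + 2 * dl) k G) => // b i z w bk Oz wz.
  apply: (is_derive_extension fk) => //.
  have z1 : gauge z < 1 by exact/cylinderP.
  have := Heta z w (cyl1 z Oz); rewrite distrC => /(_ (le_trans wz d2)).
  by rewrite ler_norml => /andP[H _]; lra.
have t1 : `|M d kappa a u0 p - M d kappa a (G [::]) p| <= eps / 3.
  have cN : continuous (fun q => - G [::] q) by apply: continuous_opp; exact: cG.
  have -> : M d kappa a u0 p - M d kappa a (G [::]) p =
      M d kappa a (fun q => u0 q + - G [::] q) p.
    rewrite MD //; congr (_ + _); under [in RHS]eq_fun do rewrite -mulN1r.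
    by rewrite MZ ?mulN1r //; exact: cG.
  apply: le_trans (He' a ak); apply: M_le => // [q|q qd].
    exact: (cvgD (cu q) (cN q)).
  have pq : `|p - q| <= 2.
    rewrite (le_trans (ler_normB _ _)) //; have := cyl1 p Op; lra.
  rewrite [p - q]surjective_pairing; apply: (eq _ _ _ _).2.
    by move: pq; rewrite prod_normE ge_max => /andP[].
  by move: pq; rewrite prod_normE ge_max => /andP[].
have t2 : `|M d kappa [::] (G a) p - G a p| <= eps / 3.
  by apply: M_close => // [|q qd]; [exact: cG|exact: Hd].
have t3 : `|G a p - partials a f p| <= eps / 3.
  by rewrite /G extension_cylinder //; exact: Hdl.
have -> : M d kappa a u0 p - partials a f p =
  (M d kappa a u0 p - M d kappa a (G [::]) p) +
  (M d kappa [::] (G a) p - G a p) + (G a p - partials a f p) by rewrite MG; ring.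
have -> : eps = eps / 3 + eps / 3 + eps / 3 by field.
rewrite (le_trans (ler_normD _ _)) // lerD // (le_trans (ler_normD _ _)) // lerD //.
Unshelve. all: by end_near. Qed.
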